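(* Let $d\in\mathbb{N}$, $a>b\ge0$ and $\mathrm{bc}\in\{\emptyset,\mathrm{per},\mathrm{Dir}\}$. For $\beta>0$, $\mu\in\mathbb{R}$, $\alpha\le0$, where the derivative on the right-hand side is defined, $$\Delta^{\mathrm{HYL}}(\beta,\mu,\alpha):=\lim_{K\to\infty}\lim_{N\to\infty}\mathbb{E}_{\nu^{\mathrm{HYL}}_{N,\mu,\alpha}}[D-D_K]=-\lim_{K\to\infty}\frac{d}{ds}\Big(\inf_{\ell_1(\mathbb{R})}\Big\{\frac1\beta I^{\mathrm{HYL}}_{\mu+s,\alpha}+sD_K\Big\}-p^{\mathrm{HYL}}(\beta,\mu+s,\alpha)\Big)\Big|_{s=0}.$$ In particular, if the infimum is achieved at $\xi(s)$ with $\xi\in C^1((-\epsilon,\epsilon);\ell_1)$ for some $\epsilon>0$ (that is, for each $K$ there are $\epsilon>0$ and a $C^1$ curve $s\mapsto\xi(s)=\xi^{(K)}(s)$ of minimisers of $\frac1\beta I^{\mathrm{HYL}}_{\mu+s,\alpha}+sD_K$, with a common value $\xi(0)$ at $s=0$), then $$\Delta^{\mathrm{HYL}}(\beta,\mu,\alpha)=\frac a{a-b}\Big(\frac{\mu+\alpha}a-D(\xi(0))\Big)_+=\Big(\frac\partial{\partial\mu}\big(H^{\mathrm{HYL}}_{\mu+\alpha}-H^{\mathrm{HYL}}_{\mu+\alpha,l.s.c.}\big)\Big)(\xi(0)),$$ the last derivative being taken in $\mu$ with the sequence held fixed and then evaluated at $\xi(0)$.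
   Context: $\Lambda_N=[-N,N]^d$, $|\Lambda_N|=(2N)^d$. For $\alpha\le0$ put $q_k^{(\alpha)}=\frac{e^{\beta\alpha k}}{(4\pi\beta)^{d/2}k^{1+d/2}}$, $\bar q^{(\alpha)}=\sum_kq_k^{(\alpha)}$. Let $g_t(x,y)=(4\pi t)^{-d/2}e^{-|x-y|^2/(4t)}$; $g_t^{(\mathrm{per})}(x,y)=\sum_{z\in\mathbb{Z}^d}g_t(x,y+2Nz)$; $g_t^{(\mathrm{Dir})}(x,y)$ the transition density of Brownian motion with generator $\Delta$ killed on leaving $\Lambda_N$. For $\mathrm{bc}=\emptyset$, $q_k^{(\mathrm{bc},\alpha)}=q_k^{(\alpha)}$ for all $k$; for $\mathrm{bc}\in\{\mathrm{per},\mathrm{Dir}\}$, $q_k^{(\mathrm{bc},\alpha)}=\frac{e^{\beta\alpha k}}{k|\Lambda_N|}\int_{\Lambda_N}g^{(\mathrm{bc})}_{k\beta}(x,x)\,dx$ for $k\le N$ and $0$ for $k>N$. Let $(\mathcal{N}_k)_k$ be independent Poisson variables with means $|\Lambda_N|q_k^{(\mathrm{bc},\alpha)}$ and $\nu^{(\mathrm{bc})}_{N,\alpha}$ the law of $(\mathcal{N}_k/|\Lambda_N|)_k$ on $\ell_1(\mathbb{R}_+)$. For $x\in\ell_1(\mathbb{R}_+)$: $D(x)=\sum_{k\ge1}kx_k$, $D_K(x)=\sum_{k=1}^Kkx_k$, $H^{\mathrm{HYL}}_\mu(x)=-\mu D(x)+\frac a2D(x)^2-\frac b2\sum_kk^2x_k^2$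 and $H^{\mathrm{HYL}}_{\mu,l.s.c.}(x)=H^{\mathrm{HYL}}_\mu(x)-\frac{(\mu-aD(x))_+^2}{2(a-b)}$ (both $+\infty$ if $D(x)=\infty$). HYL measure: $\nu^{\mathrm{HYL}}_{N,\mu,\alpha}(dx)=\frac1{Z_N}e^{-\beta|\Lambda_N|H^{\mathrm{HYL}}_\mu(x)}\nu^{(\mathrm{bc})}_{N,\alpha}(dx)$, $Z_N$ the normalising constant. $I(x)=\sum_kx_k(\log\frac{x_k}{q_k^{(0)}}-1)+\bar q^{(0)}$ on $\ell_1(\mathbb{R}_+)$, $+\infty$ elsewhere. $I^{\mathrm{HYL}}_{\mu,\alpha}=\beta H^{\mathrm{HYL}}_{\mu+\alpha,l.s.c.}+I-\inf_{y\in\ell_1(\mathbb{R})}\{\beta H^{\mathrm{HYL}}_{\mu+\alpha,l.s.c.}(y)+I(y)\}$. The limiting pressure is $p^{\mathrm{HYL}}(\beta,\mu,\alpha)=\frac1\beta\bar q^{(0)}-\frac1\beta\inf_{x\in\ell_1(\mathbb{R})}\{I(x)+\beta H^{\mathrm{HYL}}_{\mu+\alpha,l.s.c.}(x)\}$. $(t)_+=\max(t,0)$. *)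

(* Defs.v *)
From HB Require Import structures.
From mathcomp Require Import all_boot all_order all_algebra.
From mathcomp Require Import all_classical all_reals all_analysis.

Set Implicit Arguments.
Unset Strict Implicit.
Unset Printing Implicit Defensive.

Import Order.TTheory GRing.Theory Num.Theory.
Import numFieldNormedType.Exports.
Local Open Scope classical_set_scope.
Local Open Scope ring_scope.

(* Points of R^d are d-tuples, because tuples carry the product sigma-algebra. *)
Notation pointR R d := (d.-tuple (measurableTypeR R)).

Definition tadd (R : realType) (d : nat) (x y : pointR R d) : pointR R d :=
  [tuple tnth x i + tnth y i | i < d].

Definition tsub (R : realType) (d : nat) (x y : pointR R d) : pointR R d :=
  [tuple tnth x i - tnth y i | i < d].

Definition tzero (R : realType) (d : nat) : pointR R d := [tuple 0 | i < d].

Definition sqdist (R : realType) (d : nat) (x y : pointR R d) : R :=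
  \sum_(i < d) (tnth x i - tnth y i) ^+ 2.

(* d-dimensional Lebesgue measure, as an iterated product measure: the measure
   of A is the integral of the measures of its sections. *)
Fixpoint lebesgue_tuple (R : realType) (d : nat) : set (pointR R d) -> \bar R :=
  match d return set (pointR R d) -> \bar R with
  | 0%N => fun A => \d_([tuple] : pointR R 0) A
  | d'.+1 => fun A =>
      (\int[@lebesgue_measure R]_x
         lebesgue_tuple [set u : pointR R d' | A [tuple of x :: u]])%E
  end.

Definition box (R : realType) (d N : nat) : set (pointR R d) :=
  [set x | forall i, `|tnth x i| <= N%:R].

Definition vol (R : realType) (d N : nat) : R := (2 * N%:R) ^+ d.

Definition heat (R : realType) (d : nat) (t : R) (x y : pointR R d) : R :=
  (4 * pi * t) `^ (- (d%:R / 2)) * expR (- sqdist x y / (4 * t)).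

Definition heat_per (R : realType) (d N : nat) (t : R) (x y : pointR R d)
    : \bar R :=
  (\esum_(z in [set: d.-tuple int])
     (heat t x [tuple tnth y i + 2 * N%:R * (tnth z i)%:~R | i < d])%:E)%E.

(* Standard d-dimensional Brownian motion with generator the Laplacian (not
   half of it) started at 0: continuous paths and independent increments, the
   increment over [s, t] having density heat (t - s) 0. *)
Definition brownian (R : realType) (d : nat) (dO : measure_display)
    (Omega : measurableType dO) (P : probability Omega R) (B : R -> Omega -> pointR R d)
    : Prop :=
  [/\ forall t, 0 <= t -> measurable_fun [set: Omega] (B t),
      forall w, B 0 w = tzero R d,
      forall w i, {within `[0%R, +oo[, continuous (fun t : R => tnth (B t w) i : R)}
    & forall (n : nat) (t : nat -> R) (A : nat -> set (pointR R d)),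
        0 <= t 0%N -> (forall j, (j < n)%N -> t j < t j.+1) ->
        (forall j, measurable (A j)) ->
        P (\bigcap_(j in `I_n) [set w | A j (tsub (B (t j.+1) w) (B (t j) w))])
        = (\prod_(j < n) fine (\int[@lebesgue_tuple R d]_(y in A j)
                  (heat (t j.+1 - t j) (tzero R d) y)%:E))%:E ].

(* g is the transition density of Brownian motion killed on leaving the box.
   Such a density is only determined almost everywhere, and the theorem needs
   its values on the diagonal; continuity in the second variable (expressed on
   row vectors, tuples having no topology) selects the usual version. *)
Definition killed_density (R : realType) (d N : nat)
    (g : R -> pointR R d -> pointR R d -> R) : Prop :=
  exists (dO : measure_display) (Omega : measurableType dO) (P : probability Omega R)
    (B : R -> Omega -> pointR R d),
    brownian P B /\
    forall (t : R) (x : pointR R d), 0 < t -> box N x ->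
      {within [set v : 'rV[R]_d | box N ([tuple v ord0 i | i < d] : pointR R d)],
         continuous (fun v : 'rV[R]_d => g t x [tuple v ord0 i | i < d])} /\
      forall A : set (pointR R d), measurable A -> A `<=` box N ->
        P [set w | A (tadd x (B t w)) /\
                   forall s, 0 <= s <= t -> box N (tadd x (B s w))]
        = (\int[@lebesgue_tuple R d]_(y in A) (g t x y)%:E)%E.

Variant bcond := Free | Per | Dir.

Section model.
Context {R : realType}.

Definition q (d : nat) (beta alpha : R) (k : nat) : R :=
  expR (beta * alpha * k%:R) /
  ((4 * pi * beta) `^ (d%:R / 2) * k%:R `^ (1 + d%:R / 2)).

Definition qbar (d : nat) (beta alpha : R) : \bar R :=
  (\sum_(0 <= k <oo) (q d beta alpha k.+1)%:E)%E.

Definition q_cut (d N : nat) (beta alpha : R) (g : R -> pointR R d -> \bar R)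
    (k : nat) : R :=
  if (k <= N)%N then
    expR (beta * alpha * k%:R) / (k%:R * vol R d N) *
    fine (\int[@lebesgue_tuple R d]_(x in box N) g (k%:R * beta)%R x)%E
  else 0.

Definition q_bc (bc : bcond) (d N : nat)
    (gDir : R -> pointR R d -> pointR R d -> R) (beta alpha : R) (k : nat) : R :=
  match bc with
  | Free => q d beta alpha k
  | Per => q_cut N beta alpha (fun t (x : pointR R d) => heat_per N t x x) k
  | Dir => q_cut N beta alpha (fun t (x : pointR R d) => (gDir t x x)%:E) k
  end.

(* The last argument of poisson_prob is a dummy in the library; rate 0 gives
   the Dirac mass at 0. *)
Definition independent_poisson (dO : measure_display) (Omega : measurableType dO)
    (P : probability Omega R) (X : nat -> {RV P >-> nat}) (rate : nat -> R)
    : Prop :=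
  (forall k (A : set nat), distribution P (X k) A = poisson_prob (rate k) 0 A)
  /\
  (forall (s : seq nat) (A : nat -> set nat), uniq s ->
     P (\bigcap_(k in [set` s]) (X k @^-1` A k))
     = (\prod_(k <- s) fine (P (X k @^-1` A k)))%:E).

(* A sequence (x_k)_{k >= 1} is encoded with a shift: x k stands for x_{k+1}.
   The coordinate sigma-algebra induces on l_1 its Borel sigma-algebra. *)
Definition coord_sets : set (set (nat -> R)) :=
  [set A | exists k (B : set (measurableTypeR R)),
     measurable B /\ A = [set x | B (x k)]].

Definition seqspace := g_sigma_algebraType coord_sets.

Definition ell1norm (x : nat -> R) : \bar R :=
  (\sum_(0 <= k <oo) `|x k|%:E)%E.

Definition ell1 : set (nat -> R) := [set x | (ell1norm x < +oo)%E].

Definition ell1_plus : set (nat -> R) := [set x | ell1 x /\ forall k, 0 <= x k].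

Definition D (x : nat -> R) : \bar R :=
  (\sum_(0 <= k <oo) (k.+1%:R * x k)%:E)%E.

Definition D_trunc (K : nat) (x : nat -> R) : R :=
  \sum_(0 <= k < K) k.+1%:R * x k.

Definition sumsq (x : nat -> R) : \bar R :=
  (\sum_(0 <= k <oo) (k.+1%:R ^+ 2 * x k ^+ 2)%:E)%E.

(* The Hamiltonians are given on nonnegative sequences only; they are extended
   by +oo to the other sequences, where the rate function is +oo as well. *)
Definition H_HYL (a b mu : R) (x : nat -> R) : \bar R :=
  if `[< ell1_plus x /\ (D x < +oo)%E >] then
    (- mu * fine (D x) + a / 2 * fine (D x) ^+ 2 - b / 2 * fine (sumsq x))%:E
  else +oo%E.

Definition H_HYL_lsc (a b mu : R) (x : nat -> R) : \bar R :=
  (H_HYL a b mu x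
   - (Num.max (mu - a * fine (D x)) 0 ^+ 2 / (2 * (a - b)))%:E)%E.

(* ln 0 = 0 in the library, whence the usual convention 0 log 0 = 0. *)
Definition rateI (d : nat) (beta : R) (x : nat -> R) : \bar R :=
  if `[< ell1_plus x >] then
    (\sum_(0 <= k <oo) (x k * (ln (x k / q d beta 0 k.+1) - 1))%:E
     + qbar d beta 0)%E
  else +oo%E.

Definition inf_ell1 (f : (nat -> R) -> \bar R) : \bar R :=
  ereal_inf [set f x | x in ell1].

Definition I_HYL (d : nat) (a b beta mu alpha : R) (x : nat -> R) : \bar R :=
  (beta%:E * H_HYL_lsc a b (mu + alpha) x + rateI d beta x
   - inf_ell1 (fun y =>
       beta%:E * H_HYL_lsc a b (mu + alpha) y + rateI d beta y))%E.

Definition pressure (d : nat) (a b beta mu alpha : R) : \bar R :=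
  ((beta^-1)%:E * qbar d beta 0
   - (beta^-1)%:E * inf_ell1 (fun x =>
       rateI d beta x + beta%:E * H_HYL_lsc a b (mu + alpha) x))%E.

Definition tilted_rate (d : nat) (a b beta mu alpha : R) (K : nat) (s : R)
    (x : nat -> R) : \bar R :=
  ((beta^-1)%:E * I_HYL d a b beta (mu + s) alpha x
   + (s * D_trunc K x)%:E)%E.

(* The extended real under fine is always finite. *)
Definition tilted_pressure (d : nat) (a b beta mu alpha : R) (K : nat) (s : R)
    : R :=
  fine (inf_ell1 (tilted_rate d a b beta mu alpha K s)
        - pressure d a b beta (mu + s) alpha)%E.

Definition nu_ref (d N : nat) (dO : measure_display) (Omega : measurableType dO)
    (P : probability Omega R) (X : nat -> {RV P >-> nat}) : set seqspace -> \bar R :=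
  pushforward P (fun w => (fun k => (X k w)%:R / vol R d N) : seqspace).

Definition boltzmann (d N : nat) (a b beta mu : R) (x : seqspace) : \bar R :=
  expeR (- ((beta * vol R d N)%:E * H_HYL a b mu x))%E.

Definition nu_HYL (d N : nat) (a b beta mu : R) (nu : set seqspace -> \bar R)
    : set seqspace -> \bar R := fun A =>
  ((fine (\int[nu]_x boltzmann d N a b beta mu x))^-1%:E
   * \int[nu]_(x in A) boltzmann d N a b beta mu x)%E.

Definition mean_long (d N K : nat) (a b beta mu : R)
    (nu : set seqspace -> \bar R) : \bar R :=
  (\int[nu_HYL d N a b beta mu nu]_x (D x - (D_trunc K x)%:E))%E.

Definition iterated_lim (E : nat -> nat -> \bar R) (l : R) : Prop :=
  exists L : nat -> R,
    (\forall K \near \oo, E K N @[N --> \oo] --> (L K)%:E) /\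
    L K @[K --> \oo] --> l.

Definition C1_ell1 (eps : R) (xi : R -> nat -> R) : Prop :=
  exists dxi : R -> nat -> R, forall s, - eps < s < eps ->
    [/\ ell1 (xi s), ell1 (dxi s),
        ell1norm (fun k => (xi (s + h) k - xi s k) / h - dxi s k)
          @[h --> 0^'] --> 0%E
      & ell1norm (fun k => dxi r k - dxi s k) @[r --> s] --> 0%E].

Definition is_minimiser (f : (nat -> R) -> \bar R) (x : nat -> R) : Prop :=
  ell1 x /\ f x = inf_ell1 f.

End model.

Arguments seqspace : clear implicits.

(* Main.v *)
(* Loops of diverging length form a condensate: it contributes its mass to [D]
   but is invisible to every coordinate, and optimising over its mass [del]
   turns [H_HYL] into [H_HYL_lsc], the optimal mass being
   [(mu + alpha - a D)_+ / (a - b)]. Approximating the condensate by loops of a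
   single large length identifies [tilted_pressure K s] with an infimum over
   finite data. The same infimum is the limit of the finite-volume pressures
   tilted by [s (D - D_K)]: from below by one configuration close to a
   minimiser, from above because the energy is at least its minimal free energy
   minus an entropy term, so that the Gibbs weight is at most a product of
   functions of the independent Poisson variables. These pressures are convex in [s]
   with derivative at 0 the mean of [D - D_K], so the derivatives converge
   wherever the limit is derivable. Along a curve of minimisers an envelope
   argument computes that derivative.

   Only three facts about the boundary conditions matter: the weights are
   nonnegative, converge to the free ones, and are dominated by them up to a
   factor tending to 1. Periodic weights are an explicit lattice sum. The killed
   density is below the heat kernel on the diagonal, and a decomposition at the
   first exit along a dyadic grid shows that, at distance [M] from the boundary,
   it is smaller by at most a quantity vanishing as [M] grows. *)

Require Import Defs.
From HB Require Import structures.
From mathcomp Require Import all_boot all_order all_algebra.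
From mathcomp Require Import all_classical all_reals all_analysis.
From mathcomp Require Import measurable_realfun ring lra.

Import Order.TTheory GRing.Theory Num.Theory.
Import numFieldNormedType.Exports.
Local Open Scope classical_set_scope.
Local Open Scope ring_scope.

Set Implicit Arguments.
Unset Strict Implicit.

(** * Free energy with a condensate *)

Lemma sum_sqr_le_sqr_sum (R : realFieldType) (y : nat -> R) (m n : nat) :
  (forall k, 0 <= y k) ->
  \sum_(m <= k < n) y k ^+ 2 <= (\sum_(m <= k < n) y k) ^+ 2.
Proof.
move=> y0; have [mn|/ltnW nm] := leqP m n; last first.
  by rewrite !big_geq// expr0n.
rewrite -(subnKC mn); elim: (n - m)%N => [|p IH].
  by rewrite addn0 !big_geq// expr0n.
rewrite addnS !big_nat_recr ?leq_addr//= sqrrD -addrA lerD//.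
rewrite lerDr mulrn_wge0// mulr_ge0// sumr_ge0// => i _; exact: y0.
Qed.

Section finite_data.
Context {R : realType}.
Implicit Types (x y w : nat -> R).

Definition sumsq_trunc L x : R := \sum_(0 <= k < L) k.+1%:R ^+ 2 * x k ^+ 2.

Definition ent_trunc (q0 : nat -> R) L x : R := \sum_(0 <= k < L) x k * (ln (x k / q0 k) - 1).

(* [Q] is the total mass of [q0]; [del] is the mass of a condensate, carried by
   infinitely long loops and therefore invisible to every coordinate of [x]. *)
Definition free_energy (a b beta : R) (q0 : nat -> R) (Q : R) K L x (del m s : R) : R :=
  - (m + s) * (D_trunc L x + del) + a / 2 * (D_trunc L x + del) ^+ 2
  - b / 2 * (sumsq_trunc L x + del ^+ 2) + s * D_trunc K x
  + beta^-1 * (ent_trunc q0 L x + Q).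

Definition min_energy (a b beta : R) (q0 : nat -> R) (Q : R) K m s : R :=
  inf [set e | exists L x, [/\ (K <= L)%N, forall k, 0 <= x k
                             & e = free_energy a b beta q0 Q K L x 0 m s]].

Lemma entropy_term_ge0 (x q0 : R) : 0 <= x -> 0 < q0 ->
  0 <= x * (ln (x / q0) - 1) + q0.
Proof.
rewrite le_eqVlt => /orP[/eqP <- q00|x0 q00]; first by rewrite mul0r add0r ltW.
have h : ln (1 + (q0 / x - 1)) <= q0 / x - 1.
  by apply: le_ln1Dx; rewrite ltrBrDl subrr divr_gt0.
have -> : ln (x / q0) = - ln (1 + (q0 / x - 1)).
  by rewrite addrC subrK -lnV ?posrE ?divr_gt0// invf_div.
have : x * ln (1 + (q0 / x - 1)) <= x * (q0 / x - 1) by rewrite ler_wpM2l// ltW.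
have -> : x * (q0 / x - 1) = q0 - x by field; rewrite gt_eqF.
lra.
Qed.

Lemma D_trunc_ge0 K x : (forall k, 0 <= x k) -> 0 <= D_trunc K x.
Proof. by move=> x0; apply: sumr_ge0 => k _; rewrite mulr_ge0. Qed.

Lemma D_trunc_nd K L x : (forall k, 0 <= x k) -> (K <= L)%N ->
  D_trunc K x <= D_trunc L x.
Proof.
move=> x0 KL; rewrite /D_trunc [leRHS](big_cat_nat (leq0n K) KL)//= lerDl.
by apply: sumr_ge0 => k _; rewrite mulr_ge0.
Qed.

Lemma sumsq_trunc_le K L x : (forall k, 0 <= x k) -> (K <= L)%N ->
  sumsq_trunc L x <= sumsq_trunc K x + (D_trunc L x - D_trunc K x) ^+ 2.
Proof.
move=> x0 KL; rewrite /sumsq_trunc /D_trunc.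
rewrite [X in X <= _](big_cat_nat (leq0n K) KL)/= lerD2l.
rewrite [X in X - _](big_cat_nat (leq0n K) KL)/= [X in X ^+ 2]addrAC subrr add0r.

under eq_bigr do rewrite -exprMn.
by apply: sum_sqr_le_sqr_sum => k; rewrite mulr_ge0.
Qed.

Section positive_weights.
Variables (q0 : nat -> R) (Q : R).
Hypothesis q0_gt0 : forall k, 0 < q0 k.
Hypothesis q0Q : series q0 @ \oo --> Q.

Lemma series_le_total L : series q0 L <= Q.
Proof.
rewrite -(cvg_lim _ q0Q)//; apply: nondecreasing_cvgn_le; last by apply: cvgP q0Q.
apply/nondecreasing_seqP => n.
by rewrite -subr_ge0 seriesSB ltW.
Qed.

Lemma ent_trunc_ge L x : (forall k, 0 <= x k) ->
  - series q0 L <= ent_trunc q0 L x.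
Proof.
move=> x0; rewrite -subr_ge0 opprK /series/= -big_split/=.
by apply: sumr_ge0 => k _; exact: entropy_term_ge0.
Qed.

Variables (a b beta : R).
Hypotheses (b_ge0 : 0 <= b) (ba : b < a) (beta_gt0 : 0 < beta).

Lemma free_energy_ge K L x del m s : (forall k, 0 <= x k) -> 0 <= del ->
  (K <= L)%N ->
  - (`|m| + 2 * `|s|) * (D_trunc L x + del)
    + (a - b) / 2 * (D_trunc L x + del) ^+ 2
  <= free_energy a b beta q0 Q K L x del m s.
Proof.
move=> x0 d0 KL; rewrite /free_energy.
have e0 : 0 <= beta^-1 * (ent_trunc q0 L x + Q).
  rewrite mulr_ge0 ?invr_ge0 ?(ltW beta_gt0)//.
  have := ent_trunc_ge L x0; have := series_le_total L; lra.
have DL0 := D_trunc_ge0 L x0.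
have DK0 := D_trunc_ge0 K x0.
have DKL := D_trunc_nd x0 KL.
have S0 : sumsq_trunc L x <= D_trunc L x ^+ 2.
  have := sumsq_trunc_le x0 (leq0n L).
  by rewrite /sumsq_trunc /D_trunc [in X in X + _]big_geq// [in X in _ - X]big_geq// add0r subr0.
have h1 : (m + s) * (D_trunc L x + del) <= (`|m| + `|s|) * (D_trunc L x + del).
  by apply: ler_wpM2r; [lra|rewrite lerD// ler_norm].
have h2 : - (`|s| * (D_trunc L x + del)) <= s * D_trunc K x.
  have : - s * D_trunc K x <= `|s| * D_trunc K x.
    by apply: ler_wpM2r => //; rewrite -normrN ler_norm.
  have : `|s| * D_trunc K x <= `|s| * (D_trunc L x + del).
    by apply: ler_wpM2l => //; lra.
  lra.
have h3 : b / 2 * (sumsq_trunc L x + del ^+ 2) <= b / 2 * (D_trunc L x + del) ^+ 2.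
  apply: ler_wpM2l; first by rewrite divr_ge0.
  have : 0 <= D_trunc L x * del by apply: mulr_ge0.
  nra.
lra.
Qed.

Let energies K m s := [set e | exists L x, [/\ (K <= L)%N, forall k, 0 <= x k
                             & e = free_energy a b beta q0 Q K L x 0 m s]].

Let has_inf_energies K m s : has_inf (energies K m s).
Proof.
split.
  by exists (free_energy a b beta q0 Q K K (fun=> 0) 0 m s), K, (fun=> 0); split.
exists (- (`|m| + 2 * `|s|) ^+ 2 / (2 * (a - b))) => _ [L [x [KL x0 ->]]].
apply: le_trans (free_energy_ge m s x0 (lexx 0) KL).
set c := _ + _ * _; set r := _ + 0.
have ab0 : 0 < a - b by rewrite subr_gt0.
rewrite ler_pdivrMr; last by lra.
have := sqr_ge0 (c - (a - b) * r); nra.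
Qed.

Lemma min_energy_le0 K L x m s : (K <= L)%N -> (forall k, 0 <= x k) ->
  min_energy a b beta q0 Q K m s <= free_energy a b beta q0 Q K L x 0 m s.
Proof.
move=> KL x0; apply: ge_inf; first by case: (has_inf_energies K m s).
by exists L, x; split.
Qed.

Lemma min_energy_adherent K m s eps : 0 < eps ->
  exists L x, [/\ (K <= L)%N, forall k, 0 <= x k
    & free_energy a b beta q0 Q K L x 0 m s < min_energy a b beta q0 Q K m s + eps].
Proof.
move=> e0; have [_ [L [x [KL x0 ->]] h]] := inf_adherent e0 (has_inf_energies K m s).
by exists L, x; split.
Qed.

Lemma free_energy_optimal_condensate K L x del m s : 0 <= del ->
  let del' := Num.max (m + s - a * D_trunc L x) 0 / (a - b) in
  free_energy a b beta q0 Q K L x del' m s + (a - b) / 2 * (del - del') ^+ 2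
  <= free_energy a b beta q0 Q K L x del m s.
Proof.
move=> del0 /=; rewrite /free_energy.
have ab0 : 0 < a - b by rewrite subr_gt0.
move: (D_trunc L x) (sumsq_trunc L x) (s * D_trunc K x) (beta^-1 * _).
move=> r S c e; set u := m + s - a * r.
have -> : m + s = u + a * r by rewrite /u; ring.
have [u0|u0] := leP u 0.
  rewrite mul0r; have : 0 <= (- u) * del by rewrite mulr_ge0// oppr_ge0.
  lra.
have := divfK (lt0r_neq0 ab0) u; move: (u / (a - b)) => v <-.
lra.
Qed.

Lemma min_energy_le K L x del m s : (K <= L)%N -> (forall k, 0 <= x k) ->
  (fun M => ln (q0 M) / M.+1%:R) @ \oo --> (0 : R) -> 0 <= del ->
  min_energy a b beta q0 Q K m s <= free_energy a b beta q0 Q K L x del m s.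
Proof.
move=> KL x0 hlog del0.
(* The condensate is approximated by loops of a single large length [M + 1]. *)
pose y M k := if (k < L)%N then x k else if k == M then del / M.+1%:R else 0.
have y0 M k : 0 <= y M k.
  by rewrite /y; case: ifPn => // _; case: ifPn => // _; rewrite divr_ge0.
have sum_y (F : nat -> R -> R) M : (forall k, F k 0 = 0) -> (L <= M)%N ->
    \sum_(0 <= k < M.+1) F k (y M k) =
    \sum_(0 <= k < L) F k (x k) + F M (del / M.+1%:R).
  move=> F0 LM; rewrite (big_cat_nat (leq0n L))/=; last exact: leqW.
  congr (_ + _).
    by apply: eq_big_nat => k /andP[_ kL]; rewrite /y kL.
  rewrite big_nat_recr//= [in X in X + _]big_nat big1 ?add0r.
    by rewrite /y ltnNge LM/= eqxx.
  by move=> k /andP[Lk kM]; rewrite /y ltnNge Lk/= (ltn_eqF kM) F0.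
have M1 M : (M.+1%:R : R) != 0 by [].
have DMy M : (L <= M)%N -> D_trunc M.+1 (y M) = D_trunc L x + del.
  move=> LM; rewrite /D_trunc (sum_y (fun k t => k.+1%:R * t))//.
    by rewrite mulrCA divff// mulr1.
  by move=> k; rewrite mulr0.
have SMy M : (L <= M)%N -> sumsq_trunc M.+1 (y M) = sumsq_trunc L x + del ^+ 2.
  move=> LM; rewrite /sumsq_trunc (sum_y (fun k t => k.+1%:R ^+ 2 * t ^+ 2))//.
    by rewrite -exprMn mulrCA divff// mulr1.
  by move=> k; rewrite expr0n mulr0.
have DKy M : D_trunc K (y M) = D_trunc K x.
  apply: eq_big_nat => k /andP[_ kK].
  by rewrite /y (leq_trans kK KL).
have EMy M : (L <= M)%N -> ent_trunc q0 M.+1 (y M) = ent_trunc q0 L x +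
    del / M.+1%:R * (ln (del / M.+1%:R / q0 M) - 1).
  move=> LM; rewrite /ent_trunc (sum_y (fun k t => t * (ln (t / q0 k) - 1)))//.
  by move=> k; rewrite mul0r.
pose c M := beta^-1 * (del * (ln del - 1) * M.+1%:R^-1 - del * (ln (q0 M) / M.+1%:R)).
have hc : c @ \oo --> 0.
  rewrite -[0](mulr0 beta^-1); apply: cvgM; first exact: cvg_cst.
  rewrite -[X in _ --> X]subr0; apply: cvgB.
    rewrite -(mulr0 (del * (ln del - 1))); apply: cvgM; first exact: cvg_cst.
    exact: cvg_harmonic.
  by rewrite -(mulr0 del); apply: cvgM; [exact: cvg_cst|].
rewrite -[leRHS]addr0.
have /cvg_lim <- : free_energy a b beta q0 Q K L x del m s + c M @[M --> \oo] -->
    free_energy a b beta q0 Q K L x del m s + 0.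
  by apply: cvgD => //; exact: cvg_cst.
2: by [].
apply: limr_ge.
  by apply: is_cvgD; [exact: is_cvg_cst|exact: cvgP hc].
near=> M.
have LM : (L <= M)%N by near: M; exact: nbhs_infty_ge.
have KM : (K <= M.+1)%N by exact: leq_trans KL (leqW LM).
apply: le_trans (min_energy_le0 m s KM (y0 M)) _.
rewrite /free_energy DMy// SMy// DKy EMy// addr0 expr0n/= addr0.
set E := del / M.+1%:R * _.
have hE : beta^-1 * E <= c M.
  rewrite /c ler_wpM2l ?invr_ge0 ?(ltW beta_gt0)// /E.
  have [->|/eqP del_neq0] := eqVneq del 0; first by rewrite !mul0r subrr.
  have del_gt0 : 0 < del by rewrite lt0r; apply/andP; split => //; apply/eqP.
  rewrite ln_div ?posrE ?divr_gt0// ln_div ?posrE//.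
  have lnM0 : 0 <= ln M.+1%:R :> R by rewrite ln_ge0// ler1n.
  have : 0 <= del / M.+1%:R * ln M.+1%:R by rewrite mulr_ge0// divr_ge0.
  move: (ln M.+1%:R) (ln (q0 M)) (ln del) (M.+1%:R^-1) => u v w z; lra.
rewrite -/(c M); move: (c M) hE => cM; lra.
Unshelve. all: by end_near.
Qed.

Lemma min_energy_concave K m s t : 0 <= t <= 1 ->
  (1 - t) * min_energy a b beta q0 Q K m s
    + t * min_energy a b beta q0 Q K (m + 1) s
  <= min_energy a b beta q0 Q K (m + t) s.
Proof.
move=> /andP[t0 t1]; apply: lb_le_inf; first by case: (has_inf_energies K (m + t) s).
move=> _ [L [x [KL x0 ->]]].
have -> : free_energy a b beta q0 Q K L x 0 (m + t) s =
   (1 - t) * free_energy a b beta q0 Q K L x 0 m s +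
   t * free_energy a b beta q0 Q K L x 0 (m + 1) s.
  by rewrite /free_energy; ring.
by apply: lerD; apply: ler_wpM2l; rewrite ?subr_ge0//; exact: min_energy_le0.
Qed.

End positive_weights.
End finite_data.

Section nonnegative_series.
Context {R : realType}.

Lemma nneseries_fine_cvg (u : nat -> R) : (forall k, 0 <= u k) ->
  (\sum_(0 <= k <oo) (u k)%:E < +oo)%E ->
  series u @ \oo --> fine (\sum_(0 <= k <oo) (u k)%:E)%E.
Proof.
move=> u0 uoo; have cu := @is_cvg_nneseries R (fun k => (u k)%:E) xpredT 0%N
  (fun n _ _ => u0 n).
have S_fin : (\sum_(0 <= k <oo) (u k)%:E)%E \is a fin_num.
  by rewrite ge0_fin_numE// nneseries_ge0// => k _ _; rewrite lee_fin.
move: cu; rewrite /= -[X in _ --> X]fineK// => /fine_cvgP[_].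
by rewrite (_ : fine \o _ = series u)//; apply/funext => n/=; rewrite sumEFin.
Qed.

Lemma nneseries_EFin_cvg (u : nat -> R) (l : R) : (forall k, 0 <= u k) ->
  series u @ \oo --> l -> (\sum_(0 <= k <oo) (u k)%:E)%E = l%:E.
Proof.
move=> u0 ul; apply: cvg_lim => //.
rewrite (_ : (fun n => _) = EFin \o series u); last first.
  by apply/funext => n/=; rewrite sumEFin.
by apply/fine_cvgP; split => //; exact: nearW.
Qed.

End nonnegative_series.

Section loop_weights.
Context {R : realType}.
Variables (d : nat) (beta : R).
Hypotheses (d_gt0 : (0 < d)%N) (beta_gt0 : 0 < beta).

Lemma q_gt0 alpha k : 0 < q d beta alpha k.+1.
Proof.
rewrite /q divr_gt0 ?expR_gt0// mulr_gt0// powR_gt0//.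
by rewrite !mulr_gt0// pi_gt0.
Qed.

Lemma q_tilt alpha k : q d beta alpha k = expR (beta * alpha * k%:R) * q d beta 0 k.
Proof. by rewrite /q mulr0 mul0r expR0 mul1r. Qed.

Lemma series_pow32_le (n : nat) :
  series (fun k => (k.+1%:R : R) `^ (- (1 + 2^-1))) n.+1 <= 3 - 2 / Num.sqrt n.+1%:R.
Proof.
have pow32 (k : nat) : (k.+1%:R : R) `^ (- (1 + 2^-1)) = (Num.sqrt k.+1%:R ^+ 3)^-1.
  rewrite powRN powRD ?pnatr_eq0 ?implybT// powRr1// powR12_sqrt//.
  by rewrite exprS sqr_sqrtr// mulrC.
elim: n => [|n IH].
  by rewrite /series/= big_nat1 pow32 sqrtr1 expr1n invr1; lra.
rewrite seriesSr.
apply: le_trans (lerD IH (lexx _)) _; rewrite pow32.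
set v := Num.sqrt n.+2%:R; set u := Num.sqrt n.+1%:R.
have u0 : 0 < u by rewrite sqrtr_gt0.
have v0 : 0 < v by rewrite sqrtr_gt0.
have uv : v ^+ 2 = u ^+ 2 + 1 by rewrite !sqr_sqrtr// -natr1.
have ulev : u <= v by rewrite ler_sqrt// ler_nat.
rewrite -subr_ge0.
have -> : 3 - 2 / v - (3 - 2 / u + (v ^+ 3)^-1)
    = (2 * v ^+ 2 * (v - u) - u) / (v ^+ 3 * u).
  by field; rewrite !gt_eqF.
rewrite divr_ge0// ?mulr_ge0 ?exprn_ge0 ?(ltW u0) ?(ltW v0)//.
have h : (v - u) * (v + u) = 1 by rewrite -subr_sqr uv; ring.
have h2 : 0 < v - u by have := ltr01 (R := R); rewrite -h pmulr_lgt0// addr_gt0.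
nra.
Qed.

Lemma is_cvg_series_q : cvgn (series (fun k => q d beta 0 k.+1)).
Proof.
pose c := (4 * pi * beta) `^ (d%:R / 2).
have c0 : 0 < c by rewrite powR_gt0// !mulr_gt0// pi_gt0.
apply: nondecreasing_is_cvgn.
  by apply/nondecreasing_seqP => n; rewrite -subr_ge0 seriesSB ltW// q_gt0.
exists (c^-1 * 3) => _ [n _ <-].
apply: (@le_trans _ _ (series (fun k => q d beta 0 k.+1) n.+1)).
  by rewrite -subr_ge0 seriesSB ltW// q_gt0.
have h : series (fun k => (k.+1%:R : R) `^ (- (1 + 2^-1))) n.+1 <= 3.
  by apply: (le_trans (series_pow32_le n)); rewrite gerBl divr_ge0// sqrtr_ge0.
apply: le_trans (ler_wpM2l _ h); last by rewrite invr_ge0 ltW.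
rewrite /series/= mulr_sumr; apply: ler_sum => k _.
rewrite /q mulr0 mul0r expR0 div1r invfM ler_wpM2l ?invr_ge0 ?(ltW c0)//.
rewrite -powRN ler_powR ?ler1n// lerN2 lerD2l ler_pdivlMr// mulVf//.
by rewrite ler1n.
Qed.

Lemma cvg_ln_div : (fun M => ln (M.+1%:R : R) / M.+1%:R) @ \oo --> (0 : R).
Proof.
have h : (fun M => 2 * Num.sqrt (M.+1%:R^-1)) @ \oo --> (0 : R).
  rewrite -(mulr0 2); apply: cvgM; first exact: cvg_cst.
  rewrite -[X in _ --> X](sqrtr0 R).
  by apply: continuous_cvg; [exact: sqrt_continuous|exact: cvg_harmonic].
apply: squeeze_cvgr (cvg_cst 0) h; near=> M.
have M0 : 0 < M.+1%:R :> R by [].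
have s0 : 0 < Num.sqrt M.+1%:R :> R by rewrite sqrtr_gt0.
rewrite divr_ge0 ?ln_ge0 ?ler1n//= sqrtrV// ler_pdivrMr//.
rewrite -[X in ln X](sqr_sqrtr (ltW M0)) -[X in _ * X](sqr_sqrtr (ltW M0)).
rewrite lnXn// expr2 mulrA -(mulrA 2) mulVf ?gt_eqF// mulr1 -[leLHS]mulr_natl.
by rewrite ler_pM2l// ltW// ln_sublinear.
Unshelve. all: by end_near. Qed.

Lemma cvg_ln_q_div : (fun M => ln (q d beta 0 M.+1) / M.+1%:R) @ \oo --> (0 : R).
Proof.
pose c := (4 * pi * beta) `^ (d%:R / 2).
have c0 : 0 < c by rewrite powR_gt0// !mulr_gt0// pi_gt0.
rewrite (_ : (fun M => _) = fun M => - ln c * M.+1%:R^-1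
   + - (1 + d%:R / 2) * (ln M.+1%:R / M.+1%:R)).
  rewrite -[0]addr0; apply: cvgD.
    rewrite -(mulr0 (- ln c)); apply: cvgM; first exact: cvg_cst.
    exact: cvg_harmonic.
  rewrite -(mulr0 (- (1 + d%:R / 2))); apply: cvgM; first exact: cvg_cst.
  exact: cvg_ln_div.
apply/funext => M.
have -> : q d beta 0 M.+1 = (c * M.+1%:R `^ (1 + d%:R / 2))^-1.
  by rewrite /q mulr0 mul0r expR0 div1r.
have M0 : 0 < M.+1%:R `^ (1 + d%:R / 2) :> R by rewrite powR_gt0.
rewrite lnV ?posrE ?mulr_gt0// (lnM c0 M0).
rewrite (ln_powR (M.+1%:R : R)).
move: (ln c) (ln M.+1%:R) (M.+1%:R^-1) => u v w; ring.
Qed.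

End loop_weights.

(** * Variational formula *)

Section variational_formula.
Context {R : realType}.
Variables (d : nat) (a b beta : R).
Hypotheses (d_gt0 : (0 < d)%N) (b_ge0 : 0 <= b) (ba : b < a).
Hypothesis (beta_gt0 : 0 < beta).
Implicit Types x : nat -> R.

Definition q_total : R := limn (series (fun k => q d beta 0 k.+1)).

Lemma series_q_cvg : series (fun k => q d beta 0 k.+1) @ \oo --> q_total.
Proof. exact: is_cvg_series_q. Qed.

Let q_pos := fun k => q_gt0 d beta_gt0 0 k.

Lemma qbar_fin : qbar d beta 0 = q_total%:E.
Proof.
by apply: nneseries_EFin_cvg; [move=> k; rewrite ltW//|exact: series_q_cvg].
Qed.

Lemma rateI_nneseries x : ell1_plus x -> rateI d beta x =
  (\sum_(0 <= k <oo) (x k * (ln (x k / q d beta 0 k.+1) - 1) + q d beta 0 k.+1)%:E)%E.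
Proof.
move=> ex; have [_ x0] := ex; rewrite /rateI asboolT// qbar_fin.
set V := (X in _ = X).
have hV : (fun n => \sum_(0 <= k < n)
    (x k * (ln (x k / q d beta 0 k.+1) - 1) + q d beta 0 k.+1)%:E)%E @ \oo --> V.
  apply: is_cvg_nneseries => k _ _; rewrite lee_fin; exact: entropy_term_ge0.
have hQ : (fun n => (series (fun k => q d beta 0 k.+1) n)%:E) @ \oo --> q_total%:E.
  by apply/fine_cvgP; split; [exact: nearW|exact: series_q_cvg].
have -> : (\sum_(0 <= k <oo) (x k * (ln (x k / q d beta 0 k.+1) - 1))%:E = V - q_total%:E)%E.
  apply/cvg_lim => //.
  rewrite (_ : (fun n => _) = fun n => ((\sum_(0 <= k < n)
    (x k * (ln (x k / q d beta 0 k.+1) - 1) + q d beta 0 k.+1)%:E)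
     - (series (fun k => q d beta 0 k.+1) n)%:E)%E).
    by apply: cvgeB => //; rewrite fin_num_adde_defl.
  apply/funext => n; rewrite !sumEFin -EFinB big_split/=.
  by rewrite addrK.
by rewrite subeK.
Qed.

Lemma rateI_ge0 x : (0 <= rateI d beta x)%E.
Proof.
have [ex|nex] := pselect (ell1_plus x); last by rewrite /rateI asboolF.
rewrite rateI_nneseries//; apply: nneseries_ge0 => k _ _; rewrite lee_fin.
by apply: entropy_term_ge0 => //; case: ex.
Qed.

Definition finite_energy x : Prop :=
  [/\ ell1_plus x, (D x < +oo)%E & (rateI d beta x < +oo)%E].

Definition energy K m s x : R :=
  - (m + s) * fine (D x) + a / 2 * fine (D x) ^+ 2 - b / 2 * fine (sumsq x)
  - Num.max (m + s - a * fine (D x)) 0 ^+ 2 / (2 * (a - b))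
  + s * D_trunc K x + beta^-1 * fine (rateI d beta x).

Lemma D_trunc_cvg x : (forall k, 0 <= x k) -> (D x < +oo)%E ->
  (fun L => D_trunc L x) @ \oo --> fine (D x).
Proof.
by move=> x0; apply: nneseries_fine_cvg => k; rewrite mulr_ge0.
Qed.

Lemma D_trunc_le_D x L : (forall k, 0 <= x k) -> (D x < +oo)%E ->
  D_trunc L x <= fine (D x).
Proof.
move=> x0 Dx; have h := D_trunc_cvg x0 Dx.
rewrite -(cvg_lim _ h)//; apply: nondecreasing_cvgn_le; last exact: cvgP h.
by move=> m n mn; exact: D_trunc_nd.
Qed.

Lemma sumsq_trunc_cvg x : (forall k, 0 <= x k) -> (D x < +oo)%E ->
  (fun L => sumsq_trunc L x) @ \oo --> fine (sumsq x).
Proof.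
move=> x0 Dx.
have c : cvgn (fun L => sumsq_trunc L x).
  apply: nondecreasing_is_cvgn.
    apply/nondecreasing_seqP => n; rewrite /sumsq_trunc big_nat_recr//= lerDl.
    by rewrite mulr_ge0 ?sqr_ge0.
  exists (fine (D x) ^+ 2) => _ [n _ <-].
  have := sumsq_trunc_le x0 (leq0n n).
  rewrite /sumsq_trunc /D_trunc [in X in X + _]big_geq// [in X in _ - X]big_geq// add0r subr0.
  move=> /le_trans; apply; rewrite ler_sqr ?nnegrE; first exact: D_trunc_le_D.
    exact: D_trunc_ge0.
  exact: le_trans (D_trunc_ge0 n x0) (D_trunc_le_D _ x0 Dx).
rewrite /sumsq (@nneseries_EFin_cvg _ _ (limn (fun L => sumsq_trunc L x)))//.
by move=> k; rewrite mulr_ge0 ?sqr_ge0.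
Qed.

Lemma ent_trunc_cvg x : finite_energy x ->
  (fun L => ent_trunc (fun k => q d beta 0 k.+1) L x + q_total) @ \oo
    --> fine (rateI d beta x).
Proof.
move=> [ex Dx Ix]; have [_ x0] := ex.
rewrite rateI_nneseries// in Ix *.
set u := (fun L => _); rewrite (_ : u = fun L =>
  series (fun k => x k * (ln (x k / q d beta 0 k.+1) - 1) + q d beta 0 k.+1) L
  + (q_total - series (fun k => q d beta 0 k.+1) L)); last first.
  by apply/funext => L; rewrite /u /ent_trunc /series/= big_split/=; lra.
rewrite -[X in _ --> X]addr0; apply: cvgD.
  by apply: nneseries_fine_cvg => // k; exact: entropy_term_ge0.
rewrite -[X in _ --> X](subrr q_total); apply: cvgB; first exact: cvg_cst.
exact: series_q_cvg.
Qed.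

Lemma ent_trunc_le x L : finite_energy x ->
  ent_trunc (fun k => q d beta 0 k.+1) L x + series (fun k => q d beta 0 k.+1) L
   <= fine (rateI d beta x).
Proof.
move=> [ex Dx Ix]; have [_ x0] := ex.
rewrite rateI_nneseries// in Ix *.
set u := fun k => x k * (ln (x k / q d beta 0 k.+1) - 1) + q d beta 0 k.+1.
have u0 k : 0 <= u k by exact: entropy_term_ge0.
have h := nneseries_fine_cvg u0 Ix.
rewrite -(cvg_lim _ h)// /ent_trunc {1}/series/= -big_split/=.
apply: (@nondecreasing_cvgn_le _ (series u)); last exact: cvgP h.
by apply/nondecreasing_seqP => n; rewrite -subr_ge0 seriesSB.
Qed.

Local Notation free_energy_d :=
  (free_energy a b beta (fun k => q d beta 0 k.+1) q_total).
Local Notation min_energy_d :=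
  (min_energy a b beta (fun k => q d beta 0 k.+1) q_total).

Lemma free_energy_cvg K x m s : finite_energy x ->
  (fun L => free_energy_d K L x
     (Num.max (m + s - a * fine (D x)) 0 / (a - b)) m s) @ \oo
    --> energy K m s x.
Proof.
move=> fx; have [[_ x0] Dx Ix] := fx.
set del := _ / (a - b).
have -> : energy K m s x = - (m + s) * (fine (D x) + del)
    + a / 2 * (fine (D x) + del) ^+ 2
    - b / 2 * (fine (sumsq x) + del ^+ 2) + s * D_trunc K x
    + beta^-1 * fine (rateI d beta x).
  rewrite /energy /del.
  have ab0 : a - b != 0 by rewrite subr_eq0 gt_eqF.
  move: (D_trunc K x) (fine (sumsq x)) (beta^-1 * _) (fine (D x)) => ? ? ? D0.
  have [|h] := leP (m + s - a * D0) 0; first by rewrite expr0n/= !mul0r; lra.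
  by field.
have hD := D_trunc_cvg x0 Dx.
have hDd : (fun L => D_trunc L x + del) @ \oo --> fine (D x) + del.
  by apply: cvgD => //; exact: cvg_cst.
apply: cvgD; last by apply: cvgM; [exact: cvg_cst|exact: ent_trunc_cvg].
apply: cvgD; last exact: cvg_cst.
apply: cvgB.
  apply: cvgD; first by apply: cvgM => //; exact: cvg_cst.
  by apply: cvgM; [exact: cvg_cst|rewrite expr2; apply: cvgM].
apply: cvgM; first exact: cvg_cst.
by apply: cvgD; [exact: sumsq_trunc_cvg|exact: cvg_cst].
Qed.

Let min_energy_le_d K L x del m s (KL : (K <= L)%N) (x0 : forall k, 0 <= x k)
    (del0 : 0 <= del) : min_energy_d K m s <= free_energy_d K L x del m s :=
  min_energy_le q_pos series_q_cvg b_ge0 ba beta_gt0 m s KL x0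
    (cvg_ln_q_div d beta_gt0) del0.

Lemma condensate_ge0 (u : R) : 0 <= Num.max u 0 / (a - b).
Proof. by rewrite divr_ge0 ?le_max ?lexx ?orbT// subr_ge0 ltW. Qed.

Lemma min_energy_le_energy K x m s : finite_energy x ->
  min_energy_d K m s <= energy K m s x.
Proof.
move=> fx; have [[_ x0] _ _] := fx; have h := free_energy_cvg (K := K) (m := m) (s := s) fx.
rewrite -(cvg_lim _ h)//; apply: limr_ge; first exact: cvgP h.
near=> L; apply: min_energy_le_d => //; last exact: condensate_ge0.
by near: L; exact: nbhs_infty_ge.
Unshelve. all: by end_near. Qed.

Definition truncate L x : nat -> R := fun k => if (k < L)%N then x k else 0.

Lemma sum_truncate (F : nat -> R -> R) L x : (forall k, F k 0 = 0) ->
  (\sum_(0 <= k < n) F k (truncate L x k)) @[n --> \oo]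
    --> \sum_(0 <= k < L) F k (x k).
Proof.
move=> F0; apply: cvg_near_cst; near=> n.
have Ln : (L <= n)%N by near: n; exact: nbhs_infty_ge.
rewrite (big_cat_nat (leq0n L) Ln)/= [X in _ + X]big_nat [X in _ + X]big1 ?addr0.
  by apply: eq_big_nat => k /andP[_ kL]; rewrite /truncate kL.
by move=> k /andP[Lk _]; rewrite /truncate ltnNge Lk.
Unshelve. all: by end_near. Qed.

Lemma finite_truncate L x : (forall k, 0 <= x k) ->
  [/\ finite_energy (truncate L x), D (truncate L x) = (D_trunc L x)%:E,
      sumsq (truncate L x) = (sumsq_trunc L x)%:E
    & rateI d beta (truncate L x) =
      (ent_trunc (fun k => q d beta 0 k.+1) L x + q_total)%:E].
Proof.
move=> x0.
have t0 k : 0 <= truncate L x k by rewrite /truncate; case: ifP.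
have DL : D (truncate L x) = (D_trunc L x)%:E.
  apply: nneseries_EFin_cvg; first by move=> k; rewrite mulr_ge0.
  exact: (@sum_truncate (fun k t => k.+1%:R * t) L x (fun k => mulr0 _)).
have SL : sumsq (truncate L x) = (sumsq_trunc L x)%:E.
  apply: nneseries_EFin_cvg; first by move=> k; rewrite mulr_ge0 ?sqr_ge0.
  apply: (@sum_truncate (fun k t => k.+1%:R ^+ 2 * t ^+ 2) L x) => k.
  by rewrite expr0n mulr0.
have eL : ell1_plus (truncate L x).
  split => //; rewrite /ell1 /ell1norm/=.
  rewrite (@nneseries_EFin_cvg _ _ (\sum_(0 <= k < L) `|x k|)) ?ltry//.
  exact: (@sum_truncate (fun k t => `|t|) L x (fun k => normr0 _)).
have IL : rateI d beta (truncate L x) =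
      (ent_trunc (fun k => q d beta 0 k.+1) L x + q_total)%:E.
  rewrite rateI_nneseries//.
  apply: nneseries_EFin_cvg; first by move=> k; exact: entropy_term_ge0.
  set u := (X in series X); rewrite (_ : series u = (fun n => \sum_(0 <= k < n)
    truncate L x k * (ln (truncate L x k / q d beta 0 k.+1) - 1)) +
    series (fun k => q d beta 0 k.+1)).
    apply: cvgD; last exact: series_q_cvg.
    exact: (@sum_truncate (fun k t => t * (ln (t / q d beta 0 k.+1) - 1)) L x
      (fun k => mul0r _)).
  by apply/funext => n; rewrite /series/= big_split.
by split => //; split; rewrite ?DL ?IL ?ltry.
Qed.

Lemma energy_truncate_le K L x m s : (K <= L)%N -> (forall k, 0 <= x k) ->
  energy K m s (truncate L x) <= free_energy_d K L x 0 m s.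
Proof.
move=> KL x0; have [_ DL SL IL] := finite_truncate L x0.
rewrite /energy DL SL IL/= /free_energy addr0 expr0n/= addr0.
have -> : D_trunc K (truncate L x) = D_trunc K x.
  by apply: eq_big_nat => k /andP[_ kK]; rewrite /truncate (leq_trans kK KL).
rewrite 2!lerD2r gerBl divr_ge0 ?sqr_ge0// mulr_ge0// subr_ge0 ltW//.
Qed.

Lemma inf_ell1_EFin (f : (nat -> R) -> \bar R) (v : R) :
  (forall x, ell1 x -> (v%:E <= f x)%E) ->
  (forall eps, 0 < eps -> exists2 x, ell1 x & (f x <= (v + eps)%:E)%E) ->
  inf_ell1 f = v%:E.
Proof.
move=> h1 h2; apply/eqP; rewrite eq_le; apply/andP; split.
  apply/lee_addgt0Pr => e e0; have [x ex fx] := h2 _ e0.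
  by apply: le_trans fx; apply: ereal_inf_lbound; exists x.
by apply: le_ereal_inf_tmp => _ [x ex <-]; exact: h1.
Qed.

Lemma inf_ell1_energy K m s c (f : (nat -> R) -> \bar R) :
  (forall x, finite_energy x -> f x = (energy K m s x - c)%:E) ->
  (forall x, ~ finite_energy x -> f x = +oo%E) ->
  inf_ell1 f = (min_energy_d K m s - c)%:E.
Proof.
move=> fE foo; apply: inf_ell1_EFin => [x _|e e0].
  have [fx|nfx] := pselect (finite_energy x); last by rewrite foo// leey.
  by rewrite fE// lee_fin lerD2r min_energy_le_energy.
have [L [x [KL x0 h]]] := min_energy_adherent q_pos series_q_cvg b_ge0 ba beta_gt0 K m s e0.
have [fx _ _ _] := finite_truncate L x0.
exists (truncate L x); first by case: fx => -[].
rewrite fE// lee_fin; have := energy_truncate_le m s KL x0; lra.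
Qed.

Lemma H_HYL_lsc_fin mu x : ell1_plus x -> (D x < +oo)%E ->
  H_HYL_lsc a b mu x = (- mu * fine (D x) + a / 2 * fine (D x) ^+ 2
   - b / 2 * fine (sumsq x)
   - Num.max (mu - a * fine (D x)) 0 ^+ 2 / (2 * (a - b)))%:E.
Proof. by move=> ex Dx; rewrite /H_HYL_lsc /H_HYL asboolT. Qed.

Lemma H_HYL_lsc_pinfty mu x : ~ (ell1_plus x /\ (D x < +oo)%E) ->
  H_HYL_lsc a b mu x = +oo%E.
Proof. by move=> nx; rewrite /H_HYL_lsc /H_HYL asboolF. Qed.

Lemma energy_sum m x : finite_energy x ->
  (beta%:E * H_HYL_lsc a b m x + rateI d beta x)%E = (beta * energy 0 m 0 x)%:E.
Proof.
move=> [ex Dx Ix]; rewrite H_HYL_lsc_fin//.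
have -> : rateI d beta x = (fine (rateI d beta x))%:E.
  by rewrite fineK// ge0_fin_numE// rateI_ge0.
rewrite -EFinM -EFinD; congr (_%:E); rewrite /energy addr0 mul0r addr0/=.
by rewrite [RHS]mulrDr (mulrA beta beta^-1) mulfV ?gt_eqF// mul1r.
Qed.

Lemma energy_sum_pinfty m x : ~ finite_energy x ->
  (beta%:E * H_HYL_lsc a b m x + rateI d beta x)%E = +oo%E.
Proof.
move=> nfx; have [[ex Dx]|nx] := pselect (ell1_plus x /\ (D x < +oo)%E).
  have : ~ (rateI d beta x < +oo)%E by move=> Ix; apply: nfx.
  move=> /negP; rewrite -leNgt leye_eq => /eqP ->.
  by rewrite H_HYL_lsc_fin// -EFinM addey.
rewrite H_HYL_lsc_pinfty// gt0_muley ?lte_fin// addye//.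
by rewrite -ltNye; apply: lt_le_trans (rateI_ge0 x).
Qed.

Lemma inf_ell1_energy_sum m :
  inf_ell1 (fun x => (beta%:E * H_HYL_lsc a b m x + rateI d beta x)%E)
  = (beta * min_energy_d 0 m 0)%:E.
Proof.
apply: inf_ell1_EFin => [x _|e e0].
  have [fx|nfx] := pselect (finite_energy x); last first.
    by rewrite energy_sum_pinfty// leey.
  by rewrite energy_sum// lee_fin ler_pM2l// min_energy_le_energy.
have e0' : 0 < beta^-1 * e by rewrite mulr_gt0 ?invr_gt0.
have [L [x [KL x0 h]]] :=
  min_energy_adherent q_pos series_q_cvg b_ge0 ba beta_gt0 0 m 0 e0'.
have [fx _ _ _] := finite_truncate L x0.
exists (truncate L x); first by case: fx => -[].
rewrite energy_sum// lee_fin.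
apply: (@le_trans _ _ (beta * (min_energy_d 0 m 0 + beta^-1 * e))).
  by rewrite ler_pM2l//; have := energy_truncate_le m 0 KL x0; lra.
by rewrite mulrDr (mulrA beta beta^-1) mulfV ?gt_eqF// mul1r.
Qed.

Lemma tilted_rateE mu alpha K s x : finite_energy x ->
  tilted_rate d a b beta mu alpha K s x =
  (energy K (mu + alpha) s x - min_energy_d 0 (mu + s + alpha) 0)%:E.
Proof.
move=> fx; rewrite /tilted_rate /I_HYL inf_ell1_energy_sum energy_sum//.
rewrite -EFinB -EFinM -EFinD; congr (_%:E).
have -> : energy K (mu + alpha) s x = energy 0 (mu + s + alpha) 0 x + s * D_trunc K x.
  rewrite /energy addr0 mul0r addr0.
  have -> : mu + alpha + s = mu + s + alpha by ring.
  rewrite -!addrA; do 4 congr (_ + _).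
  by rewrite addrC.
have b0 : beta != 0 by rewrite gt_eqF.
rewrite mulrBr !mulrA mulVf// !mul1r addrAC; by [].
Qed.

Lemma tilted_rate_pinfty mu alpha K s x : ~ finite_energy x ->
  tilted_rate d a b beta mu alpha K s x = +oo%E.
Proof.
move=> nfx; rewrite /tilted_rate /I_HYL inf_ell1_energy_sum energy_sum_pinfty//.
by rewrite -EFinN addye// gt0_muley ?lte_fin ?invr_gt0// addye.
Qed.

Lemma inf_tilted_rate mu alpha K s :
  inf_ell1 (tilted_rate d a b beta mu alpha K s) =
  (min_energy_d K (mu + alpha) s - min_energy_d 0 (mu + s + alpha) 0)%:E.
Proof.
apply: inf_ell1_energy => x; first exact: tilted_rateE.
exact: tilted_rate_pinfty.
Qed.

Lemma tilted_pressureE mu alpha K s :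
  tilted_pressure d a b beta mu alpha K s =
  min_energy_d K (mu + alpha) s - beta^-1 * q_total.
Proof.
rewrite /tilted_pressure inf_tilted_rate /pressure.
have -> : inf_ell1 (fun x => (rateI d beta x +
    beta%:E * H_HYL_lsc a b (mu + s + alpha) x)%E) =
    (beta * min_energy_d 0 (mu + s + alpha) 0)%:E.
  rewrite -inf_ell1_energy_sum; congr (inf_ell1 _).
  by apply/funext => x; rewrite addeC.
rewrite qbar_fin -!EFinM -!EFinB/=.
by rewrite mulrA mulVf ?gt_eqF// mul1r; ring.
Qed.

End variational_formula.

Section minimiser_curve.
Context {R : realType}.
Variables (d : nat) (a b beta : R).
Hypotheses (d_gt0 : (0 < d)%N) (b_ge0 : 0 <= b) (ba : b < a).
Hypothesis (beta_gt0 : 0 < beta).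
Implicit Types x : nat -> R.

Local Notation q0 := (fun k => q d beta 0 k.+1).
Local Notation Q := (q_total d beta).
Local Notation free_energy_d := (free_energy a b beta q0 Q).
Local Notation min_energy_d := (min_energy a b beta q0 Q).
Local Notation finite_energy_d := (finite_energy d beta).
Local Notation energy_d := (energy d a b beta).

Let q_pos := fun k => q_gt0 d beta_gt0 0 k.
Let ab0 : 0 < a - b. Proof. by rewrite subr_gt0. Qed.

Definition total_density m x : R :=
  fine (D x) + Num.max (m - a * fine (D x)) 0 / (a - b).

Lemma D_trunc_le_total_density K m x : finite_energy_d x ->
  D_trunc K x <= total_density m x.
Proof.
move=> [[_ x0] Dx _]; have := D_trunc_le_D K x0 Dx.
have := condensate_ge0 ba (m - a * fine (D x)); rewrite /total_density; lra.
Qed.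

Lemma min_energy_tangent K m s t x : finite_energy_d x ->
  min_energy_d K m t <= energy_d K m s x
    - (t - s) * (total_density (m + s) x - D_trunc K x).
Proof.
move=> fx; have [[_ x0] Dx Ix] := fx.
have h := free_energy_cvg d_gt0 ba beta_gt0 (K := K) (m := m) (s := s) fx.
have hD := D_trunc_cvg x0 Dx.
set del := _ / (a - b) in h.
have h2 : (fun L => free_energy_d K L x del m t) @ \oo -->
   energy_d K m s x - (t - s) * (total_density (m + s) x - D_trunc K x).
  rewrite (_ : (fun L => _) = fun L => free_energy_d K L x del m s
     - (t - s) * (D_trunc L x + del - D_trunc K x)); last first.
    by apply/funext => L; rewrite /free_energy; ring.
  apply: cvgB => //; apply: cvgM; first exact: cvg_cst.
  apply: cvgB; last exact: cvg_cst.
  by apply: cvgD => //; exact: cvg_cst.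
rewrite -(cvg_lim _ h2)//; apply: limr_ge; first exact: cvgP h2.
near=> L.
apply: (min_energy_le q_pos (series_q_cvg d_gt0 beta_gt0) b_ge0 ba beta_gt0
  m t _ x0 (cvg_ln_q_div d beta_gt0)).
  by near: L; exact: nbhs_infty_ge.
exact: condensate_ge0.
Unshelve. all: by end_near. Qed.

Lemma free_energy_truncation_le K L m s x : finite_energy_d x ->
  free_energy_d K L x (total_density (m + s) x - D_trunc L x) m 0
  <= energy_d K m s x + s * (total_density (m + s) x - D_trunc K x)
     + beta^-1 * (Q - series q0 L).
Proof.
move=> fx; have [[_ x0] Dx Ix] := fx.
have hE : beta^-1 * (ent_trunc q0 L x + series q0 L) <= beta^-1 * fine (rateI d beta x).
  by rewrite ler_wpM2l ?invr_ge0 ?(ltW beta_gt0)//; exact: ent_trunc_le.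
have DL := D_trunc_le_D L x0 Dx.
set del := Num.max (m + s - a * fine (D x)) 0 / (a - b).
have del0 : 0 <= del by exact: condensate_ge0.
have rhoE : total_density (m + s) x = fine (D x) + del by [].
have hS : fine (sumsq x) <= sumsq_trunc L x + (fine (D x) - D_trunc L x) ^+ 2.
  have hs := sumsq_trunc_cvg x0 Dx.
  have hd : (fun M => sumsq_trunc L x + (D_trunc M x - D_trunc L x) ^+ 2) @ \oo -->
      sumsq_trunc L x + (fine (D x) - D_trunc L x) ^+ 2.
    apply: cvgD; first exact: cvg_cst.
    have hc : (fun M => D_trunc M x - D_trunc L x) @ \oo --> fine (D x) - D_trunc L x.
      by apply: cvgB; [exact: D_trunc_cvg|exact: cvg_cst].
    by rewrite expr2; apply: cvgM.
  apply: ler_cvg_to hs hd _; near=> M; apply: sumsq_trunc_le => //.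
  by near: M; exact: nbhs_infty_ge.
have -> : energy_d K m s x = - (m + s) * (fine (D x) + del)
    + a / 2 * (fine (D x) + del) ^+ 2
    - b / 2 * (fine (sumsq x) + del ^+ 2) + s * D_trunc K x
    + beta^-1 * fine (rateI d beta x).
  rewrite /energy /del.
  have ab1 : a - b != 0 by rewrite gt_eqF.
  move: (D_trunc K x) (fine (sumsq x)) (beta^-1 * _) (fine (D x)) => ? ? ? D0.
  have [|h] := leP (m + s - a * D0) 0; first by rewrite expr0n/= !mul0r; lra.
  by field.
rewrite rhoE /free_energy; clearbody del.
move: (D_trunc K x) (D_trunc L x) (fine (D x)) (fine (sumsq x)) (sumsq_trunc L x)
  (fine (rateI d beta x)) (ent_trunc q0 L x) (series q0 L) DL hS hE => DK DL' D0 S SL I E T hDL hS hE.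
have key : b / 2 * (S + del ^+ 2) <= b / 2 * (SL + (D0 + del - DL') ^+ 2).
  apply: ler_wpM2l; first by rewrite divr_ge0.
  have : 0 <= (D0 - DL') * del by rewrite mulr_ge0// subr_ge0.
  lra.
lra.
Unshelve. all: by end_near. Qed.

Lemma density_gap_le K L m s x : (K <= L)%N -> finite_energy_d x ->
  min_energy_d K m 0 + (a - b) / 2 * (total_density (m + s) x
     - (D_trunc L x + Num.max (m - a * D_trunc L x) 0 / (a - b))) ^+ 2
  <= energy_d K m s x + s * (total_density (m + s) x - D_trunc K x)
     + beta^-1 * (Q - series q0 L).
Proof.
move=> KL fx; have [[_ x0] Dx Ix] := fx.
apply: le_trans (free_energy_truncation_le K L m s fx).
have del0 : 0 <= total_density (m + s) x - D_trunc L x.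
  by rewrite subr_ge0; exact: D_trunc_le_total_density.
have := free_energy_optimal_condensate q0 Q beta ba K L x m 0 del0.
rewrite /= addr0; set del' := _ / (a - b).
have del'0 : 0 <= del' by exact: condensate_ge0.
have := min_energy_le q_pos (series_q_cvg d_gt0 beta_gt0) b_ge0 ba beta_gt0
  m 0 KL x0 (cvg_ln_q_div d beta_gt0) del'0.
have -> : total_density (m + s) x - (D_trunc L x + del') =
  total_density (m + s) x - D_trunc L x - del' by ring.
lra.
Qed.

Lemma max0_lipschitz (u v : R) : `|Num.max u 0 - Num.max v 0| <= `|u - v|.
Proof.
have h0 := normr_ge0 (u - v); have h1 := ler_norm (u - v).
have := ler_norm (v - u); rewrite distrC => h2.
rewrite ler_norml; apply/andP; split.
  by case: (leP u 0) => hu; case: (leP v 0) => hv; lra.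
by case: (leP u 0) => hu; case: (leP v 0) => hv; lra.
Qed.

Lemma quadratic_le_bound (r c A B : R) : 0 <= c -> 0 <= A -> 0 <= B ->
  (r - c) ^+ 2 <= A * r + B -> r <= c + 1 + A + A * c + B.
Proof.
move=> c0 A0 B0 h; rewrite leNgt; apply/negP => hr.
have Ac : 0 <= A * c by rewrite mulr_ge0.
pose t := r - c; have t1 : 1 <= t by rewrite /t; lra.
have rE : r = c + t by rewrite /t; ring.
have h2 : t * (t - A - (A * c + B)) > 0 by rewrite pmulr_lgt0 /t; lra.
have h3 : (A * c + B) * 1 <= (A * c + B) * t by rewrite ler_wpM2l// addr_ge0.
move: h h2; rewrite -/t {1}rE; nra.
Qed.

Lemma cvg_D_trunc (T : Type) (F : set_system T) (FF : Filter F)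
  (f : T -> nat -> R) x L : (forall k, f s k @[s --> F] --> x k) ->
  D_trunc L (f s) @[s --> F] --> D_trunc L x.
Proof.
move=> fx; elim: L => [|L IH].
  rewrite (_ : (fun s => _) = fun=> D_trunc 0 x); first exact: cvg_cst.
  by apply/funext => s; rewrite /D_trunc !big_geq.
rewrite (_ : (fun s => _) = fun s => D_trunc L (f s) + L.+1%:R * f s L); last first.
  by apply/funext => s; rewrite /D_trunc big_nat_recr.
rewrite {2}/D_trunc big_nat_recr//=; apply: cvgD; first exact: IH.
by apply: cvgM => //; exact: cvg_cst.
Qed.

Lemma C1_ell1_coord eps xi k : 0 < eps -> C1_ell1 eps xi ->
  xi s k @[s --> 0^'] --> (xi 0 k : R).
Proof.
move=> e0 [dxi /(_ 0)]; rewrite oppr_lt0 e0 => /(_ isT)[_ _ + _].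
move=> /fine_cvgP[hfin /cvgrPdist_lt/(_ 1 ltr01) h1].
apply/cvgrPdist_le => e egt0.
pose C := 1 + `|dxi 0 k|; have C0 : 0 < C by rewrite ltr_pwDl.
near=> s.
have s0 : s != 0 by near: s; exact: nbhs_dnbhs_neq.
have sC : `|s| <= e / C.
  near: s; apply: dnbhs0_le; exact: divr_gt0.
have hk : `|(xi s k - xi 0 k) / s - dxi 0 k| <= 1.
  have hf : ell1norm (fun k => (xi (0 + s) k - xi 0 k) / s - dxi 0 k) \is a fin_num.
    by near: s.
  have : `|0 - fine (ell1norm (fun k => (xi (0 + s) k - xi 0 k) / s - dxi 0 k))| < 1.
    by near: s.
  rewrite sub0r normrN => /ltW h.
  have hle : (`|(xi s k - xi 0 k)%R / s - dxi 0 k|%R%:E <=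
      ell1norm (fun k => ((xi (0 + s) k - xi 0 k) / s - dxi 0 k)%R))%E.
    rewrite /ell1norm add0r; apply: le_trans (nneseries_lim_ge k.+1 _) => //.
    rewrite big_nat_recr//= leeDr// sume_ge0 => // i _; by rewrite lee_fin.
  rewrite -lee_fin; apply: (le_trans hle); rewrite -(fineK hf) lee_fin.
  exact: le_trans (ler_norm _) h.
have -> : xi 0 k - xi s k = - (s * (((xi s k - xi 0 k) / s - dxi 0 k) + dxi 0 k)).
  by field.
rewrite normrN normrM; apply: le_trans (ler_wpM2r _ sC) _ => //.
rewrite -[leRHS](divfK (lt0r_neq0 C0)) ler_wpM2l ?divr_ge0 ?(ltW e0) ?(ltW egt0) ?(ltW C0)//.
by apply: le_trans (ler_normD _ _) _; rewrite lerD2r.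
Unshelve. all: by end_near. Qed.

Lemma minimiser_energy K mu alpha s x :
  is_minimiser (tilted_rate d a b beta mu alpha K s) x ->
  finite_energy_d x /\ energy_d K (mu + alpha) s x = min_energy_d K (mu + alpha) s.
Proof.
move=> [_]; rewrite inf_tilted_rate// => h.
have [fx|nfx] := pselect (finite_energy_d x).
  split => //; move: h; rewrite tilted_rateE// => -[]/eqP.
  by rewrite (inj_eq (addIr _)) => /eqP.
by move: h; rewrite tilted_rate_pinfty.
Qed.

Lemma cvg_total_density K (m eps : R) (xi : R -> nat -> R) : 0 < eps ->
  (forall k, xi s k @[s --> 0^'] --> (xi 0 k : R)) ->
  (forall s, - eps < s < eps ->
     finite_energy_d (xi s) /\ energy_d K m s (xi s) = min_energy_d K m s) ->
  total_density (m + s) (xi s) @[s --> 0^'] --> total_density m (xi 0).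
Proof.
move=> e0 xic hmin.
have [f0 g0] : finite_energy_d (xi 0) /\ energy_d K m 0 (xi 0) = min_energy_d K m 0.
  by apply: hmin; rewrite oppr_lt0 e0.
set rho0 := total_density m (xi 0).
have DK0 : D_trunc K (xi 0) <= rho0 by exact: D_trunc_le_total_density.
have DK0p : 0 <= D_trunc K (xi 0) by apply: D_trunc_ge0; case: f0 => -[].
pose T L x := D_trunc L x + Num.max (m - a * D_trunc L x) 0 / (a - b).
have T0 L x : (forall k, 0 <= x k) -> 0 <= T L x.
  by move=> x0; rewrite addr_ge0 ?D_trunc_ge0// condensate_ge0.
pose C := 1 + `|a| / (a - b); have C0 : 0 < C by rewrite ltr_pwDl// divr_ge0// ltW.
have Tlip L x y : `|T L x - T L y| <= C * `|D_trunc L x - D_trunc L y|.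
  have -> : T L x - T L y = (D_trunc L x - D_trunc L y) +
      (Num.max (m - a * D_trunc L x) 0 - Num.max (m - a * D_trunc L y) 0) / (a - b).
    by rewrite /T; ring.
  apply: le_trans (ler_normD _ _) _; rewrite [leRHS]mulrDl mul1r lerD2l normrM.
  rewrite (gtr0_norm (_ : 0 < (a - b)^-1)) ?invr_gt0// mulrAC ler_wpM2r ?invr_ge0 ?(ltW ab0)//.
  apply: le_trans (max0_lipschitz _ _) _.
  by rewrite opprB addrC addrA subrK -mulrBr normrM distrC.
have Tc L : T L (xi s) @[s --> 0^'] --> T L (xi 0).
  apply/cvgrPdist_le => e egt0.
  have /cvgrPdist_le/(_ (e / C) (divr_gt0 egt0 C0)) := cvg_D_trunc (L := L) (dnbhs_filter _) xic.
  apply: filterS => s hs; apply: le_trans (Tlip _ _ _) _.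
  by rewrite mulrC -ler_pdivlMr.
pose kappa := 2 / (a - b); have k0 : 0 < kappa by rewrite divr_gt0.
pose tail L := beta^-1 * (Q - series q0 L).
have tail0 L : 0 <= tail L.
  rewrite mulr_ge0 ?invr_ge0 ?(ltW beta_gt0)// subr_ge0.
  exact: (series_le_total q_pos (series_q_cvg d_gt0 beta_gt0)).
have main L s : (K <= L)%N -> - eps < s < eps ->
    (total_density (m + s) (xi s) - T L (xi s)) ^+ 2 <=
    kappa * (2 * `|s| * (total_density (m + s) (xi s) + rho0) + tail L).
  move=> KL hs; have [fs gs] := hmin s hs.
  have h1 := density_gap_le m s KL fs.
  have h2 := min_energy_tangent K m 0 s f0.
  have DKs := D_trunc_le_total_density K (m + s) fs.
  have DKsp : 0 <= D_trunc K (xi s) by apply: D_trunc_ge0; case: fs => -[].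
  move: h1 h2; rewrite g0 gs subr0 addr0 -/rho0 -/(T L (xi s)) -/(tail L).
  move: (total_density (m + s) (xi s)) (D_trunc K (xi s)) (T L (xi s)) DKs DKsp.
  move=> r Dr t rD D0 h1 h2.
  have h3 : s * (r - Dr - (rho0 - D_trunc K (xi 0))) <= `|s| * (2 * (r + rho0)).
    apply: le_trans (ler_norm _) _; rewrite normrM ler_wpM2l// ler_norml.
    by apply/andP; split; lra.
  have h4 : (a - b) / 2 * (r - t) ^+ 2 <= 2 * `|s| * (r + rho0) + tail L by lra.
  rewrite -ler_pdivrMl//; apply: le_trans h4; rewrite /kappa invf_div.
  by [].
have [B hB] : exists B, 0 <= B /\
    \forall s \near 0^', total_density (m + s) (xi s) <= B.
  pose c := T K (xi 0) + 1.
  have c0 : 0 <= c by rewrite addr_ge0// T0//; case: f0 => -[].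
  pose A := kappa * 2; have A0 : 0 <= A by rewrite mulr_ge0// ltW.
  pose B' := kappa * (2 * rho0 + tail K).
  have rho00 : 0 <= rho0 by apply: le_trans DK0.
  have B0 : 0 <= B' by rewrite mulr_ge0 ?(ltW k0)// addr_ge0// mulr_ge0.
  exists (c + 1 + A + A * c + B'); split.
    have Ac0 : 0 <= A * c by rewrite mulr_ge0.
    by clear -c0 A0 B0 Ac0; lra.
  near=> s.
  have hs : - eps < s < eps by rewrite -ltr_norml; near: s; exact: dnbhs0_lt.
  have s1 : `|s| <= 1 by near: s; exact: dnbhs0_le.
  have hT : T K (xi s) <= c.
    have : `|T K (xi 0) - T K (xi s)| <= 1.
      by near: s; move/cvgrPdist_le : (Tc K); apply.
    rewrite distrC => /(le_trans (ler_norm _)); rewrite /c; lra.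
  have [fs _] := hmin s hs.
  have r0 : 0 <= total_density (m + s) (xi s).
    apply: le_trans (D_trunc_le_total_density K _ fs).
    by apply: D_trunc_ge0; case: fs => -[].
  have Ts0 : 0 <= T K (xi s) by apply: T0; case: fs => -[].
  have h : total_density (m + s) (xi s) <= T K (xi s) + 1 + A + A * T K (xi s) + B'.
    apply: quadratic_le_bound => //; apply: le_trans (main K s (leqnn K) hs) _.
    have hsr : `|s| * (total_density (m + s) (xi s) + rho0) <=
        total_density (m + s) (xi s) + rho0.
      by rewrite -[leRHS]mul1r ler_wpM2r// addr_ge0.
    have := ler_wpM2l (ltW k0) hsr; rewrite /A /B'.
    move: (total_density _ _) (tail K) => r tl; lra.
  have Ah : A * T K (xi s) <= A * c by rewrite ler_wpM2l.
  move: h hT Ah; move: (total_density _ _) (T K (xi s)) (A * _) (A * _) => r t u v; lra.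
have [B0 hB'] := hB => {hB}.
have rho0B : 0 <= rho0 by apply: le_trans DK0.
apply/cvgrPdist_le => e egt0.
pose e' := (e / 3) ^+ 2; have e'0 : 0 < e' by rewrite exprn_gt0// divr_gt0.
have [L [KL hL]] : exists L, (K <= L)%N /\ kappa * tail L <= e' / 2.
  have htail : kappa * tail L @[L --> \oo] --> 0.
    rewrite -[X in _ --> X](mulr0 kappa); apply: cvgM; first exact: cvg_cst.
    rewrite -[X in _ --> X](mulr0 beta^-1); apply: cvgM; first exact: cvg_cst.
    rewrite -[X in _ --> X](subrr Q); apply: cvgB; first exact: cvg_cst.
    exact: series_q_cvg.
  have hn : \forall L \near \oo, (K <= L)%N /\ kappa * tail L <= e' / 2.
    near=> L; split; first by near: L; exact: nbhs_infty_ge.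
    have : `|0 - kappa * tail L| <= e' / 2.
      by near: L; move/cvgrPdist_le : htail; apply; exact: divr_gt0.
    by rewrite sub0r normrN => /(le_trans (ler_norm _)).
  by have [N _ /(_ N (leqnn N))] := hn; exists N.
have hs0 : `|rho0 - T L (xi 0)| <= e / 3.
  rewrite -ler_sqr ?nnegrE ?divr_ge0 ?(ltW egt0)// real_normK ?num_real//.
  have := main L 0 KL; rewrite oppr_lt0 e0 => /(_ isT).
  rewrite addr0 normr0 mulr0 mul0r add0r -/rho0 => /le_trans; apply.
  rewrite -/e'; lra.
pose M := kappa * (2 * (B + rho0)) + 1.
have M0 : 0 < M by rewrite ltr_wpDl// mulr_ge0 ?(ltW k0)// mulr_ge0// addr_ge0.
near=> s.
have hs : - eps < s < eps by rewrite -ltr_norml; near: s; exact: dnbhs0_lt.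
have sM : `|s| <= e' / 2 / M by near: s; apply: dnbhs0_le; rewrite !divr_gt0.
have rB : total_density (m + s) (xi s) <= B by near: s.
have hss : `|total_density (m + s) (xi s) - T L (xi s)| <= e / 3.
  rewrite -ler_sqr ?nnegrE ?divr_ge0 ?(ltW egt0)// real_normK ?num_real//.
  apply: le_trans (main L s KL hs) _; rewrite -/e' mulrDr.
  have : kappa * (2 * `|s| * (total_density (m + s) (xi s) + rho0)) <= `|s| * M.
    rewrite [leRHS](_ : _ = kappa * (2 * `|s| * (B + rho0)) + `|s|); last first.
      by rewrite /M; ring.
    rewrite ler_wpDr// ler_wpM2l ?(ltW k0)// ler_wpM2l ?mulr_ge0//.
    by rewrite lerD2r.
  have : `|s| * M <= e' / 2 by rewrite -ler_pdivlMr.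
  lra.
have hT : `|T L (xi 0) - T L (xi s)| <= e / 3.
  by near: s; move/cvgrPdist_le : (Tc L); apply; exact: divr_gt0.
have -> : rho0 - total_density (m + s) (xi s) = (rho0 - T L (xi 0))
   + (T L (xi 0) - T L (xi s)) - (total_density (m + s) (xi s) - T L (xi s)) by ring.
apply: le_trans (ler_normB _ _) _; apply: le_trans (lerD (ler_normD _ _) (lexx _)) _.
lra.
Unshelve. all: by end_near. Qed.

Lemma minimiser_curve_derive K (mu alpha eps : R) (xi : R -> nat -> R) : 0 < eps -> C1_ell1 eps xi ->
  (forall s, - eps < s < eps ->
     is_minimiser (tilted_rate d a b beta mu alpha K s) (xi s)) ->
  finite_energy_d (xi 0) /\
  is_derive (0 : R) 1 (min_energy_d K (mu + alpha))
    (- (total_density (mu + alpha) (xi 0) - D_trunc K (xi 0))).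
Proof.
move=> e0 C1xi hxi.
have hmin s hs := minimiser_energy (hxi s hs).
have xic k := C1_ell1_coord (k := k) e0 C1xi.
have hrho := cvg_total_density e0 xic hmin.
have hD := cvg_D_trunc (L := K) (dnbhs_filter _) xic.
have [f0 g0] := hmin 0 ltac:(by rewrite oppr_lt0 e0).
split => //; set m := mu + alpha; set rho0 := total_density m (xi 0).
have lim : (fun h : R => h^-1 *: (min_energy_d K m (h *: 1 + 0) - min_energy_d K m 0))
    @ 0^' --> - (rho0 - D_trunc K (xi 0)).
  apply/cvgrPdist_le => e egt0; near=> s.
  have s0 : s != 0 by near: s; exact: nbhs_dnbhs_neq.
  have hs : - eps < s < eps by rewrite -ltr_norml; near: s; exact: dnbhs0_lt.
  have [fs gs] := hmin s hs.
  have h1 : `|rho0 - total_density (m + s) (xi s)| <= e / 2.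
    by near: s; move/cvgrPdist_le : hrho; apply; exact: divr_gt0.
  have h2 : `|D_trunc K (xi 0) - D_trunc K (xi s)| <= e / 2.
    by near: s; move/cvgrPdist_le : hD; apply; exact: divr_gt0.
  have t1 := min_energy_tangent K m 0 s f0.
  have t2 := min_energy_tangent K m s 0 fs.
  rewrite g0 subr0 addr0 -/rho0 in t1; rewrite gs sub0r in t2.
  rewrite addr0 /GRing.scale/= mulr1.
  set p := rho0 - _ in t1 *; set p' := total_density _ _ - _ in t2.
  have pp : `|p - p'| <= e.
    have -> : p - p' = (rho0 - total_density (m + s) (xi s))
      - (D_trunc K (xi 0) - D_trunc K (xi s)) by rewrite /p /p'; ring.
    by apply: le_trans (ler_normB _ _) _; lra.
  have -> : - p - s^-1 * (min_energy_d K m s - min_energy_d K m 0) =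
      - (s^-1 * (min_energy_d K m s - min_energy_d K m 0 + s * p)) by field.
  rewrite normrN normrM normfV ler_pdivrMl ?normr_gt0// mulrC.
  have : `|s| * `|p - p'| <= `|s| * e by rewrite ler_wpM2l.
  rewrite -normrM => hb; rewrite mulrC; apply: le_trans hb.
  rewrite ler_norml.
  have hsp : - (s * (p - p')) <= `|s * (p - p')| by rewrite -normrN ler_norm.
  have hsp0 : 0 <= `|s * (p - p')| by [].
  move: hsp hsp0 t1 t2; move: `|_ * _| => z.
  move: (min_energy_d K m s) (min_energy_d K m 0) => u v.
  by move=> *; apply/andP; split; lra.
apply: DeriveDef; first exact: cvgP lim.
exact: cvg_lim lim.
Unshelve. all: by end_near. Qed.

End minimiser_curve.

(** * Tilted partition functions *)

Section independent_poisson_integrals.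
Context {R : realType} (dO : measure_display) (Omega : measurableType dO).
Variables (P : probability Omega R) (X : nat -> {RV P >-> nat}) (lam : nat -> R).
Hypotheses (lam_ge0 : forall k, 0 <= lam k) (XP : independent_poisson X lam).

Definition poisson_weight (l : R) (n : nat) : R := expR (- l) * (l ^+ n / n`!%:R).

Lemma poisson_weight_ge0 l n : 0 <= l -> 0 <= poisson_weight l n.
Proof. by move=> l0; rewrite mulr_ge0 ?expR_ge0// divr_ge0// exprn_ge0. Qed.

Lemma poisson_pointE k n : P (X k @^-1` [set n]) = (poisson_weight (lam k) n)%:E.
Proof.
have := XP.1 k [set n]; rewrite /distribution/pushforward => ->.
rewrite /poisson_prob /poisson_weight; case: ifPn => [l0|].
  rewrite esum_set1 ?lee_fin ?poisson_pmf_ge0// /poisson_pmf l0.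
  by congr (_%:E); rewrite mulrC.
rewrite -leNgt => l0; have -> : lam k = 0 by apply/eqP; rewrite eq_le l0 lam_ge0.
rewrite diracE oppr0 expR0 mul1r; case: n => [|n].
  by rewrite expr0 fact0 invr1 mulr1 mem_set.
by rewrite expr0n/= mul0r memNset.
Qed.

Lemma measurable_preim k (A : set nat) : measurable (X k @^-1` A).
Proof. by rewrite -[_ @^-1` _]setTI; exact: measurable_funPT. Qed.

Lemma measurable_fun_nat (h : nat -> R) k : measurable_fun setT (fun w => h (X k w)).
Proof.
apply: (@measurableT_comp _ _ _ _ _ _ h) => //.
Qed.

Lemma measurable_prod_comp (h : nat -> nat -> R) M :
  measurable_fun setT (fun w => \prod_(0 <= k < M) h k (X k w)).
Proof.
elim: M => [|M IH].
  under eq_fun do rewrite big_geq//; exact: measurable_cst.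
under eq_fun do rewrite big_nat_recr//=.
by apply: measurable_funM => //; exact: measurable_fun_nat.
Qed.

Lemma measurable_cylinder (s : seq nat) (A : nat -> set nat) :
  measurable (\bigcap_(k in [set` s]) (X k @^-1` A k)).
Proof.
rewrite bigcap_seq; elim/big_ind : _ => //; first exact: measurableI.
by move=> k _; exact: measurable_preim.
Qed.

Lemma integral_prod_cylinder_le (h : nat -> nat -> R) (e : nat -> R) M :
  (forall k n, 0 <= h k n) ->
  (forall k, (\sum_(0 <= n <oo) (h k n * poisson_weight (lam k) n)%:E <= (e k)%:E)%E) ->
  forall (s : seq nat) (A : nat -> set nat), uniq s -> (forall k, k \in s -> (M <= k)%N) ->
  (\int[P]_(w in \bigcap_(k in [set` s]) (X k @^-1` A k))
     (\prod_(0 <= k < M) h k (X k w))%:E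
   <= (\prod_(0 <= k < M) e k * \prod_(k <- s) fine (P (X k @^-1` A k)))%:E)%E.
Proof.
move=> h0 he; have e0 k : 0 <= e k.
  rewrite -lee_fin; apply: le_trans (he k); apply: nneseries_ge0 => n _ _.
  by rewrite lee_fin mulr_ge0// poisson_weight_ge0.
elim: M => [|M IH] s A us Ms.
  under eq_integral do rewrite big_geq//.
  rewrite integral_cst; last exact: measurable_cylinder.
  by rewrite mul1e big_geq// mul1r -(XP.2 s A us).
set E := \bigcap_(k in _) _.
pose F n := E `&` X M @^-1` [set n].
have mE : measurable E by exact: measurable_cylinder.
have mF n : measurable (F n) by apply: measurableI => //; exact: measurable_preim.
have EF : E = \bigcup_n F n.
  rewrite -setI_bigcupr -preimage_bigcup; apply/seteqP; split; last exact: subIsetl.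
  by move=> w Ew; split => //; exists (X M w).
have tF : trivIset setT F.
  by move=> i j _ _ [w [[_ <-] [_ <-]]].
have Pr0 m (w : Omega) : 0 <= \prod_(0 <= k < m) h k (X k w).
  by apply: prodr_ge0.
rewrite EF ge0_integral_bigcup//; last 2 first.
- by apply/measurable_EFinP; apply: measurable_funTS; exact: measurable_prod_comp.
- by move=> w _; rewrite lee_fin; exact: Pr0.
pose p := \prod_(0 <= k < M) e k * \prod_(k <- s) fine (P (X k @^-1` A k)).
have p0 : 0 <= p.
  rewrite mulr_ge0//; first by apply: prodr_ge0.
  by apply: prodr_ge0 => k _; rewrite fine_ge0.
have step n : (\int[P]_(w in F n) (\prod_(0 <= k < M.+1) h k (X k w))%:E
    <= p%:E * (h M n * poisson_weight (lam M) n)%:E)%E.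
  have -> : (\int[P]_(w in F n) (\prod_(0 <= k < M.+1) h k (X k w))%:E =
      \int[P]_(w in F n) ((h M n)%:E * (\prod_(0 <= k < M) h k (X k w))%:E))%E.
    apply: eq_integral => w; rewrite inE => -[_ /= Xn].
    by rewrite big_nat_recr//= Xn mulrC EFinM.
  rewrite ge0_integralZl_EFin//; last 2 first.
  - by move=> w _; rewrite lee_fin; exact: Pr0.
  - by apply/measurable_EFinP; apply: measurable_funTS; exact: measurable_prod_comp.
  pose A' k := if k == M then [set n] else A k.
  have MNs : M \notin s by apply/negP => /Ms; rewrite ltnn.
  have A's k : k \in s -> A' k = A k.
    by move=> ks; rewrite /A'; case: eqP => // kM; rewrite -kM ks in MNs.
  have -> : F n = \bigcap_(k in [set` M :: s]) (X k @^-1` A' k).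
    apply/seteqP; split => [w [Ew XMn] k /=|w Hw].
      rewrite inE => /orP[/eqP ->|ks]; first by rewrite /A' eqxx.
      by rewrite A's//; exact: Ew.
    split; last by have := Hw M (mem_head _ _); rewrite /A'/= eqxx.
    by move=> k /= ks; rewrite -(A's k ks); apply: Hw => /=; rewrite inE ks orbT.
  apply: le_trans (lee_wpmul2l _ (IH (M :: s) A' _ _)) _.
  - by rewrite lee_fin.
  - by rewrite /= MNs.
  - by move=> k; rewrite inE => /orP[/eqP ->//|/Ms/ltnW].
  rewrite -!EFinM lee_fin big_cons {1}/A' eqxx poisson_pointE/=.
  have -> : \prod_(k <- s) fine (P (X k @^-1` A' k)) =
      \prod_(k <- s) fine (P (X k @^-1` A k)).
    by apply: eq_big_seq => k ks; rewrite A's.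
  by rewrite le_eqVlt; apply/orP; left; apply/eqP; rewrite /p; ring.
apply: (@le_trans _ _ (\sum_(0 <= n <oo) (p%:E * (h M n * poisson_weight (lam M) n)%:E))%E).
  apply: lee_nneseries => n _; last exact: step.
  by move=> _; apply: integral_ge0 => w _; rewrite lee_fin; exact: Pr0.
rewrite nneseriesZl; last first.
  by move=> n _; rewrite lee_fin mulr_ge0// poisson_weight_ge0.
apply: le_trans (lee_wpmul2l _ (he M)) _; first by rewrite lee_fin.
rewrite -EFinM lee_fin big_nat_recr//=.
by rewrite le_eqVlt; apply/orP; left; apply/eqP; rewrite /p; ring.
Qed.

Lemma integral_prod_le (h : nat -> nat -> R) (e : nat -> R) M :
  (forall k n, 0 <= h k n) ->
  (forall k, (\sum_(0 <= n <oo) (h k n * poisson_weight (lam k) n)%:E <= (e k)%:E)%E) ->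
  (\int[P]_w (\prod_(0 <= k < M) h k (X k w))%:E <= (\prod_(0 <= k < M) e k)%:E)%E.
Proof.
move=> h0 he; have := @integral_prod_cylinder_le h e M h0 he [::] (fun=> setT) isT.
by rewrite big_nil mulr1 set_nil bigcap_set0; apply.
Qed.

Lemma integral_le_of_finite_products (f : Omega -> \bar R) (h : nat -> nat -> R)
    (e : nat -> R) (L : nat) (B c : R) :
  (forall k n, 0 <= h k n) ->
  (forall k, (\sum_(0 <= n <oo) (h k n * poisson_weight (lam k) n)%:E <= (e k)%:E)%E) ->
  measurable_fun setT f -> (forall w, (0 <= f w)%E) ->
  (forall w, (forall M, exists2 k, (M <= k)%N & X k w <> 0%N) -> f w = 0%E) ->
  (forall w m M, (L <= M)%N -> (m <= M)%N -> (forall k, (m <= k)%N -> X k w = 0%N) ->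
     (f w <= (\prod_(0 <= k < M) h k (X k w))%:E)%E) ->
  (forall M, (L <= M)%N -> \prod_(0 <= k < M) e k <= B * expR (- series lam M)) ->
  series lam @ \oo --> c ->
  (\int[P]_w f w <= (B * expR (- c))%:E)%E.
Proof.
move=> h0 he mf f0 finf fle eB lamc.
pose A m := \bigcap_(k in [set k | (m <= k)%N]) (X k @^-1` [set 0%N]).
have mA m : measurable (A m).
  by apply: bigcap_measurableType => k _; exact: measurable_preim.
have ndA : nondecreasing_seq A.
  by move=> m n mn; apply/subsetPset => w Aw k /= nk; apply: Aw => /=; exact: leq_trans nk.
have fA : (\int[P]_w f w = \int[P]_(w in \bigcup_m A m) f w)%E.
  rewrite [RHS]integral_mkcond; apply: eq_integral => w _.
  rewrite patchE; case: ifPn => //; rewrite notin_setE => nA.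
  apply: finf => M; apply: contrapT => nk; apply: nA; exists M => // k /= Mk.
  by apply: contrapT => Xk; apply: nk; exists k.
rewrite fA.
have hc := ge0_nondecreasing_set_cvg_integral (mu := P) ndA mA
  (fun i => measurable_funS measurableT (@subsetT _ (A i)) mf) (fun i w _ => f0 w).
rewrite -(cvg_lim _ hc)//; apply: lime_le; first exact: cvgP hc.
apply: nearW => m.
have hB : (fun M => (B * expR (- series lam M))%:E) @ \oo --> (B * expR (- c))%:E.
  apply/fine_cvgP; split; first exact: nearW.
  apply: cvgM; first exact: cvg_cst.
  by apply: continuous_cvg; [exact: continuous_expR|exact: cvgN].
rewrite -(cvg_lim _ hB)//; apply: lime_ge; first exact: cvgP hB.
near=> M.
have LM : (L <= M)%N by near: M; exact: nbhs_infty_ge.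
have mM : (m <= M)%N by near: M; exact: nbhs_infty_ge.
apply: (@le_trans _ _ (\prod_(0 <= k < M) e k)%:E); last by rewrite lee_fin eB.
apply: le_trans (integral_prod_le M h0 he).
apply: (@le_trans _ _ (\int[P]_(w in A m) (\prod_(0 <= k < M) h k (X k w))%:E)%E).
  apply: ge0_le_integral => //.
  - exact: measurable_funTS.
  - apply/measurable_EFinP; apply: measurable_funTS; exact: measurable_prod_comp.
  - by move=> w Aw; apply: (fle w m M) => // k mk; exact: Aw.
apply: ge0_subset_integral => //.
- by apply/measurable_EFinP; exact: measurable_prod_comp.
- by move=> w _; rewrite lee_fin; apply: prodr_ge0.
Unshelve. all: by end_near. Qed.

Lemma poisson_configuration_ge (n : nat -> nat) (L : nat) (c : R) :
  (forall k, (L <= k)%N -> n k = 0%N) -> series lam @ \oo --> c ->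
  ((expR (- c) * \prod_(0 <= k < L) (lam k ^+ n k / (n k)`!%:R))%:E
   <= P (\bigcap_k (X k @^-1` [set n k])))%E.
Proof.
move=> n0 lamc.
pose F M := \bigcap_(k in [set` iota 0 M]) (X k @^-1` [set n k]).
have mF M : measurable (F M) by exact: (measurable_cylinder _ (fun k => [set n k])).
have EF : \bigcap_k (X k @^-1` [set n k]) = \bigcap_M F M.
  apply/seteqP; split => [w Hw M _ k _|w Hw k _]; first exact: Hw.
  by apply: (Hw k.+1) => //; change (k \in iota 0 k.+1); rewrite mem_iota add0n ltnSn.
have niF : nonincreasing_seq F.
  move=> m M mM; apply/subsetPset => w Hw k /= km; apply: Hw => /=.
  by move: km; rewrite !mem_iota/= !add0n => /leq_trans; apply.
have PF M : (L <= M)%N -> P (F M) =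
    (expR (- series lam M) * \prod_(0 <= k < L) (lam k ^+ n k / (n k)`!%:R))%:E.
  move=> LM; rewrite /F (XP.2 (iota 0 M) (fun k => [set n k])) ?iota_uniq//.
  congr (_%:E); under eq_bigr do rewrite poisson_pointE/= /poisson_weight.
  rewrite big_split/=; congr (_ * _).
    rewrite /series/= -sumrN expR_sum; apply: congr_big => //.
    by rewrite /index_iota subn0.
  have -> : iota 0 M = index_iota 0 M by rewrite /index_iota subn0.
  rewrite (big_cat_nat (leq0n L) LM)/= [X in _ * X]big_nat [X in _ * X]big1 ?mulr1//.
  by move=> k /andP[Lk _]; rewrite n0// expr0 fact0 invr1 mulr1.
have mI : measurable (\bigcap_M F M) by exact: bigcap_measurableType.
have hF := nonincreasing_cvg_mu (mu := P) (F := F) ltac:(by rewrite -ge0_fin_numE// fin_num_measure) mF mI niF.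
rewrite EF -(cvg_lim _ hF)//; apply: lime_ge; first exact: cvgP hF.
near=> M.
have LM : (L <= M)%N by near: M; exact: nbhs_infty_ge.
rewrite /= PF// lee_fin; apply: ler_wpM2r.
  by apply: prodr_ge0 => k _; rewrite divr_ge0// exprn_ge0.
rewrite ler_expR lerN2 -(cvg_lim _ lamc)//.
apply: nondecreasing_cvgn_le; last exact: cvgP lamc.
by apply/nondecreasing_seqP => k; rewrite -subr_ge0 seriesSB.
Unshelve. all: by end_near. Qed.

End independent_poisson_integrals.

Section partition_function.
Context {R : realType} (dO : measure_display) (Omega : measurableType dO).
Variables (P : probability Omega R) (X : nat -> {RV P >-> nat}) (lam : nat -> R).
Variables (d : nat) (a b beta V : R).
Hypotheses (d_gt0 : (0 < d)%N) (b_ge0 : 0 <= b) (ba : b < a).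
Hypotheses (beta_gt0 : 0 < beta) (V_gt0 : 0 < V).
Hypotheses (lam_ge0 : forall k, 0 <= lam k) (XP : independent_poisson X lam).

Local Notation q0 := (fun k => q d beta 0 k.+1).
Local Notation Q := (q_total d beta).
Local Notation min_energy_d := (min_energy a b beta q0 Q).

Definition config (w : Omega) : nat -> R := fun k => (X k w)%:R / V.

Definition tilted_hamiltonian (a b : R) K (mu s : R) (x : nat -> R) : R :=
  - (mu + s) * fine (D x) + a / 2 * fine (D x) ^+ 2 - b / 2 * fine (sumsq x)
  + s * D_trunc K x.

Definition gibbs_weight K mu s w : R :=
  if `[< (D (config w) < +oo)%E >]
  then expR (- (beta * V * tilted_hamiltonian a b K mu s (config w))) else 0.

Lemma config_ge0 w k : 0 <= config w k.
Proof. by rewrite divr_ge0// ltW. Qed.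

Lemma nneseries_finite_support (u : nat -> R) m M : (forall k, 0 <= u k) ->
  (m <= M)%N -> (forall k, (m <= k)%N -> u k = 0) ->
  (\sum_(0 <= k <oo) (u k)%:E)%E = (\sum_(0 <= k < M) u k)%:E.
Proof.
move=> u0 mM uz; apply: nneseries_EFin_cvg => //; apply: cvg_near_cst; near=> n.
have Mn : (M <= n)%N by near: n; exact: nbhs_infty_ge.
rewrite /series/= (big_cat_nat (leq0n M) Mn)/= [X in _ + X]big_nat [X in _ + X]big1 ?addr0//.
by move=> k /andP[Mk _]; rewrite uz// (leq_trans mM).
Unshelve. all: by end_near. Qed.

Lemma config_finite w m M : (m <= M)%N -> (forall k, (m <= k)%N -> X k w = 0%N) ->
  D (config w) = (D_trunc M (config w))%:E /\
  sumsq (config w) = (sumsq_trunc M (config w))%:E.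
Proof.
move=> mM X0.
have c0 k : (m <= k)%N -> config w k = 0 by move=> mk; rewrite /config X0// mul0r.
split; apply: (nneseries_finite_support _ mM).
- by move=> k; rewrite mulr_ge0// config_ge0.
- by move=> k mk; rewrite c0// mulr0.
- by move=> k; rewrite mulr_ge0// sqr_ge0.
- by move=> k mk; rewrite c0// expr0n mulr0.
Qed.

Lemma D_config_infinite w : (forall M, exists2 k, (M <= k)%N & X k w <> 0%N) ->
  ~ (D (config w) < +oo)%E.
Proof.
move=> Xinf Dw.
have h := D_trunc_cvg (config_ge0 w) Dw.
have := @cvg_series_cvg_0 _ _ (fun k => k.+1%:R * config w k : R^o) (cvgP _ h).
move=> /cvgrPdist_lt/(_ V^-1); rewrite invr_gt0 => /(_ V_gt0)[M _ hM].
have [k Mk Xk] := Xinf M; have := hM k Mk.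
rewrite /= sub0r normrN ger0_norm; last by apply: mulr_ge0 => //; exact: config_ge0.
rewrite /config mulrA.
rewrite -[X in _ < X]mul1r ltr_pM2r ?invr_gt0// ltNge => /negP; apply.
rewrite -[leLHS]mulr1 ler_pM ?ler1n// lt0n; exact/eqP.
Qed.

Lemma gibbs_weight_ge0 K mu s w : 0 <= gibbs_weight K mu s w.
Proof. by rewrite /gibbs_weight; case: ifP => // _; rewrite expR_ge0. Qed.

Lemma measurable_config k : measurable_fun setT (fun w => config w k).
Proof.
by apply: measurable_funM => //; exact: (measurable_fun_nat X (fun n => n%:R)).
Qed.

Lemma measurable_D_config : measurable_fun setT (fun w => D (config w)).
Proof.
apply: ge0_emeasurable_sum => [k w _ _|k _]; first by rewrite lee_fin mulr_ge0// config_ge0.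
apply/measurable_EFinP; apply: measurable_funM => //.
exact: measurable_config.
Qed.

Lemma measurable_sumsq_config : measurable_fun setT (fun w => sumsq (config w)).
Proof.
apply: ge0_emeasurable_sum => [k w _ _|k _]; first by rewrite lee_fin mulr_ge0// sqr_ge0.
apply/measurable_EFinP; apply: measurable_funM => //.
by apply: measurable_funX; exact: measurable_config.
Qed.

Lemma measurable_D_trunc_config K : measurable_fun setT (fun w => D_trunc K (config w)).
Proof.
rewrite /D_trunc; apply: measurable_sum => k.
apply: measurable_funM => //; exact: measurable_config.
Qed.

Lemma measurable_fine_comp (f : Omega -> \bar R) : measurable_fun setT f ->
  measurable_fun setT (fun w => fine (f w)).
Proof. by move=> mf; apply: measurableT_comp mf => //; exact: fine_measurable. Qed.

Lemma measurable_gibbs_weight K mu s : measurable_fun setT (gibbs_weight K mu s).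
Proof.
apply: measurable_fun_ifT => //.
  rewrite (_ : (fun w => _) = (fun w => (D (config w) < +oo)%E)); last first.
    by apply/funext => w; rewrite asboolb.
  by apply: measurable_fun_lte => //; exact: measurable_D_config.
apply: measurableT_comp => //; apply: measurableT_comp => //.
apply: measurable_funM => //.
have mD := measurable_fine_comp measurable_D_config.
have mS := measurable_fine_comp measurable_sumsq_config.
apply: measurable_funD; last first.
  by apply: measurable_funM => //; exact: measurable_D_trunc_config.
apply: measurable_funB; last exact: measurable_funM.
by apply: measurable_funD; apply: measurable_funM => //; exact: measurable_funX.
Qed.

Lemma poisson_weight_exp_moment (l c : R) : 0 <= l -> 0 <= c ->
  (\sum_(0 <= n <oo) (c ^+ n * poisson_weight l n)%:E)%E = (expR (- l) * expR (c * l))%:E.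
Proof.
move=> l0 c0; apply: nneseries_EFin_cvg.
  by move=> n; rewrite mulr_ge0 ?exprn_ge0// poisson_weight_ge0.
rewrite (_ : series _ = expR (- l) \*o series (exp_coeff (c * l))); last first.
  apply/funext => M; rewrite /series/= mulr_sumr; apply: eq_bigr => n _.
  by rewrite /poisson_weight exp_coeffE exprMn; ring.
apply: cvgM; first exact: cvg_cst.
exact: is_cvg_series_exp_coeff.
Qed.

Lemma natXn_le_fact (n : nat) : n%:R ^+ n * expR (- 1) ^+ n <= n`!%:R :> R.
Proof.
case: n => [|n]; first by rewrite !expr0 mul1r fact0.
rewrite -expRM_natl mulrN1 expRN.
rewrite ler_pdivrMr ?expR_gt0// mulrC -ler_pdivrMr ?ltr0n ?fact_gt0//.
have := @expR_ge1Dxn R n.+1%:R n (ler0n _ _); lra.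
Qed.

Lemma poisson_weight_entropy_moment (l u y t : R) : 0 <= l -> 0 < u -> 0 < y ->
  l * t <= y * u -> 0 < t -> u < 1 ->
  (\sum_(0 <= n <oo) (expR (n%:R * (ln t + ln (n%:R / y) - 1)) * poisson_weight l n)%:E
    <= (expR (- l) * (1 - u)^-1)%:E)%E.
Proof.
move=> l0 u0 y0 ltu t0 u1.
have <- : (\sum_(0 <= n <oo) (expR (- l) * u ^+ n)%:E)%E = (expR (- l) * (1 - u)^-1)%:E.
  apply: nneseries_EFin_cvg.
    by move=> n; rewrite mulr_ge0 ?expR_ge0// exprn_ge0// ltW.
  by apply: cvg_geometric_series; rewrite ger0_norm ?ltW.
apply: lee_nneseries => n _.
  by move=> _; rewrite lee_fin mulr_ge0 ?expR_ge0// poisson_weight_ge0.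
rewrite lee_fin /poisson_weight mulrCA ler_wpM2l ?expR_ge0//.
case: n => [|n]; first by rewrite mul0r expR0 !expr0 fact0 invr1 !mulr1.
have n0 : 0 < n.+1%:R :> R by [].
rewrite expRM_natl expRB expRD lnK ?posrE// lnK ?posrE ?divr_gt0//.
rewrite mulrA ler_pdivrMr ?ltr0n ?fact_gt0// -exprMn.
apply: (@le_trans _ _ ((u * (n.+1%:R * expR (- 1))) ^+ n.+1)).
  rewrite lerXn2r ?nnegrE ?mulr_ge0 ?invr_ge0 ?expR_ge0 ?(ltW t0) ?(ltW y0) ?(ltW u0)//.
  rewrite expRN.
  have -> : t * (n.+1%:R / y) / expR 1 * l = (l * t / y) * (n.+1%:R / expR 1) by ring.
  by rewrite ler_wpM2r ?divr_ge0 ?expR_ge0// ler_pdivrMr// [leRHS]mulrC.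
rewrite exprMn ler_wpM2l ?exprn_ge0 ?(ltW u0)// exprMn; exact: natXn_le_fact.
Qed.

Section upper_bound.
Variables (alpha r eta : R).
Hypotheses (r_gt0 : 0 < r) (lam_le : forall k, lam k <= V * (r * q d beta alpha k.+1)).
Hypotheses (eta_gt0 : 0 < eta) (r_eta : r * expR (- (beta * eta)) < 1).

Let u := r * expR (- (beta * eta)).
Let t k := expR (- (beta * (alpha + eta) * k.+1%:R)).

Let lam_t k : lam k * t k <= V * q0 k * u.
Proof.
apply: le_trans (ler_wpM2r (expR_ge0 _) (lam_le k)) _.
rewrite (q_tilt d beta alpha) /u /t.
have -> : V * (r * (expR (beta * alpha * k.+1%:R) * q d beta 0 k.+1)) *
    expR (- (beta * (alpha + eta) * k.+1%:R)) =
    V * q0 k * (r * (expR (beta * alpha * k.+1%:R)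
                 * expR (- (beta * (alpha + eta) * k.+1%:R)))) by ring.
have Vq : 0 <= V * q0 k by rewrite mulr_ge0 ?(ltW V_gt0)// ltW// q_gt0.
rewrite ler_wpM2l// ler_wpM2l ?(ltW r_gt0)// -expRD ler_expR.
have -> : beta * alpha * k.+1%:R - beta * (alpha + eta) * k.+1%:R
  = - (beta * eta) - (beta * eta) * k%:R by rewrite -natr1; ring.
by rewrite gerBl mulr_ge0// mulr_ge0// ltW.
Qed.

Let h L k n := if (k < L)%N
  then expR (n%:R * (ln (t k) + ln (n%:R / (V * q0 k)) - 1)) else t k ^+ n.

Let e L k := if (k < L)%N then expR (- lam k) * (1 - u)^-1
  else expR (- lam k) * expR (V * (r * q0 k)).

Let h_ge0 L k n : 0 <= h L k n.
Proof. by rewrite /h; case: ifP => // _; rewrite ?exprn_ge0// expR_ge0. Qed.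

Let u_gt0 : 0 < u. Proof. by rewrite mulr_gt0// expR_gt0. Qed.

Let h_moment L k :
  (\sum_(0 <= n <oo) (h L k n * poisson_weight (lam k) n)%:E <= (e L k)%:E)%E.
Proof.
have Vq : 0 < V * q0 k by rewrite mulr_gt0// q_gt0.
rewrite /h /e; case: ifP => _.
  exact: poisson_weight_entropy_moment (lam_ge0 k) u_gt0 Vq (lam_t k) (expR_gt0 _) r_eta.
rewrite poisson_weight_exp_moment ?expR_ge0// lee_fin ler_wpM2l ?expR_ge0//.
rewrite ler_expR mulrC; apply: le_trans (lam_t k) _.
have -> : V * (r * q d beta 0 k.+1) = V * q0 k * (r * 1) by ring.
rewrite /u ler_wpM2l ?(ltW Vq)// ler_wpM2l ?(ltW r_gt0)// -expR0 ler_expR.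
by rewrite oppr_le0 mulr_ge0// ltW.
Qed.

Let prod_e L M : (L <= M)%N -> \prod_(0 <= k < M) e L k <=
  (1 - u)^-1 ^+ L * expR (V * (r * (Q - series q0 L))) * expR (- series lam M).
Proof.
move=> LM; rewrite (big_cat_nat (leq0n L) LM)/=.
rewrite (eq_big_nat _ _ (F2 := fun k => expR (- lam k) * (1 - u)^-1)); last first.
  by move=> k /andP[_ kL]; rewrite /e kL.
rewrite [X in _ * X](eq_big_nat _ _ (F2 := fun k => expR (- lam k) * expR (V * (r * q0 k)))); last first.
  by move=> k /andP[Lk _]; rewrite /e ltnNge Lk.
rewrite !big_split/= prodr_const_nat subn0 mulrACA.
have -> : \prod_(0 <= i < L) expR (- lam i) * \prod_(L <= i < M) expR (- lam i)
    = expR (- series lam M).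
  by rewrite -(big_cat_nat (leq0n L) LM)/= -expR_sum sumrN.
rewrite mulrC ler_wpM2r ?expR_ge0// ler_wpM2l ?exprn_ge0 ?invr_ge0 ?subr_ge0 ?(ltW r_eta)//.
rewrite -expR_sum ler_expR -mulr_sumr ler_wpM2l ?(ltW V_gt0)//.
rewrite -mulr_sumr ler_wpM2l ?(ltW r_gt0)//.
have -> : \sum_(L <= i < M) q0 i = series q0 M - series q0 L.
  by rewrite sub_series_geq.
rewrite lerD2r; apply: (series_le_total (fun k => q_gt0 d beta_gt0 0 k)).
exact: series_q_cvg.
Qed.

Let C K mu s := expR (- (beta * V * min_energy_d K (mu + alpha + eta) s) + V * Q).

Let gibbs_weight_le K L mu s w m M : (K <= L)%N -> (L <= M)%N -> (m <= M)%N ->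
  (forall k, (m <= k)%N -> X k w = 0%N) ->
  gibbs_weight K mu s w <= C K mu s * \prod_(0 <= k < M) h L k (X k w).
Proof.
move=> KL LM mM X0.
have [DE SE] := config_finite mM X0.
rewrite /gibbs_weight DE asboolT ?ltry//.
set x := config w.
have x0 := config_ge0 w : forall k, 0 <= x k.
have XV k : (X k w)%:R = V * x k by rewrite /x /config mulrC divfK// gt_eqF.
have hE k : h L k (X k w) = expR (V * (- (beta * (alpha + eta)) * (k.+1%:R * x k)
    + (if (k < L)%N then x k * (ln (x k / q0 k) - 1) else 0))).
  have -> : V * (- (beta * (alpha + eta)) * (k.+1%:R * x k) +
    (if (k < L)%N then x k * (ln (x k / q0 k) - 1) else 0)) =
    V * x k * (- (beta * (alpha + eta) * k.+1%:R) +
      (if (k < L)%N then (ln (x k / q0 k) - 1) else 0)).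
    by case: ifP => _; ring.
  rewrite -XV /h; case: ifP => _; last by rewrite addr0 expRM_natl.
  congr (expR (_ * _)); rewrite /t expRK -addrA; congr (_ + (ln _ - _)).
  by rewrite /x /config invfM mulrA.
under eq_bigr do rewrite hE.
rewrite -expR_sum -expRD ler_expR -mulr_sumr big_split/= -mulr_sumr.
have -> : \sum_(0 <= k < M) (if (k < L)%N then x k * (ln (x k / q0 k) - 1) else 0)
    = ent_trunc q0 L x.
  rewrite (big_cat_nat (leq0n L) LM)/= [X in _ + X]big_nat [X in _ + X]big1 ?addr0.
    by apply: eq_big_nat => k /andP[_ kL]; rewrite kL.
  by move=> k /andP[Lk _]; rewrite ltnNge Lk.
rewrite -/(D_trunc M x) /tilted_hamiltonian DE SE/=.
have DL := D_trunc_nd x0 LM.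
have del0 : 0 <= D_trunc M x - D_trunc L x by rewrite subr_ge0.
have := min_energy_le (fun k => q_gt0 d beta_gt0 0 k) (series_q_cvg d_gt0 beta_gt0)
  b_ge0 ba beta_gt0 (mu + alpha + eta) s KL x0 (cvg_ln_q_div d beta_gt0) del0.
rewrite /free_energy (addrC (D_trunc L x)) subrK.
have := sumsq_trunc_le x0 LM.
move: (min_energy _ _ _ _ _ _ _ _) (D_trunc M x) (D_trunc L x) (D_trunc K x)
  (sumsq_trunc M x) (sumsq_trunc L x) (ent_trunc q0 L x) => g DM DL' DK SM SL EL hS hg.
have bV : 0 < beta * V by rewrite mulr_gt0.
have hbS := ler_wpM2l (divr_ge0 b_ge0 (ler0n _ 2)) hS.
have hg2 : g <= - (mu + alpha + eta + s) * DM + a / 2 * DM ^+ 2 - b / 2 * SM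
     + s * DK + beta^-1 * (EL + Q) by lra.
have := ler_wpM2l (ltW bV) hg2.
have -> : beta * V * (- (mu + alpha + eta + s) * DM + a / 2 * DM ^+ 2 - b / 2 * SM +
    s * DK + beta^-1 * (EL + Q)) = beta * V * (- (mu + s) * DM + a / 2 * DM ^+ 2 -
    b / 2 * SM + s * DK) + V * (- (beta * (alpha + eta)) * DM + EL) + V * Q.
  by field; rewrite gt_eqF.
lra.
Qed.

Lemma partition_function_le K L mu s c : (K <= L)%N -> series lam @ \oo --> c ->
  (\int[P]_w (gibbs_weight K mu s w)%:E <=
   (expR (- (beta * V * min_energy_d K (mu + alpha + eta) s) + V * Q) *
    ((1 - r * expR (- (beta * eta)))^-1 ^+ L
     * expR (V * (r * (Q - series q0 L))) * expR (- c)))%:E)%E.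
Proof.
move=> KL lamc; rewrite -/(C K mu s) -/u.
have C0 : 0 < C K mu s by exact: expR_gt0.
have -> : (\int[P]_w (gibbs_weight K mu s w)%:E =
    \int[P]_w ((C K mu s)%:E * ((C K mu s)^-1 * gibbs_weight K mu s w)%:E))%E.
  by apply: eq_integral => w _; rewrite -EFinM mulrA mulfV ?gt_eqF// mul1r.
have mf : measurable_fun setT (fun w => ((C K mu s)^-1 * gibbs_weight K mu s w)%:E).
  apply/measurable_EFinP; apply: measurable_funM => //.
  exact: measurable_gibbs_weight.
have f0 w : (0 <= ((C K mu s)^-1 * gibbs_weight K mu s w)%:E)%E.
  by rewrite lee_fin mulr_ge0 ?invr_ge0 ?(ltW C0)// gibbs_weight_ge0.
rewrite ge0_integralZl_EFin ?(ltW C0)// EFinM lee_wpmul2l ?lee_fin ?(ltW C0)//.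
apply: (integral_le_of_finite_products lam_ge0 XP (@h_ge0 L)
  (@h_moment L) mf f0 _ _ (@prod_e L) lamc).
  move=> w Xinf; rewrite /gibbs_weight asboolF ?mulr0//.
  exact: D_config_infinite.
move=> w m M LM mM X0; rewrite lee_fin ler_pdivrMl//.
exact: (gibbs_weight_le _ _ KL LM mM X0).
Qed.

End upper_bound.

Lemma partition_function_ge K L mu s c (n : nat -> nat) : (K <= L)%N ->
  (forall k, (L <= k)%N -> n k = 0%N) -> series lam @ \oo --> c ->
  let y := fun k => (n k)%:R / V in
  ((expR (- (beta * V * (- (mu + s) * D_trunc L y + a / 2 * D_trunc L y ^+ 2
       - b / 2 * sumsq_trunc L y + s * D_trunc K y))) *
    (expR (- c) * \prod_(0 <= k < L) (lam k ^+ n k / (n k)`!%:R)))%:E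
   <= \int[P]_w (gibbs_weight K mu s w)%:E)%E.
Proof.
move=> KL n0 lamc; cbv zeta; set y := fun k => _.
set H := - (mu + s) * D_trunc L y + _ - _ + _.
pose E := \bigcap_k (X k @^-1` [set n k]).
have mE : measurable E by apply: bigcap_measurableType => k _; exact: measurable_preim.
have wE w : E w -> gibbs_weight K mu s w = expR (- (beta * V * H)).
  move=> Ew; have Xn k : X k w = n k by exact: Ew.
  have cy : config w = y by apply/funext => k; rewrite /config Xn.
  have [DE SE] := config_finite (leqnn L) (fun k Lk => etrans (Xn k) (n0 k Lk)).
  by rewrite /gibbs_weight DE asboolT ?ltry// /tilted_hamiltonian DE SE cy.
rewrite EFinM.
apply: (@le_trans _ _ (\int[P]_(w in E) (gibbs_weight K mu s w)%:E)%E); last first.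
  apply: ge0_subset_integral => //.
  - by apply/measurable_EFinP; exact: measurable_gibbs_weight.
  - by move=> w _; rewrite lee_fin gibbs_weight_ge0.
have -> : (\int[P]_(w in E) (gibbs_weight K mu s w)%:E =
    \int[P]_(w in E) (expR (- (beta * V * H)))%:E)%E.
  by apply: eq_integral => w; rewrite inE => /wE ->.
rewrite integral_cst// lee_wpmul2l ?lee_fin ?expR_ge0//.
exact: (poisson_configuration_ge lam_ge0 XP n0 lamc).
Qed.

End partition_function.

Section log_asymptotics.
Context {R : realType}.

Lemma ln_fact_le (n : nat) :
  ln (n.+1)`!%:R <= n.+2%:R * ln n.+1%:R + 1 - n.+1%:R :> R.
Proof.
elim: n => [|n IH]; first by rewrite factS fact0 muln1 ln1 mulr0 add0r subrr.
rewrite factS natrM lnM ?posrE ?ltr0n ?fact_gt0//.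
have h : 1 <= n.+2%:R * (ln n.+2%:R - ln n.+1%:R) :> R.
  have := @le_ln1Dx R (- n.+2%:R^-1).
  rewrite ltrN2 invf_lt1 ?ltr1n// => /(_ isT).
  have -> : 1 - n.+2%:R^-1 = n.+1%:R / n.+2%:R :> R.
    have e : n.+2%:R != 0 :> R by [].
    by apply: (mulIf e); rewrite divfK// mulrBl mul1r mulVf// -[n.+2%:R]natr1 addrK.
  rewrite ln_div ?posrE// lerNr opprB => h.
  have := ler_wpM2l (ler0n R n.+2) h.
  by rewrite mulfV.
move: IH h; rewrite -(natr1 n.+2) -(natr1 n.+1).
move: (ln (n.+1)`!%:R) (ln (n.+1%:R + 1)) (ln n.+1%:R) => u v w; lra.
Qed.

Lemma poisson_term_lower_bound (V r : nat -> R) (x p : R) : 0 <= x -> 0 < p ->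
  V @ \oo --> +oo -> r @ \oo --> p ->
  exists tau : nat -> R, tau @ \oo --> - (x * (ln (x / p) - 1)) /\
    \forall N \near \oo, expR (V N * tau N) <=
      (V N * r N) ^+ Num.truncn (V N * x) / (Num.truncn (V N * x))`!%:R.
Proof.
rewrite le_eqVlt => /orP[/eqP <- p0 Voo rp|x0 p0 Voo rp].
  exists (fun=> 0); split; first by rewrite mul0r oppr0; exact: cvg_cst.
  apply: nearW => N.
  by rewrite !mulr0 expR0 truncn0 expr0 fact0 invr1 mulr1.
pose n N := Num.truncn (V N * x).
pose y N := (n N)%:R / V N.
have Vx : (fun N => V N * x) @ \oo --> +oo.
  apply/cvgryPge => A; near=> N; rewrite -ler_pdivrMr//.
  by near: N; move/cvgryPge : Voo; apply.
have noo : n @ \oo --> \oo.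
  apply/cvgnyPge => A; near=> N.
  have VN : A%:R <= V N * x by near: N; move/cvgryPge : Vx; apply.
  by rewrite /n truncn_ge_nat// (le_trans _ VN).
have Vi : (fun N => (V N)^-1) @ \oo --> 0 by apply/gtr0_cvgV0; [
  by move/cvgryPgt : Voo; apply|].
have yx : y @ \oo --> x.
  have h1 : (fun N => x - (V N)^-1) @ \oo --> x.
    by rewrite -[X in _ --> X]subr0; apply: cvgB => //; exact: cvg_cst.
  apply: squeeze_cvgr h1 (cvg_cst x); near=> N.
  have V0 : 0 < V N by near: N; move/cvgryPgt : Voo; apply.
  have Vx0 : 0 <= V N * x by rewrite mulr_ge0// ltW.
  have /andP[h2 h3] := truncn_itv Vx0.
  apply/andP; split; last by rewrite ler_pdivrMr// mulrC.
  by rewrite ler_pdivlMr// mulrBl mulVf ?gt_eqF// mulrC lerBlDr natr1 ltW.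
have lnn : (fun N => ln (n N)%:R / V N) @ \oo --> 0.
  have h : (fun N => ln (n N).-1.+1%:R / (n N).-1.+1%:R : R) @ \oo --> (0 : R).
    apply: (@cvg_comp _ _ _ (fun N => (n N).-1) (fun M => ln (M.+1%:R : R) / M.+1%:R)).
      2: exact: cvg_ln_div.
    apply/cvgnyPge => A; near=> N.
    have : (A.+1 <= n N)%N by near: N; move/cvgnyPge : noo; apply.
    by case: (n N).
  have h2 : (fun N => ln (n N).-1.+1%:R / (n N).-1.+1%:R * y N) @ \oo --> 0.
    by rewrite -(mul0r x); apply: cvgM.
  apply: cvg_trans h2; apply: near_eq_cvg; near=> N.
  have n0 : (0 < n N)%N by near: N; move/cvgnyPge : noo; apply.
  rewrite /y prednK// mulrA divfK//.
  by rewrite pnatr_eq0 -lt0n.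
exists (fun N => y N * ln (r N) - y N * ln (y N) + y N - ln (n N)%:R / V N - (V N)^-1).
split.
  have -> : - (x * (ln (x / p) - 1)) = x * ln p - x * ln x + x - 0 - 0.
    by rewrite ln_div ?posrE//; ring.
  apply: cvgB => //; apply: cvgB => //; apply: cvgD => //; apply: cvgB.
    by apply: cvgM => //; apply: continuous_cvg => //; exact: continuous_ln.
  by apply: cvgM => //; apply: continuous_cvg => //; exact: continuous_ln.
near=> N.
have n0 : (0 < n N)%N by near: N; move/cvgnyPge : noo; apply.
have V0 : 0 < V N by near: N; move/cvgryPgt : Voo; apply.
have r0 : 0 < r N by near: N; move/cvgrPdist_lt : rp => /(_ _ p0); apply: filterS => N;
  rewrite ltr_norml; lra.
rewrite -/(n N).
have nR : 0 < (n N)%:R :> R by rewrite ltr0n.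
have f0 : 0 < (n N)`!%:R :> R by rewrite ltr0n fact_gt0.
have Vr0 : 0 < V N * r N by rewrite mulr_gt0.
rewrite -[leRHS]lnK ?posrE ?divr_gt0 ?exprn_gt0// ler_expR.
rewrite ln_div ?posrE ?exprn_gt0// lnXn// lnM ?posrE// -[(_ + _) *+ n N]mulr_natl.
rewrite /y ln_div ?posrE//.
have := ln_fact_le (n N).-1; rewrite prednK// -(natr1 (n N)).
have -> : V N * ((n N)%:R / V N * ln (r N) - (n N)%:R / V N * (ln (n N)%:R - ln (V N))
   + (n N)%:R / V N - ln (n N)%:R / V N - (V N)^-1) =
   (n N)%:R * ln (r N) - (n N)%:R * (ln (n N)%:R - ln (V N)) + (n N)%:R
   - ln (n N)%:R - 1 by field; rewrite gt_eqF.
move: (ln (n N)`!%:R) (ln (n N)%:R) (ln (V N)) (ln (r N)) => u v w z; lra.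
Unshelve. all: by end_near. Qed.

Lemma cvg_sumsq_trunc (T : Type) (F : set_system T) (FF : Filter F)
  (f : T -> nat -> R) x L : (forall k, f s k @[s --> F] --> x k) ->
  sumsq_trunc L (f s) @[s --> F] --> sumsq_trunc L x.
Proof.
move=> fx; elim: L => [|L IH].
  rewrite (_ : (fun s => _) = fun=> sumsq_trunc 0 x); first exact: cvg_cst.
  by apply/funext => s; rewrite /sumsq_trunc !big_geq.
rewrite (_ : (fun s => _) = fun s => sumsq_trunc L (f s) + L.+1%:R ^+ 2 * f s L ^+ 2);
  last by apply/funext => s; rewrite /sumsq_trunc big_nat_recr.
rewrite {2}/sumsq_trunc big_nat_recr//=; apply: cvgD; first exact: IH.
by apply: cvgM; [exact: cvg_cst|rewrite expr2; apply: cvgM].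
Qed.

End log_asymptotics.

Section pressure_limit.
Context {R : realType}.
Variables (d : nat) (a b beta : R).
Hypotheses (d_gt0 : (0 < d)%N) (b_ge0 : 0 <= b) (ba : b < a).
Hypothesis (beta_gt0 : 0 < beta).

Local Notation q0 := (fun k => q d beta 0 k.+1).
Local Notation Q := (q_total d beta).
Local Notation min_energy_d := (min_energy a b beta q0 Q).

Variables (alpha mu s : R) (K : nat).
Variables (V c rho Z : nat -> R) (r : nat -> nat -> R).
Hypotheses (Voo : V @ \oo --> +oo) (rho1 : rho @ \oo --> (1 : R)).
Hypothesis r_cvg : forall k, (fun N => r N k) @ \oo --> q d beta alpha k.+1.

Hypothesis Z_le : \forall N \near \oo, forall L eta, (K <= L)%N -> 0 < eta ->
  rho N * expR (- (beta * eta)) < 1 ->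
  Z N <= expR (- (beta * V N * min_energy_d K (mu + alpha + eta) s) + V N * Q) *
    ((1 - rho N * expR (- (beta * eta)))^-1 ^+ L
     * expR (V N * (rho N * (Q - series q0 L))) * expR (- c N)).

Hypothesis Z_ge : \forall N \near \oo, forall L (n : nat -> nat), (K <= L)%N ->
  (forall k, (L <= k)%N -> n k = 0%N) ->
  let y := fun k => (n k)%:R / V N in
  expR (- (beta * V N * (- (mu + s) * D_trunc L y + a / 2 * D_trunc L y ^+ 2
       - b / 2 * sumsq_trunc L y + s * D_trunc K y))) *
    (expR (- c N) * \prod_(0 <= k < L) ((V N * r N k) ^+ n k / (n k)`!%:R)) <= Z N.

Let pressureN N := (beta * V N)^-1 * (ln (Z N) + c N) - beta^-1 * Q.

Let V_gt0 : \forall N \near \oo, 0 < V N.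
Proof. by move/cvgryPgt : Voo; apply. Qed.

Let Z_gt0 : \forall N \near \oo, 0 < Z N.
Proof.
near=> N.
have h : forall L (n : nat -> nat), (K <= L)%N ->
  (forall k, (L <= k)%N -> n k = 0%N) ->
  let y := fun k => (n k)%:R / V N in
  expR (- (beta * V N * (- (mu + s) * D_trunc L y + a / 2 * D_trunc L y ^+ 2
       - b / 2 * sumsq_trunc L y + s * D_trunc K y))) *
    (expR (- c N) * \prod_(0 <= k < L) ((V N * r N k) ^+ n k / (n k)`!%:R)) <= Z N.
  by near: N.
apply: lt_le_trans (h K (fun=> 0%N) (leqnn K) (fun _ _ => erefl)).
rewrite !mulr_gt0 ?expR_gt0//; apply: prodr_gt0 => k _.
by rewrite expr0 fact0 invr1 mulr1.
Unshelve. all: by end_near. Qed.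

Lemma pressure_limsup eps : 0 < eps -> \forall N \near \oo,
  pressureN N <= - min_energy_d K (mu + alpha) s + eps.
Proof.
move=> e0; set m := mu + alpha.
set g0 := min_energy_d K m s; set g1 := min_energy_d K (m + 1) s.
have q_pos := fun k => q_gt0 d beta_gt0 0 k.
have [eta [eta0 eta1 heta]] : exists eta, [/\ 0 < eta, eta <= 1 &
    g0 - eps / 4 <= min_energy_d K (m + eta) s].
  pose eta := Num.min 1 (eps / 4 / (1 + `|g1 - g0|)).
  have A0 : 0 < 1 + `|g1 - g0| by rewrite ltr_pwDl.
  have eta0 : 0 < eta by rewrite lt_min ltr01/= !divr_gt0.
  have eta1 : eta <= 1 by rewrite ge_min lexx.
  have eta2 : eta * `|g1 - g0| <= eps / 4.
    apply: (@le_trans _ _ (eta * (1 + `|g1 - g0|))).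
      by rewrite ler_wpM2l ?(ltW eta0)// lerDr.
    by rewrite -ler_pdivlMr// ge_min lexx orbT.
  exists eta; split => //.
  have h := min_energy_concave q_pos (series_q_cvg d_gt0 beta_gt0) b_ge0 ba beta_gt0
    K m s (t := eta).
  apply: le_trans (h _); last by rewrite ltW.
  rewrite -/g0 -/g1.
  have : - (eta * `|g1 - g0|) <= eta * (g1 - g0).
    by rewrite -mulrN ler_wpM2l ?(ltW eta0)// lerNl -normrN ler_norm.
  lra.
have bi0 : 0 < beta^-1 by rewrite invr_gt0.
have [L [KL hL]] : exists L, (K <= L)%N /\ beta^-1 * (Q - series q0 L) <= eps / 8.
  have htail : beta^-1 * (Q - series q0 L) @[L --> \oo] --> 0.
    rewrite -[X in _ --> X](mulr0 beta^-1); apply: cvgM; first exact: cvg_cst.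
    rewrite -[X in _ --> X](subrr Q); apply: cvgB; first exact: cvg_cst.
    exact: series_q_cvg.
  have hn : \forall L \near \oo, (K <= L)%N /\ beta^-1 * (Q - series q0 L) <= eps / 8.
    near=> L; split; first by near: L; exact: nbhs_infty_ge.
    have : `|0 - beta^-1 * (Q - series q0 L)| <= eps / 8.
      by near: L; move/cvgrPdist_le : htail; apply; exact: divr_gt0.
    by rewrite sub0r normrN => /(le_trans (ler_norm _)).
  by have [N _ /(_ N (leqnn N))] := hn; exists N.
have tail0 : 0 <= Q - series q0 L.
  by rewrite subr_ge0; exact: (series_le_total q_pos (series_q_cvg d_gt0 beta_gt0)).
pose th := expR (- (beta * eta / 2)).
have th1 : th < 1 by rewrite expR_lt1 oppr_lt0 divr_gt0// mulr_gt0.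
pose B := L%:R * - ln (1 - th).
near=> N.
have V0 : 0 < V N by near: N.
have Z0 : 0 < Z N by near: N.
have bV : 0 < beta * V N by rewrite mulr_gt0.
have rho2 : rho N <= 2.
  by near: N; move/cvgr_le : rho1; apply; rewrite ltrDl.
have rhoe : rho N <= expR (beta * eta / 2).
  near: N; move/cvgr_le : rho1; apply.
  by rewrite expR_gt1 divr_gt0// mulr_gt0.
have rho_th : rho N * expR (- (beta * eta)) <= th.
  apply: le_trans (ler_wpM2r (expR_ge0 _) rhoe) _.
  by rewrite -expRD ler_expR; lra.
have hN : forall L eta, (K <= L)%N -> 0 < eta ->
  rho N * expR (- (beta * eta)) < 1 ->
  Z N <= expR (- (beta * V N * min_energy_d K (mu + alpha + eta) s) + V N * Q) *
    ((1 - rho N * expR (- (beta * eta)))^-1 ^+ L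
     * expR (V N * (rho N * (Q - series q0 L))) * expR (- c N)).
  by near: N.
have {}hN := hN L eta KL eta0 (le_lt_trans rho_th th1).
set u := rho N * _ in hN rho_th.
have u1 : 0 < 1 - u by rewrite subr_gt0 (le_lt_trans rho_th).
have hln : ln (Z N) <= - (beta * V N * min_energy_d K (m + eta) s) + V N * Q
    + (L%:R * - ln (1 - u) + V N * (rho N * (Q - series q0 L)) - c N).
  rewrite -ler_expR lnK ?posrE//; apply: (le_trans hN).
  rewrite !expRD expRM_natl -lnV ?posrE// lnK ?posrE ?invr_gt0//.
have hB : L%:R * - ln (1 - u) <= B.
  have h1th : 0 < 1 - th by rewrite subr_gt0.
  rewrite /B ler_wpM2l// lerN2 ler_ln ?posrE//.
  by rewrite lerD2l lerN2.
have hV : beta^-1 * B <= eps / 4 * V N.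
  rewrite [leRHS]mulrC -ler_pdivrMr ?divr_gt0//.
  by near: N; move/cvgryPge : Voo; apply.
have hrho : beta^-1 * (rho N * (Q - series q0 L)) <= eps / 4.
  apply: (@le_trans _ _ (2 * (beta^-1 * (Q - series q0 L)))); last by lra.
  by rewrite mulrCA ler_wpM2r// mulr_ge0// ltW.
rewrite /pressureN.
have h1 : (beta * V N)^-1 * (ln (Z N) + c N) <= (beta * V N)^-1 *
   (- (beta * V N * min_energy_d K (m + eta) s) + V N * Q
    + (B + V N * (rho N * (Q - series q0 L)))).
  by rewrite ler_wpM2l ?invr_ge0 ?(ltW bV)//; lra.
have h2 : (beta * V N)^-1 *
   (- (beta * V N * min_energy_d K (m + eta) s) + V N * Q
    + (B + V N * (rho N * (Q - series q0 L)))) =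
   - min_energy_d K (m + eta) s + beta^-1 * Q + beta^-1 * B / V N
   + beta^-1 * (rho N * (Q - series q0 L)).
  by field; rewrite !gt_eqF.
have h3 : beta^-1 * B / V N <= eps / 4 by rewrite ler_pdivrMr.
move: h1 h2 h3 heta hrho.
move: (min_energy _ _ _ _ _ _ _ _) (beta^-1 * Q) (beta^-1 * B / V N) (beta^-1 * (rho N * _))
  (_^-1 * (ln _ + _)) => *; lra.
Unshelve. all: by end_near. Qed.

Lemma pressure_liminf eps : 0 < eps -> \forall N \near \oo,
  - min_energy_d K (mu + alpha) s - eps <= pressureN N.
Proof.
move=> e0; set m := mu + alpha.
have q_pos := fun k => q_gt0 d beta_gt0 0 k.
have e20 : 0 < eps / 2 by rewrite divr_gt0.
have [L [x [KL x0 hx]]] := min_energy_adherent q_pos (series_q_cvg d_gt0 beta_gt0)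
  b_ge0 ba beta_gt0 K m s e20.
pose n N k := Num.truncn (V N * truncate L x k).
pose y N k := (n N k)%:R / V N.
have t0 k : 0 <= truncate L x k by rewrite /truncate; case: ifP.
have tauP k : exists tau : nat -> R,
    tau @ \oo --> - (truncate L x k * (ln (truncate L x k / q d beta alpha k.+1) - 1)) /\
    \forall N \near \oo, expR (V N * tau N) <=
      (V N * r N k) ^+ n N k / (n N k)`!%:R.
  by apply: poisson_term_lower_bound => //; exact: q_gt0.
have [tau htau] := choice tauP.
have yx k : (fun N => y N k) @ \oo --> truncate L x k.
  have Vi : (fun N => (V N)^-1) @ \oo --> 0 by apply/gtr0_cvgV0.
  have h1 : (fun N => truncate L x k - (V N)^-1) @ \oo --> truncate L x k.
    by rewrite -[X in _ --> X]subr0; apply: cvgB => //; exact: cvg_cst.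
  apply: squeeze_cvgr h1 (cvg_cst _); near=> N.
  have V0 : 0 < V N by near: N.
  have Vx0 : 0 <= V N * truncate L x k by rewrite mulr_ge0// ltW.
  have /andP[h2 h3] := truncn_itv Vx0.
  apply/andP; split; last by rewrite ler_pdivrMr// mulrC.
  by rewrite ler_pdivlMr// mulrBl mulVf ?gt_eqF// mulrC lerBlDr natr1 ltW.
have DE M : (M <= L)%N -> D_trunc M (truncate L x) = D_trunc M x.
  move=> ML; apply: eq_big_nat => k /andP[_ kM].
  by rewrite /truncate (leq_trans kM).
have SE : sumsq_trunc L (truncate L x) = sumsq_trunc L x.
  by apply: eq_big_nat => k /andP[_ kL]; rewrite /truncate kL.
have hD M : (M <= L)%N -> (fun N => D_trunc M (y N)) @ \oo --> D_trunc M x.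
  by move=> ML; rewrite -(DE _ ML); exact: cvg_D_trunc yx.
have hS : (fun N => sumsq_trunc L (y N)) @ \oo --> sumsq_trunc L x.
  by rewrite -SE; exact: cvg_sumsq_trunc yx.
pose H N := - (mu + s) * D_trunc L (y N) + a / 2 * D_trunc L (y N) ^+ 2
       - b / 2 * sumsq_trunc L (y N) + s * D_trunc K (y N).
have hH : H @ \oo --> - (mu + s) * D_trunc L x + a / 2 * D_trunc L x ^+ 2
       - b / 2 * sumsq_trunc L x + s * D_trunc K x.
  apply: cvgD; last by apply: cvgM; [exact: cvg_cst|exact: hD].
  apply: cvgB; last by apply: cvgM => //; exact: cvg_cst.
  apply: cvgD; first by apply: cvgM; [exact: cvg_cst|exact: hD].
  by apply: cvgM; [exact: cvg_cst|rewrite expr2; apply: cvgM; exact: hD].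
pose T M N := \sum_(0 <= k < M) tau k N.
have hT M : T M @ \oo --> \sum_(0 <= k < M)
    - (truncate L x k * (ln (truncate L x k / q d beta alpha k.+1) - 1)).
  elim: M => [|M IH].
    have -> : T 0%N = fun=> 0 by apply/funext => N; rewrite /T big_geq.
    by rewrite big_geq//; exact: cvg_cst.
  rewrite (_ : T M.+1 = T M \+ tau M); last first.
    by apply/funext => N; rewrite /T big_nat_recr.
  by rewrite big_nat_recr//=; apply: cvgD => //; case: (htau M).
have TE : \sum_(0 <= k < L)
    - (truncate L x k * (ln (truncate L x k / q d beta alpha k.+1) - 1))
    = - ent_trunc q0 L x + beta * alpha * D_trunc L x.
  rewrite /ent_trunc /D_trunc mulr_sumr -sumrN -big_split/=.
  apply: eq_big_nat => k /andP[_ kL]; rewrite /truncate kL.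
  have [->|/eqP xk0] := eqVneq (x k) 0; first by rewrite !mul0r !mulr0; ring.
  have xk : 0 < x k by rewrite lt0r x0 andbT; apply/eqP.
  have lnq v : 0 < v -> ln (x k / v) = ln (x k) - ln v by move=> v0; rewrite ln_div ?posrE.
  rewrite !lnq ?q_gt0//.
  have -> : ln (q d beta alpha k.+1) = beta * alpha * k.+1%:R + ln (q d beta 0 k.+1).
    by rewrite q_tilt lnM ?posrE ?expR_gt0 ?q_gt0// expRK.
  by move: (ln (x k)) (ln (q _ _ _ _)) => u v; ring.
have hlim : (fun N => - H N + beta^-1 * T L N - beta^-1 * Q) @ \oo -->
    - free_energy a b beta q0 Q K L x 0 m s.
  have -> : - free_energy a b beta q0 Q K L x 0 m s =
     - (- (mu + s) * D_trunc L x + a / 2 * D_trunc L x ^+ 2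
       - b / 2 * sumsq_trunc L x + s * D_trunc K x)
     + beta^-1 * (- ent_trunc q0 L x + beta * alpha * D_trunc L x) - beta^-1 * Q.
    rewrite /free_energy addr0 expr0n/= addr0 /m.
    move: (D_trunc L x) (D_trunc K x) (sumsq_trunc L x) (ent_trunc _ _ _) => u v w z.
    by field; rewrite gt_eqF.
  apply: cvgB; last exact: cvg_cst.
  apply: cvgD; first exact: cvgN.
  by apply: cvgM; [exact: cvg_cst|rewrite -TE].
near=> N.
have V0 : 0 < V N by near: N.
have Z0 : 0 < Z N by near: N.
have bV : 0 < beta * V N by rewrite mulr_gt0.
have hN : forall L (n : nat -> nat), (K <= L)%N ->
  (forall k, (L <= k)%N -> n k = 0%N) ->
  let y := fun k => (n k)%:R / V N in
  expR (- (beta * V N * (- (mu + s) * D_trunc L y + a / 2 * D_trunc L y ^+ 2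
       - b / 2 * sumsq_trunc L y + s * D_trunc K y))) *
    (expR (- c N) * \prod_(0 <= k < L) ((V N * r N k) ^+ n k / (n k)`!%:R)) <= Z N.
  by near: N.
have htN : forall k, (k < L)%N -> expR (V N * tau k N) <= (V N * r N k) ^+ n N k / (n N k)`!%:R.
  near: N; have h M : \forall N \near \oo, forall k, (k < M)%N ->
      expR (V N * tau k N) <= (V N * r N k) ^+ n N k / (n N k)`!%:R.
    elim: M => [|M IH]; first exact: nearW.
    have [_ hM] := htau M; near=> N => k.
    rewrite ltnS leq_eqVlt => /orP[/eqP ->|kM]; first by near: N.
    have IHN : forall k, (k < M)%N ->
      expR (V N * tau k N) <= (V N * r N k) ^+ n N k / (n N k)`!%:R by near: N.
    exact: IHN.
  exact: h.
have n0 k : (L <= k)%N -> n N k = 0%N.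
  by move=> Lk; rewrite /n /truncate ltnNge Lk/= mulr0 truncn0.
have hprod : expR (V N * T L N) <= \prod_(0 <= k < L) ((V N * r N k) ^+ n N k / (n N k)`!%:R).
  rewrite /T mulr_sumr expR_sum big_nat [leRHS]big_nat.
  by apply: ler_prod => k /andP[_ kL]; rewrite expR_ge0/= htN.
have hlnZ : - (beta * V N * H N) - c N + V N * T L N <= ln (Z N).
  rewrite -ler_expR lnK ?posrE//; apply: le_trans (hN L (n N) KL n0).
  rewrite -addrA !expRD ler_wpM2l ?expR_ge0// ler_wpM2l ?expR_ge0//.
have h1 : (beta * V N)^-1 * (- (beta * V N * H N) + V N * T L N) <=
    (beta * V N)^-1 * (ln (Z N) + c N).
  by rewrite ler_wpM2l ?invr_ge0 ?(ltW bV)//; lra.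
have h2 : (beta * V N)^-1 * (- (beta * V N * H N) + V N * T L N) =
    - H N + beta^-1 * T L N by field; rewrite !gt_eqF.
have h3 : - free_energy a b beta q0 Q K L x 0 m s - eps / 2 <=
    - H N + beta^-1 * T L N - beta^-1 * Q.
  near: N; move/cvgr_ge : hlim; apply; lra.
rewrite /pressureN; move: h1 h2 h3 (hx).
move: (min_energy _ _ _ _ _ _ _ _) (free_energy _ _ _ _ _ _ _ _ _ _ _)
 (_^-1 * (ln _ + _)) (beta^-1 * Q) (_^-1 * T L N) => *; lra.
Unshelve. all: by end_near. Qed.

Lemma pressure_cvg : pressureN @ \oo --> - min_energy_d K (mu + alpha) s.
Proof.
apply/cvgrPdist_le => eps e0; near=> N.
have h1 : pressureN N <= - min_energy_d K (mu + alpha) s + eps.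
  by near: N; exact: pressure_limsup.
have h2 : - min_energy_d K (mu + alpha) s - eps <= pressureN N.
  by near: N; exact: pressure_liminf.
by rewrite ler_norml; apply/andP; split; lra.
Unshelve. all: by end_near. Qed.

End pressure_limit.

(** * Mean density of long loops *)

Section integral_complements.
Context {R : realType} (dT : measure_display) (T : measurableType dT).
Local Open Scope ereal_scope.
Import HBNNSimple.

Lemma ge0_le_integral_off_null (mu : {measure set T -> \bar R}) (E : set T)
    (f g : T -> \bar R) : measurable E -> mu (~` E) = 0 ->
  (forall x, 0 <= f x) -> (forall x, 0 <= g x) ->
  (forall x, E x -> f x <= g x) -> \int[mu]_x f x <= \int[mu]_x g x.
Proof.
move=> mE E0 f0 g0 fg; rewrite [leLHS]ge0_integralTE// [leRHS]ge0_integralTE//.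
apply: ge_ereal_sup => _ [h /= hf <-].
apply: ereal_sup_ubound; exists (proj_nnsfun h mE) => /=.
  move=> x; rewrite mindicE; have [xE|xE] := boolP (x \in E).
    by rewrite mulr1; apply: le_trans (hf x) (fg _ _); rewrite -inE.
  by rewrite mulr0.
rewrite -!integralT_nnsfun; apply: ge0_ae_eq_integral => //.
- by apply/measurable_EFinP; exact: measurable_funP.
- by apply/measurable_EFinP; exact: measurable_funP.
- by move=> x _; rewrite lee_fin.
- by move=> x _; rewrite lee_fin.
exists (~` E); split => //; first exact: measurableC.
move=> x /= nx Ex; apply: nx => _ /=.
by rewrite mindicE mem_set// mulr1.
Qed.

Lemma eq_integral_off_null (mu : {measure set T -> \bar R}) (E : set T)
    (f g : T -> \bar R) : measurable E -> mu (~` E) = 0 ->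
  (forall x, E x -> f x = g x) -> \int[mu]_x f x = \int[mu]_x g x.
Proof.
move=> mE E0 fg.
have le (h k : T -> \bar R) : (forall x, 0 <= h x) -> (forall x, 0 <= k x) ->
    (forall x, E x -> h x = k x) -> \int[mu]_x h x = \int[mu]_x k x.
  move=> h0 k0 hk; apply/eqP; rewrite eq_le.
  by apply/andP; split; apply: (ge0_le_integral_off_null mE E0) => // x /hk ->.
rewrite integralE [RHS]integralE; congr (_ - _); apply: le => // x Ex.
  by rewrite !funeposE fg.
by rewrite !funenegE fg.
Qed.

Lemma le_integralW (mu : {measure set T -> \bar R}) (A : set T)
    (f g : T -> \bar R) :
  (forall x, A x -> f x <= g x) -> \int[mu]_(x in A) f x <= \int[mu]_(x in A) g x.
Proof.
have le (h k : T -> \bar R) : (forall x, 0 <= h x) -> (forall x, 0 <= k x) ->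
    (forall x, A x -> h x <= k x) -> \int[mu]_(x in A) h x <= \int[mu]_(x in A) k x.
  move=> h0 k0 hk; rewrite integral_mkcond [leRHS]integral_mkcond.
  apply: (@ge0_le_integral_off_null mu setT) => //; first by rewrite setCT measure0.
  - exact: (erestrict_ge0 (fun y _ => h0 y)).
  - exact: (erestrict_ge0 (fun y _ => k0 y)).
  - by move=> x _; exact: (lee_restrict hk).
move=> fg; rewrite integralE [leRHS]integralE; apply: leeB; apply: le => //.
  by move=> x Ax; rewrite !funeposE ge_max !le_max fg// lexx orbT.
by move=> x Ax; rewrite !funenegE ge_max !le_max leeN2 fg// lexx orbT.
Qed.

Section density.
Variables (mu m : {measure set T -> \bar R}) (g : T -> \bar R) (c : R).
Hypotheses (mg : measurable_fun setT g) (g0 : forall x, 0 <= g x) (c0 : (0 <= c)%R).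
Hypothesis mE : forall A, measurable A -> m A = c%:E * \int[mu]_(x in A) g x.

Lemma ge0_integral_density (f : T -> \bar R) : measurable_fun setT f ->
  (forall x, 0 <= f x) -> \int[m]_x f x = c%:E * \int[mu]_x (f x * g x).
Proof.
move=> mf f0; pose f_ := nnsfun_approx measurableT mf.
have simple (h : {nnsfun T >-> R}) :
    \int[m]_x (h x)%:E = c%:E * \int[mu]_x ((h x)%:E * g x).
  rewrite integralT_nnsfun sintegralE.
  have -> : (fun x => (h x)%:E * g x) =
      (fun x => \sum_(y \in range h) (y%:E * (\1_(h @^-1` [set y]) x)%:E * g x)).
    apply/funext => x; rewrite -ge0_mule_fsuml; last first.
      by move=> y; rewrite nnfun_muleindic_ge0.
    congr (_ * _); rewrite {1}(fimfunE h x) fsumEFin//.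
  rewrite ge0_integral_fsum//; last 2 first.
  - move=> y; apply: emeasurable_funM => //; apply: emeasurable_funM => //.
    by apply/measurable_EFinP; apply: measurable_indic.
  - by move=> y x _; rewrite mule_ge0// nnfun_muleindic_ge0.
  rewrite ge0_mule_fsumr; last first.
    by move=> y; apply: integral_ge0 => x _; rewrite mule_ge0// nnfun_muleindic_ge0.
  apply: eq_fsbigr => y /[!inE] -[x _ <-].
  rewrite mE//.
  rewrite muleCA; congr (_ * _).
  have -> : \int[mu]_z ((h x)%:E * (\1_(h @^-1` [set h x]) z)%:E * g z) =
      \int[mu]_z ((h x)%:E * ((\1_(h @^-1` [set h x]) z)%:E * g z)).
    by apply: eq_integral => z _; rewrite muleA.
  rewrite ge0_integralZl_EFin//.
  - congr (_ * _); rewrite integral_mkcond; apply: eq_integral => z _.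
    by rewrite patchE indicE; case: ifPn => _; rewrite ?mul1e ?mul0e.
  - by move=> z _; rewrite mule_ge0.
  - by apply: emeasurable_funM => //; apply/measurable_EFinP; apply: measurable_indic.
have cvf x : EFin \o f_^~ x @ \oo --> f x.
  by apply: cvg_nnsfun_approx => // y _; exact: f0.
have nd x : {homo f_^~ x : i j / (i <= j)%N >-> (i <= j)%R}.
  by move=> i j ij; exact/lefP/nd_nnsfun_approx.
have h1 : \int[m]_x (f_ n x)%:E @[n --> \oo] --> \int[m]_x f x.
  rewrite (_ : \int[m]_x f x = \int[m]_x limn (fun n => (f_ n x)%:E)); last first.
    by apply: eq_integral => x _; apply/esym/cvg_lim => //; exact: cvf.
  apply: cvg_monotone_convergence => //.
  - by move=> n; exact/measurable_EFinP/measurable_funP.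
  - by move=> n x _; rewrite lee_fin.
  - by move=> x _ i j ij; rewrite lee_fin nd.
have h2 : \int[mu]_x ((f_ n x)%:E * g x) @[n --> \oo] --> \int[mu]_x (f x * g x).
  have cvfg x : (fun n => (f_ n x)%:E * g x) @ \oo --> f x * g x.
    have [->|gx0] := eqVneq (g x) 0.
      by rewrite mule0; under eq_fun do rewrite mule0; exact: cvg_cst.
    have gx : 0 < g x by rewrite lt_neqAle eq_sym gx0 g0.
    have := cvf x; set l := f x => cvl.
    have ndg : nondecreasing_seq (fun n => (f_ n x)%:E * g x).
      by move=> i j ij; apply: lee_wpmul2r => //; rewrite lee_fin nd.
    have [gfin|] := boolP (g x \is a fin_num).
      by rewrite -(fineK gfin); apply: cvgeZr.
    rewrite ge0_fin_numE// -leNgt leye_eq => /eqP ->.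
    have [fx0|fx0] := eqVneq (f x) 0.
      rewrite /l fx0 mul0e.
      have z n : f_ n x = 0%R.
        apply/eqP; rewrite eq_le fun_ge0 andbT -lee_fin.
        have : (f_ n x)%:E <= l.
          rewrite -(cvg_lim _ cvl)//; apply: lime_ge; first exact: cvgP cvl.
          by near=> k; rewrite lee_fin; apply: nd; near: k; exact: nbhs_infty_ge.
        by rewrite /l fx0.
      by under eq_fun do rewrite z mul0e; exact: cvg_cst.
    have fx : 0 < f x by rewrite lt_neqAle eq_sym fx0 f0.
    rewrite gt0_muley//; apply: cvg_near_cst; near=> n.
    rewrite gt0_muley//; near: n.
    exact: (cvl _ (open_ereal_gt' fx)).
  rewrite (_ : \int[mu]_x (f x * g x) = \int[mu]_x limn (fun n => (f_ n x)%:E * g x)); last first.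
    by apply: eq_integral => x _; apply/esym/cvg_lim => //; exact: cvfg.
  apply: cvg_monotone_convergence => //.
  - by move=> n; apply: emeasurable_funM => //; exact/measurable_EFinP/measurable_funP.
  - by move=> n x _; rewrite mule_ge0// lee_fin.
  - by move=> x _ i j ij; rewrite lee_wpmul2r// lee_fin nd.
rewrite -(cvg_lim _ h1)//; apply/cvg_lim => //.
under eq_fun do rewrite simple.
exact: cvgeZl.
Unshelve. all: by end_near. Qed.

End density.
End integral_complements.

Section density_measure.
Context {R : realType} (dT : measure_display) (T : measurableType dT).
Variables (mu : {measure set T -> \bar R}) (g : T -> \bar R).
Hypotheses (mg : measurable_fun setT g) (g0 : forall x, (0 <= g x)%E).

Definition density_measure (mg : measurable_fun setT g) (g0 : forall x, (0 <= g x)%E)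
  (A : set T) : \bar R := (\int[mu]_(x in A) g x)%E.

Let density0 : density_measure mg g0 set0 = 0%E.
Proof. by rewrite /density_measure integral_set0. Qed.

Let density_ge0 A : (0 <= density_measure mg g0 A)%E.
Proof. exact: integral_ge0. Qed.

Let density_sigma_additive : semi_sigma_additive (density_measure mg g0).
Proof. exact: semi_sigma_additive_nng_induced. Qed.

HB.instance Definition _ := isMeasure.Build _ _ _ (density_measure mg g0)
  density0 density_ge0 density_sigma_additive.

End density_measure.

Section sequence_space.
Context {R : realType}.
Local Notation S := (seqspace R).

Lemma measurable_coord k : measurable_fun [set: S] (fun x : S => x k).
Proof.
by move=> _ B mB; rewrite setTI; apply: sub_sigma_algebra; exists k, B.
Qed.

Definition nonneg_seqs : set S := [set x | forall k, 0 <= x k].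

Lemma measurable_nonneg_seqs : measurable nonneg_seqs.
Proof.
rewrite (_ : nonneg_seqs = \bigcap_k ((fun x : S => x k) @^-1` `[0, +oo[%classic)).
  apply: bigcap_measurableType => k _; rewrite -[_ @^-1` _]setTI.
  by apply: measurable_coord.
by apply/seteqP; split => x /= h k; [rewrite /= in_itv/= andbT|have := h k Logic.I;
  rewrite /= in_itv/= andbT].
Qed.

Definition abs_tail K (x : S) : \bar R :=
  (\sum_(0 <= k <oo) ((k + K).+1%:R * `|x (k + K)%N|)%:E)%E.

Lemma measurable_abs_tail K : measurable_fun [set: S] (abs_tail K).
Proof.
apply: ge0_emeasurable_sum => [k w _ _|k _]; first by rewrite lee_fin mulr_ge0.
apply/measurable_EFinP; apply: measurable_funM => //.
by apply: measurableT_comp => //; exact: measurable_coord.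
Qed.

Lemma measurable_sumsq : measurable_fun [set: S] (fun x : S => sumsq x).
Proof.
apply: ge0_emeasurable_sum => [k w _ _|k _].
  by rewrite lee_fin mulr_ge0// sqr_ge0.
apply/measurable_EFinP; apply: measurable_funM => //.
by apply: measurable_funX; exact: measurable_coord.
Qed.

Lemma abs_tail_ge0 K x : (0 <= abs_tail K x)%E.
Proof. by apply: nneseries_ge0 => k _ _; rewrite lee_fin mulr_ge0. Qed.

Lemma D_split K x : nonneg_seqs x -> D x = ((D_trunc K x)%:E + abs_tail K x)%E.
Proof.
move=> x0; rewrite /D (@nneseries_split _ _ 0%N K); last first.
  by move=> k _; rewrite lee_fin mulr_ge0.
rewrite add0n sumEFin -/(D_trunc K x); congr (_ + _)%E.
rewrite -(@nneseries_addn _ (fun k => (k.+1%:R * x k)%:E)); last first.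
  by move=> k; rewrite lee_fin mulr_ge0.
by apply: eq_eseriesr => k _; rewrite ger0_norm.
Qed.

Lemma D_sub_trunc K x : nonneg_seqs x -> (D x - (D_trunc K x)%:E)%E = abs_tail K x.
Proof. by move=> x0; rewrite (D_split K x0) addeAC subee// add0e. Qed.

Lemma ell1_plusP x : (ell1_plus x /\ (D x < +oo)%E) <->
  (nonneg_seqs x /\ (abs_tail 0 x < +oo)%E).
Proof.
split=> [[[_ x0] Dx]|[x0 tx]].
  by split => //; rewrite -D_sub_trunc// /D_trunc big_geq// sube0.
have Dx : D x = abs_tail 0 x by rewrite -D_sub_trunc// /D_trunc big_geq// sube0.
split; last by rewrite Dx.
split => //; apply: le_lt_trans tx; rewrite -Dx; apply: lee_nneseries => k _ //.
by rewrite lee_fin ger0_norm// -[leLHS]mul1r ler_wpM2r// ler1n.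
Qed.

Variables (d N : nat) (a b beta mu : R).
Hypotheses (beta_gt0 : 0 < beta) (N_gt0 : (0 < N)%N).

Lemma vol_gt0 : 0 < vol R d N.
Proof. by rewrite exprn_gt0// mulr_gt0// ltr0n. Qed.

Lemma boltzmannE (x : S) : boltzmann d N a b beta mu x =
  if (x \in nonneg_seqs) && (abs_tail 0 x < +oo)%E
  then (expR (- (beta * vol R d N * (- mu * fine (abs_tail 0 x)
     + a / 2 * fine (abs_tail 0 x) ^+ 2 - b / 2 * fine (sumsq x)))))%:E else 0%E.
Proof.
have bV : 0 < beta * vol R d N by rewrite mulr_gt0// vol_gt0.
rewrite /boltzmann /H_HYL.
have [/andP[/set_mem x0 tx]|h] := boolP ((x \in nonneg_seqs) && (abs_tail 0 x < +oo)%E).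
  have [ex Dx] := (ell1_plusP x).2 (conj x0 tx).
  rewrite asboolT//= -D_sub_trunc// /D_trunc big_geq// sube0.
  by [].
rewrite asboolF; last first.
  move=> /ell1_plusP[x0 tx]; move: h; by rewrite mem_set// tx.
by rewrite gt0_muley// lte_fin.
Qed.

Lemma boltzmann_ge0 (x : S) : (0 <= boltzmann d N a b beta mu x)%E.
Proof. exact: expeR_ge0. Qed.

Lemma measurable_boltzmann : measurable_fun [set: S] (boltzmann d N a b beta mu).
Proof.
rewrite (funext boltzmannE).
have mf (f : S -> \bar R) : measurable_fun setT f -> measurable_fun setT (fun x => fine (f x)).
  by move=> mf; apply: measurableT_comp mf => //; exact: fine_measurable.
have mD := mf _ (measurable_abs_tail 0).
have mS := mf _ measurable_sumsq.
apply: measurable_fun_ifT => //.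
  apply: measurable_and.
    apply: (measurable_fun_bool true); rewrite setTI preimage_mem_true.
    exact: measurable_nonneg_seqs.
  by apply: measurable_fun_lte => //; exact: measurable_abs_tail.
apply/measurable_EFinP; apply: measurableT_comp => //; apply: measurableT_comp => //.
apply: measurable_funM => //; apply: measurable_funB; last exact: measurable_funM.
by apply: measurable_funD; apply: measurable_funM => //; exact: measurable_funX.
Qed.

End sequence_space.

Section gibbs_mean.
Context {R : realType} (dO : measure_display) (Omega : measurableType dO).
Variables (P : probability Omega R) (X : nat -> {RV P >-> nat}).
Variables (d N : nat) (a b beta mu : R).
Hypotheses (beta_gt0 : 0 < beta) (N_gt0 : (0 < N)%N).

Local Notation V := (vol R d N).
Local Notation weight := (gibbs_weight X a b beta V).

Let V0 : 0 < V. Proof. exact: vol_gt0. Qed.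

Let cfg (w : Omega) : seqspace R := config X V w.

Let measurable_cfg : measurable_fun setT cfg.
Proof.
apply: (@measurability _ _ _ _ setT cfg coord_sets erefl) => _ [A [k [B [mB ->]]] <-].
rewrite setTI; have := measurable_config X V k measurableT mB.
by rewrite setTI.
Qed.

Let cfgM : {mfun Omega >-> seqspace R} :=
  HB.pack cfg (isMeasurableFun.Build _ _ _ _ _ measurable_cfg).

Lemma config_nonneg w : nonneg_seqs (config X V w).
Proof. by move=> k; exact: config_ge0. Qed.

Definition long_density K (w : Omega) : R := fine (abs_tail K (config X V w)).

Lemma long_density_ge0 K w : 0 <= long_density K w.
Proof. by rewrite fine_ge0// abs_tail_ge0. Qed.

Lemma fine_D_config K w : (D (config X V w) < +oo)%E ->
  fine (D (config X V w)) = D_trunc K (config X V w) + long_density K w.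
Proof.
move=> Dw; have h := D_split K (config_nonneg w).
have tf : abs_tail K (config X V w) \is a fin_num.
  rewrite ge0_fin_numE ?abs_tail_ge0//; apply: le_lt_trans Dw.
  rewrite h leeDr// lee_fin; apply: D_trunc_ge0; exact: config_ge0.
by rewrite h fineD.
Qed.

Lemma gibbs_weight0 K K' w : weight K mu 0 w = weight K' mu 0 w.
Proof. by rewrite /gibbs_weight /tilted_hamiltonian !mul0r. Qed.

Lemma gibbs_weight_tilt K s w :
  weight K mu s w = weight K mu 0 w * expR (s * (beta * V * long_density K w)).
Proof.
rewrite /gibbs_weight; case: asboolP => [Dw|_]; last by rewrite mul0r.
rewrite -expRD; congr expR; rewrite /tilted_hamiltonian (fine_D_config K Dw); ring.
Qed.

Lemma boltzmann_config K w :
  boltzmann d N a b beta mu (config X V w) = (weight K mu 0 w)%:E.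
Proof.
have bV : 0 < beta * V by rewrite mulr_gt0.
have ex : (D (config X V w) < +oo)%E ->
    ell1_plus (config X V w) /\ (D (config X V w) < +oo)%E.
  move=> Dw; apply/ell1_plusP; split; first exact: config_nonneg.
  rewrite -D_sub_trunc; last exact: config_nonneg.
  by rewrite /D_trunc big_geq// sube0.
rewrite /boltzmann /H_HYL /gibbs_weight.
have [Dw|Dw] := pselect (D (config X V w) < +oo)%E.
  by rewrite (asboolT (ex Dw)) (asboolT Dw)/= /tilted_hamiltonian mul0r !addr0.
by rewrite (asboolF (fun h : _ /\ _ => Dw (proj2 h))) (asboolF Dw) gt0_muley ?lte_fin.
Qed.

Let bm := measurable_boltzmann d a b mu beta_gt0 N_gt0.
Let b0 := @boltzmann_ge0 R d N a b beta mu.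

Let Z0 := (\int[P]_w (weight 0 mu 0 w)%:E)%E.

Let int_boltzmann : (\int[nu_ref d N X]_x boltzmann d N a b beta mu x)%E = Z0.
Proof.
rewrite (_ : nu_ref d N X = pushforward P cfg)// ge0_integral_pushforward//.
by apply: eq_integral => w _; rewrite /= (boltzmann_config 0).
Qed.

Hypothesis weight_fin : forall K s, (\int[P]_w (weight K mu s w)%:E < +oo)%E.
Hypothesis weight_pos : forall K s, (0 < \int[P]_w (weight K mu s w)%:E)%E.

Let c0 : 0 <= (fine Z0)^-1.
Proof. by rewrite invr_ge0 fine_ge0// integral_ge0// => w _; rewrite lee_fin gibbs_weight_ge0. Qed.

Lemma mean_longE K : mean_long d N K a b beta mu (nu_ref d N X) =
  ((fine Z0)^-1%:E * \int[P]_w (weight K mu 0 w * long_density K w)%:E)%E.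
Proof.
pose nuM : {measure set (seqspace R) -> \bar R} := distribution P cfgM.
pose m : {measure set (seqspace R) -> \bar R} := mscale (NngNum c0)
  (density_measure nuM bm b0).
have mE : nu_HYL d N a b beta mu (nu_ref d N X) = m.
  by apply/funext => A; rewrite /nu_HYL int_boltzmann.
rewrite /mean_long mE (@eq_integral_off_null _ _ _ m (@nonneg_seqs R) _ (abs_tail K)).
- rewrite (ge0_integral_density (mu := nuM) (g := boltzmann d N a b beta mu)
    (c := (fine Z0)^-1) bm b0)//; last 2 first.
  + exact: measurable_abs_tail.
  + exact: abs_tail_ge0.
  congr (_ * _)%E; rewrite ge0_integral_pushforward//=.
  + apply: eq_integral => w _ /=; rewrite (boltzmann_config K).
    rewrite /gibbs_weight; case: asboolP => [Dw|_]; last by rewrite mul0r mule0.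
    rewrite EFinM muleC; congr (_ * _)%E; rewrite /long_density fineK//.
    rewrite ge0_fin_numE ?abs_tail_ge0//; apply: le_lt_trans Dw.
    rewrite (D_split K (config_nonneg w)) leeDr// lee_fin; apply: D_trunc_ge0.
    exact: config_ge0.
  + apply: emeasurable_funM => //; exact: measurable_abs_tail.
  + by move=> x _; rewrite mule_ge0// abs_tail_ge0.
- exact: measurable_nonneg_seqs.
- change ((fine Z0)^-1%:E * \int[nuM]_(x in ~` (@nonneg_seqs R)) boltzmann d N a b beta mu x = 0)%E.
  rewrite integral0_eq ?mule0// => x nx; rewrite boltzmannE// (_ : x \in nonneg_seqs = false)//.
  by apply/negbTE; rewrite notin_setE.
- by move=> x; exact: D_sub_trunc.
Qed.

Let integrable_weight K s : P.-integrable setT (EFin \o weight K mu s).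
Proof.
apply/integrableP; split.
  by apply/measurable_EFinP; exact: measurable_gibbs_weight.
under eq_integral do rewrite /= ger0_norm ?gibbs_weight_ge0//.
exact: weight_fin.
Qed.

Let measurable_weight_density K :
  measurable_fun setT (fun w => weight K mu 0 w * long_density K w).
Proof.
apply: measurable_funM; first exact: measurable_gibbs_weight.
apply: measurable_fine_comp.
exact: (measurableT_comp (@measurable_abs_tail R K) measurable_cfg).
Qed.

Let integrable_weight_density K :
  P.-integrable setT (EFin \o (fun w => weight K mu 0 w * long_density K w)).
Proof.
have bV : 0 < beta * V by rewrite mulr_gt0.
apply: (@le_integrable _ _ _ _ _ _ _
  (fun w => ((beta * V)^-1%:E * (weight K mu 1 w)%:E)%E)) => //.
- by apply/measurable_EFinP; exact: measurable_weight_density.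
- move=> w _; rewrite /= lee_fin.
  rewrite !ger0_norm ?mulr_ge0 ?gibbs_weight_ge0 ?long_density_ge0 ?invr_ge0 ?(ltW bV)//.
  rewrite (gibbs_weight_tilt K 1) mul1r mulrCA ler_wpM2l ?gibbs_weight_ge0//.
  rewrite ler_pdivlMl//; apply: le_trans (expR_ge1Dx _).
  by rewrite lerDr.
- by apply: integrableZl => //; exact: integrable_weight.
Qed.

Definition mean_density K : R :=
  (\int[P]_w weight K mu 0 w)^-1 * \int[P]_w (weight K mu 0 w * long_density K w).

Lemma mean_long_fin K :
  mean_long d N K a b beta mu (nu_ref d N X) = (mean_density K)%:E.
Proof.
rewrite mean_longE /mean_density EFinM; congr (_ * _)%E.
  by congr (_^-1%:E); rewrite /Z0; congr fine; apply: eq_integral => w _; rewrite (gibbs_weight0 K 0).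
rewrite /Rintegral fineK//; apply: integrable_fin_num => //.
exact: integrable_weight_density.
Qed.

Lemma mean_density_ge0 K : 0 <= mean_density K.
Proof.
rewrite mulr_ge0 ?invr_ge0 ?Rintegral_ge0// => w _; first exact: gibbs_weight_ge0.
by rewrite mulr_ge0 ?gibbs_weight_ge0 ?long_density_ge0.
Qed.

Lemma mean_density_nonincreasing K : mean_density K.+1 <= mean_density K.
Proof.
rewrite /mean_density.
have -> : \int[P]_w weight K.+1 mu 0 w = \int[P]_w weight K mu 0 w.
  by apply: eq_Rintegral => w _; exact: gibbs_weight0.
rewrite ler_wpM2l ?invr_ge0 ?Rintegral_ge0//.
  by move=> w _; exact: gibbs_weight_ge0.
apply: le_Rintegral => //; try exact: integrable_weight_density.
move=> w _; rewrite (gibbs_weight0 K.+1 K) /gibbs_weight.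
case: asboolP => [Dw|_]; last by rewrite !mul0r.
rewrite ler_wpM2l ?expR_ge0//.
have := fine_D_config K Dw; have := fine_D_config K.+1 Dw; rewrite /D_trunc big_nat_recr//= => -> /eqP.
rewrite -addrA (inj_eq (addrI _)) => /eqP <-.
by rewrite lerDr mulr_ge0// config_ge0.
Qed.

Lemma mean_density_jensen K s :
  (\int[P]_w weight K mu 0 w) * expR (s * (beta * V * mean_density K))
  <= \int[P]_w weight K mu s w.
Proof.
set z := \int[P]_w weight K mu 0 w; set E := mean_density K.
have z0 : 0 < z.
  by rewrite fine_gt0// weight_pos weight_fin.
set t := s * (beta * V); set c := t * E.
have -> : s * (beta * V * E) = c by rewrite /c /t mulrA.
have zE : z * E = \int[P]_w (weight K mu 0 w * long_density K w).
  by rewrite /E /mean_density -/z mulrA mulfV ?gt_eqF// mul1r.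
have -> : z * expR c = \int[P]_w (expR c * (1 - c) * weight K mu 0 w
    + expR c * t * (weight K mu 0 w * long_density K w)).
  have i1 := integrable_weight K 0; have i2 := integrable_weight_density K.
  rewrite RintegralD//; last 2 first.
  - by have := integrableZl measurableT (expR c * (1 - c)) i1.
  - by have := integrableZl measurableT (expR c * t) i2.
  rewrite !RintegralZl// -zE -/z /c; ring.
apply: le_Rintegral => //; last first.
- move=> w _; rewrite (gibbs_weight_tilt K s).
  have -> : expR c * (1 - c) * weight K mu 0 w +
      expR c * t * (weight K mu 0 w * long_density K w) =
      weight K mu 0 w * (expR c * (1 + (t * long_density K w - c))) by ring.
  rewrite ler_wpM2l ?gibbs_weight_ge0//.
  apply: le_trans (ler_wpM2l (expR_ge0 _) (expR_ge1Dx _)) _.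
  by rewrite -expRD ler_expR /t addrC subrK -!mulrA.
- have i1 := integrable_weight K 0; have i2 := integrable_weight_density K.
  exact: (integrableD measurableT (integrableZl measurableT (expR c * (1 - c)) i1)
   (integrableZl measurableT (expR c * t) i2)).
Qed.

End gibbs_mean.

Section thermodynamic_limit.
Context {R : realType}.
Variables (d : nat) (a b beta mu alpha : R).
Variables (dO : nat -> measure_display) (Omega : forall N, measurableType (dO N)).
Variables (P : forall N, probability (Omega N) R) (X : forall N, nat -> {RV (P N) >-> nat}).
Variables (r : nat -> nat -> R) (rho : nat -> R).
Hypotheses (d_gt0 : (0 < d)%N) (b_ge0 : 0 <= b) (ba : b < a) (beta_gt0 : 0 < beta).
Hypothesis XP : forall N, (0 < N)%N ->
  independent_poisson (X N) (fun k => vol R d N * r N k).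
Hypothesis r_ge0 : forall N k, (0 < N)%N -> 0 <= r N k.
Hypothesis rho_cvg : rho @ \oo --> (1 : R).
Hypothesis r_le : \forall N \near \oo, forall k, r N k <= rho N * q d beta alpha k.+1.
Hypothesis r_cvg : forall k, (fun N => r N k) @ \oo --> q d beta alpha k.+1.
Hypothesis alpha_le0 : alpha <= 0.

Local Notation q0 := (fun k => q d beta 0 k.+1).
Local Notation Q := (q_total d beta).
Local Notation min_energy_d := (min_energy a b beta q0 Q).
Local Notation V := (fun N => vol R d N).
Local Notation Z := (fun N K s =>
  \int[P N]_w gibbs_weight (X N) a b beta (vol R d N) K mu s w).

Lemma vol_pinfty : vol R d @ \oo --> +oo.
Proof.
apply/cvgryPge => A; near=> N.
have N1 : 1 <= N%:R :> R by rewrite ler1n; near: N; exact: nbhs_infty_gt.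
have AN : A <= N%:R by near: N; exact: nbhs_infty_ger.
apply: (le_trans AN); rewrite /vol; case: d d_gt0 => // d' _.
rewrite exprS; apply: (@le_trans _ _ (2 * N%:R * 1)); first by lra.
by rewrite ler_wpM2l ?mulr_ge0// exprn_ege1//; lra.
Unshelve. all: by end_near. Qed.

Lemma q_alpha_le k : q d beta alpha k.+1 <= q0 k.
Proof.
rewrite q_tilt -[leRHS]mul1r ler_wpM2r ?(ltW (q_gt0 d beta_gt0 0 k))//.
by rewrite expR_le1 mulr_le0_ge0// mulr_ge0_le0// ltW.
Qed.

Let c N := limn (series (fun k => vol R d N * r N k)).

Let lam_cvg N : (0 < N)%N -> 0 < rho N ->
  (forall k, r N k <= rho N * q d beta alpha k.+1) ->
  series (fun k => vol R d N * r N k) @ \oo --> c N.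
Proof.
move=> N0 rho0 hr; have V0 := vol_gt0 (R := R) d N0.
suff : cvgn (series (fun k => vol R d N * r N k)) by [].
apply: nondecreasing_is_cvgn.
  apply/nondecreasing_seqP => n; rewrite -subr_ge0 seriesSB.
  by rewrite mulr_ge0 ?(ltW V0)// r_ge0.
exists (vol R d N * (rho N * Q)) => _ [n _ <-].
rewrite /series/= -mulr_sumr ler_wpM2l ?(ltW V0)//.
apply: (@le_trans _ _ (rho N * series q0 n)).
  rewrite /series/= mulr_sumr; apply: ler_sum => k _; apply: (le_trans (hr k)).
  by rewrite ler_wpM2l ?(ltW rho0)// q_alpha_le.
rewrite ler_wpM2l ?(ltW rho0)//; apply: (series_le_total (fun k => q_gt0 d beta_gt0 0 k)).
exact: series_q_cvg.
Qed.

Let good N := [/\ (0 < N)%N, 0 < rho N & forall k, r N k <= rho N * q d beta alpha k.+1].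

Let good_near : \forall N \near \oo, good N.
Proof.
near=> N; split.
- by near: N; exact: nbhs_infty_gt.
- by near: N; move/cvgr_gt : rho_cvg; apply.
- by near: N.
Unshelve. all: by end_near. Qed.

Let lam_ge0 N k : (0 < N)%N -> 0 <= vol R d N * r N k.
Proof. by move=> N0; rewrite mulr_ge0 ?r_ge0// ltW// vol_gt0. Qed.

Let Zint_le N K s L eta : good N -> (K <= L)%N -> 0 < eta ->
  rho N * expR (- (beta * eta)) < 1 ->
  (\int[P N]_w (gibbs_weight (X N) a b beta (vol R d N) K mu s w)%:E <=
   (expR (- (beta * vol R d N * min_energy_d K (mu + alpha + eta) s) + vol R d N * Q) *
    ((1 - rho N * expR (- (beta * eta)))^-1 ^+ L
     * expR (vol R d N * (rho N * (Q - series q0 L))) * expR (- c N)))%:E)%E.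
Proof.
move=> [N0 rho0 hr] KL eta0 he.
have V0 := vol_gt0 (R := R) d N0.
apply: (partition_function_le d_gt0 b_ge0 ba beta_gt0 V0 (fun k => lam_ge0 k N0)
  (XP N0) rho0 _ eta0 he mu s KL (lam_cvg N0 rho0 hr)).
by move=> k; rewrite ler_wpM2l ?(ltW V0).
Qed.

Let Z_fin N K s : good N ->
  (\int[P N]_w (gibbs_weight (X N) a b beta (vol R d N) K mu s w)%:E < +oo)%E.
Proof.
move=> gN; have [N0 rho0 hr] := gN.
apply: le_lt_trans (@Zint_le N K s K (rho N / beta) gN (leqnn K) _ _) (ltry _).
  exact: divr_gt0.
rewrite mulrCA mulfV ?gt_eqF// mulr1 expRN ltr_pdivrMr ?expR_gt0// mul1r.
by apply: lt_le_trans (expR_ge1Dx _); rewrite ltrDr.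
Qed.

Let Zint_ge N K s L (n : nat -> nat) : good N -> (K <= L)%N ->
  (forall k, (L <= k)%N -> n k = 0%N) ->
  let y := fun k => (n k)%:R / vol R d N in
  ((expR (- (beta * vol R d N * (- (mu + s) * D_trunc L y + a / 2 * D_trunc L y ^+ 2
       - b / 2 * sumsq_trunc L y + s * D_trunc K y))) *
    (expR (- c N) * \prod_(0 <= k < L) ((vol R d N * r N k) ^+ n k / (n k)`!%:R)))%:E
  <= \int[P N]_w (gibbs_weight (X N) a b beta (vol R d N) K mu s w)%:E)%E.
Proof.
move=> [N0 rho0 hr] KL n0.
exact: (partition_function_ge a b beta (vol_gt0 (R := R) d N0) (fun k => lam_ge0 k N0)
  (XP N0) mu s KL n0 (lam_cvg N0 rho0 hr)).
Qed.

Let Z_pos N K s : good N ->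
  (0 < \int[P N]_w (gibbs_weight (X N) a b beta (vol R d N) K mu s w)%:E)%E.
Proof.
move=> gN; apply: lt_le_trans (@Zint_ge N K s K (fun=> 0%N) gN (leqnn K) _) => //.
rewrite lte_fin !mulr_gt0 ?expR_gt0//; apply: prodr_gt0 => k _.
by rewrite expr0 fact0 invr1 mulr1.
Qed.

Lemma tilted_pressure_cvg K s :
  (beta * vol R d N)^-1 * (ln (Z N K s) + c N) - beta^-1 * Q @[N --> \oo]
    --> - min_energy_d K (mu + alpha) s.
Proof.
apply: (pressure_cvg d_gt0 b_ge0 ba beta_gt0 vol_pinfty rho_cvg r_cvg).
- near=> N => L eta KL eta0 he; have gN : good N by near: N.
  rewrite -lee_fin fineK; last by rewrite ge0_fin_numE ?Z_fin// ltW// Z_pos.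
  exact: Zint_le.
- near=> N => L n KL n0; have gN : good N by near: N.
  cbv zeta; rewrite -lee_fin fineK; last by rewrite ge0_fin_numE ?Z_fin// ltW// Z_pos.
  exact: Zint_ge.
Unshelve. all: by end_near. Qed.

Local Notation e N K := (mean_density (X N) d N a b beta mu K).

Lemma mean_long_near : \forall N \near \oo, forall K,
  [/\ mean_long d N K a b beta mu (nu_ref d N (X N)) = (e N K)%:E,
      0 <= e N K, e N K.+1 <= e N K
    & forall s, s * e N K <=
        ((beta * vol R d N)^-1 * (ln (Z N K s) + c N) - beta^-1 * Q)
        - ((beta * vol R d N)^-1 * (ln (Z N K 0) + c N) - beta^-1 * Q)].
Proof.
near=> N => K; have gN : good N by near: N.
have [N0 rho0 hr] := gN; have V0 := vol_gt0 (R := R) d N0.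
have Zf K' s := @Z_fin N K' s gN; have Zp K' s := @Z_pos N K' s gN.
have Z0 K' s : 0 < Z N K' s by rewrite fine_gt0// Zp Zf.
have bV : 0 < beta * vol R d N by rewrite mulr_gt0.
split.
- exact: mean_long_fin.
- exact: mean_density_ge0.
- exact: mean_density_nonincreasing.
- move=> s; have h := mean_density_jensen beta_gt0 N0 Zf Zp K s.
  have {h} : ln (Z N K 0) + s * (beta * vol R d N * e N K) <= ln (Z N K s).
    rewrite -[X in _ + X]expRK -lnM ?posrE ?expR_gt0//.
    by rewrite ler_ln ?posrE// mulr_gt0// expR_gt0.
  set E := e N K => h.
  have -> : s * E = (beta * vol R d N)^-1 * (s * (beta * vol R d N * E)).
    by field; rewrite !gt_eqF.
  set B := (beta * vol R d N)^-1.
  have -> : B * (ln (Z N K s) + c N) - beta^-1 * Q - (B * (ln (Z N K 0) + c N) - beta^-1 * Q)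
      = B * (ln (Z N K s) - ln (Z N K 0)) by ring.
  by rewrite ler_wpM2l ?invr_ge0 ?(ltW bV)// lerBrDl.
Unshelve. all: by end_near. Qed.

Lemma mean_density_cvg K (l : R) :
  is_derive (0 : R) 1 (min_energy_d K (mu + alpha)) (- l) ->
  (fun N => e N K) @ \oo --> l.
Proof.
move=> [dg dgE]; set g := min_energy_d K (mu + alpha).
have quot : (fun h : R => h^-1 * (g h - g 0)) @ 0^' --> - l.
  rewrite -dgE; move: dg => /= hg; rewrite /derive.
  apply: cvg_trans hg; apply: near_eq_cvg; near=> h.
  by rewrite /= addr0 /GRing.scale/= mulr1.
apply/cvgrPdist_le => eps eps0.
have e2 : 0 < eps / 2 by rewrite divr_gt0.
have [s0 s0_gt0 hs0] : exists2 s0 : R, 0 < s0 & forall s, s != 0 -> `|s| < s0 ->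
    `|- l - s^-1 * (g s - g 0)| <= eps / 2.
  have /cvgrPdist_le/(_ _ e2) := quot; rewrite /dnbhs/within/= => /nbhs_ballP[s0/= s0_gt0 H].
  exists s0 => // s sn0 ss0; apply: H => //.
  by rewrite /ball/= sub0r normrN.
pose s := s0 / 2; have s_gt0 : 0 < s by rewrite divr_gt0.
have ss0 : `|s| < s0 by rewrite gtr0_norm// /s; lra.
have hp := hs0 s (lt0r_neq0 s_gt0) ss0.
have hm : `|- l - (- s)^-1 * (g (- s) - g 0)| <= eps / 2.
  by apply: hs0; rewrite ?oppr_eq0 ?gt_eqF// normrN.
have W t : ((beta * vol R d N)^-1 * (ln (Z N K t) + c N) - beta^-1 * Q)
        - ((beta * vol R d N)^-1 * (ln (Z N K 0) + c N) - beta^-1 * Q) @[N --> \oo]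
        --> - g t - (- g 0).
  by apply: cvgB; exact: tilted_pressure_cvg.
have es : 0 < s * (eps / 2) by rewrite mulr_gt0.
have J : \forall N \near \oo, forall t, t * e N K <=
        ((beta * vol R d N)^-1 * (ln (Z N K t) + c N) - beta^-1 * Q)
        - ((beta * vol R d N)^-1 * (ln (Z N K 0) + c N) - beta^-1 * Q).
  by apply: filterS mean_long_near => N /(_ K)[].
near=> N.
have [hJ hJ'] : s * e N K <= (- g s - - g 0) + s * (eps / 2) /\
    (- s) * e N K <= (- g (- s) - - g 0) + s * (eps / 2).
  have hN : forall t, t * e N K <=
        ((beta * vol R d N)^-1 * (ln (Z N K t) + c N) - beta^-1 * Q)
        - ((beta * vol R d N)^-1 * (ln (Z N K 0) + c N) - beta^-1 * Q) by near: N.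
  split; apply: le_trans (hN _) _; near: N.
    by move/cvgr_le : (W s); apply; rewrite ltrDl.
  by move/cvgr_le : (W (- s)); apply; rewrite ltrDl.
move: hp hm hJ hJ'; move: (e N K) (g s) (g (- s)) (g 0) => E gs gs' g0.
rewrite invrN !ler_norml => /andP[hp1 hp2] /andP[hm1 hm2] hJ hJ'.
have q1 : - (gs - g0) <= s * (l + eps / 2).
  by rewrite -ler_pdivrMl// mulrN; lra.
have q2 : s * (l - eps / 2) <= gs' - g0.
  by rewrite -ler_pdivlMl//; lra.
have q3 : s * E <= s * (l + eps) by lra.
have q4 : s * (l - eps) <= s * E by lra.
rewrite ler_pM2l// in q3; rewrite ler_pM2l// in q4.
by apply/andP; split; lra.
Unshelve. all: by end_near. Qed.

End thermodynamic_limit.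

Section density_of_long_loops.
Context {R : realType}.
Variables (d : nat) (a b beta mu alpha : R).
Variables (dO : nat -> measure_display) (Omega : forall N, measurableType (dO N)).
Variables (P : forall N, probability (Omega N) R) (X : forall N, nat -> {RV (P N) >-> nat}).
Variables (r : nat -> nat -> R) (rho : nat -> R).
Hypotheses (d_gt0 : (0 < d)%N) (b_ge0 : 0 <= b) (ba : b < a) (beta_gt0 : 0 < beta).
Hypothesis XP : forall N, (0 < N)%N ->
  independent_poisson (X N) (fun k => vol R d N * r N k).
Hypothesis r_ge0 : forall N k, (0 < N)%N -> 0 <= r N k.
Hypothesis rho_cvg : rho @ \oo --> (1 : R).
Hypothesis r_le : \forall N \near \oo, forall k, r N k <= rho N * q d beta alpha k.+1.
Hypothesis r_cvg : forall k, (fun N => r N k) @ \oo --> q d beta alpha k.+1.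
Hypothesis alpha_le0 : alpha <= 0.

Local Notation min_energy_d :=
  (min_energy a b beta (fun k => q d beta 0 k.+1) (q_total d beta)).
Local Notation E := (fun K N => mean_long d N K a b beta mu (nu_ref d N (X N))).
Local Notation F := (tilted_pressure d a b beta mu alpha).

Lemma mean_long_cvg K l : is_derive (0 : R) 1 (min_energy_d K (mu + alpha)) (- l) ->
  E K N @[N --> \oo] --> l%:E.
Proof.
move=> hl; have h := mean_density_cvg d_gt0 b_ge0 ba beta_gt0 XP r_ge0 rho_cvg
  r_le r_cvg alpha_le0 hl.
have hE : (fun N => (mean_density (X N) d N a b beta mu K)%:E) @ \oo --> l%:E.
  by apply/fine_cvgP; split => //; exact: nearW.
apply: cvg_trans hE; apply: near_eq_cvg.
have := mean_long_near mu d_gt0 b_ge0 ba beta_gt0 XP r_ge0 rho_cvg r_le alpha_le0.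
by apply: filterS => N /(_ K)[].
Qed.

Lemma derivable_tilted_pressure K : derivable (F K) 0 1 ->
  is_derive (0 : R) 1 (min_energy_d K (mu + alpha)) (derive1 (F K) 0).
Proof.
have FE : F K = min_energy_d K (mu + alpha) \- cst (beta^-1 * q_total d beta).
  by apply/funext => s; rewrite tilted_pressureE.
move=> dF; have gE : min_energy_d K (mu + alpha) =
    F K \+ cst (beta^-1 * q_total d beta).
  by rewrite FE; apply/funext => s /=; rewrite subrK.
rewrite derive1E {1}gE -[X in is_derive _ _ _ X]addr0.
by apply: is_deriveD; exact: derivableP.
Qed.

Lemma iterated_lim_derive :
  (\forall K \near \oo, derivable (F K) 0 1) ->
  exists Delta : R, iterated_lim E Delta /\ - derive1 (F K) 0 @[K --> \oo] --> Delta.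
Proof.
move=> dF; pose L K := - derive1 (F K) 0.
have EL : \forall K \near \oo, E K N @[N --> \oo] --> (L K)%:E.
  near=> K; apply: mean_long_cvg; rewrite opprK; apply: derivable_tilted_pressure.
  by near: K.
have hN := mean_long_near mu d_gt0 b_ge0 ba beta_gt0 XP r_ge0 rho_cvg r_le alpha_le0.
have L0 : \forall K \near \oo, 0 <= L K.
  near=> K; have EK : E K N @[N --> \oo] --> (L K)%:E by near: K.
  rewrite -lee_fin -(cvg_lim _ EK)//; apply: lime_ge; first exact: cvgP EK.
  by apply: filterS hN => N /(_ K)[-> e0 _ _]; rewrite lee_fin.
have [K0 _ hK0] := EL.
have Lni : \forall K \near \oo, L K.+1 <= L K.
  near=> K; have K0K : (K0 <= K)%N by near: K; exact: nbhs_infty_ge.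
  have EK := hK0 K K0K; have EK1 := hK0 K.+1 (leqW K0K).
  rewrite -lee_fin -(cvg_lim _ EK)// -(cvg_lim _ EK1)//.
  apply: lee_lim; [exact: cvgP EK1|exact: cvgP EK|].
  apply: filterS hN => N h; have [-> _ h1 _] := h K; have [-> _ _ _] := h K.+1.
  by rewrite lee_fin.
have cL : cvgn L.
  apply: near_nonincreasing_is_cvgn L0.
  have [K1 _ hK1] := Lni; exists K1 => // K /= K1K K' KK'.
  rewrite -(subnKC KK'); elim: (K' - K)%N => [|n IH]; first by rewrite addn0.
  by rewrite addnS; apply: le_trans IH; apply: hK1 => /=; rewrite (leq_trans K1K)// leq_addr.
exists (limn L); split => //; exists L; split => //.
Unshelve. all: by end_near. Qed.

Lemma is_derive_sqr_max0 (u c : R) :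
  is_derive u 1 (fun v => Num.max (v + c) 0 ^+ 2 : R) (2 * Num.max (u + c) 0).
Proof.
have lim : (fun h : R => h^-1 *: (Num.max (h *: 1 + u + c) 0 ^+ 2 - Num.max (u + c) 0 ^+ 2))
    @ 0^' --> 2 * Num.max (u + c) 0.
  apply/cvgrPdist_le => e egt0; near=> h.
  have h0 : h != 0 by near: h; exact: nbhs_dnbhs_neq.
  have he : `|h| <= e by near: h; exact: dnbhs0_le.
  rewrite /GRing.scale/= mulr1 -addrA; move: (u + c) => {}u.
  have -> : 2 * Num.max u 0 - h^-1 * (Num.max (h + u) 0 ^+ 2 - Num.max u 0 ^+ 2) =
    - (h^-1 * (Num.max (h + u) 0 ^+ 2 - Num.max u 0 ^+ 2 - 2 * h * Num.max u 0)).
    by field.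
  rewrite normrN normrM normfV ler_pdivrMl ?normr_gt0//.
  apply: (@le_trans _ _ (`|h| * `|h|)); last by rewrite ler_wpM2l.
  rewrite -normrM -expr2 (ger0_norm (sqr_ge0 h)) ler_norml.
  have h2 := sqr_ge0 h.
  case: (leP u 0) => hu; case: (leP (h + u) 0) => hhu; apply/andP; split; nra.
apply: DeriveDef; first exact: cvgP lim.
exact: cvg_lim lim.
Unshelve. all: by end_near. Qed.

Lemma minimiser_curves (xi0 : nat -> R) :
  (forall K : nat, (0 < K)%N ->
    exists (eps : R) (xi : R -> nat -> R),
      [/\ 0 < eps, C1_ell1 eps xi, xi 0 = xi0
        & forall s : R, - eps < s < eps ->
            is_minimiser (tilted_rate d a b beta mu alpha K s) (xi s)]) ->
  let Delta := a / (a - b) * Num.max ((mu + alpha) / a - fine (D xi0)) 0 in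
  iterated_lim E Delta /\
  is_derive mu 1
    (fun m : R => fine (H_HYL a b (m + alpha) xi0 - H_HYL_lsc a b (m + alpha) xi0)%E)
    Delta.
Proof.
move=> hxi Delta; have ab0 : 0 < a - b by rewrite subr_gt0.
have a0 : 0 < a by exact: le_lt_trans ba.
have DeltaE : Delta = Num.max (mu + alpha - a * fine (D xi0)) 0 / (a - b).
  rewrite /Delta; have -> : mu + alpha - a * fine (D xi0) =
     a * ((mu + alpha) / a - fine (D xi0)) by field; rewrite gt_eqF.
  rewrite -[in RHS](mulr0 a) -maxr_pMr ?(ltW a0)// mulrAC; ring.
have H K : (0 < K)%N -> finite_energy d beta xi0 /\
    is_derive (0 : R) 1 (min_energy_d K (mu + alpha))
      (- (total_density a b (mu + alpha) xi0 - D_trunc K xi0)).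
  move=> K0; have [eps [xi [eps0 C1xi <- hmin]]] := hxi K K0.
  exact: minimiser_curve_derive eps0 C1xi hmin.
have [[[_ x0] Dx Ix] _] := H 1%N isT.
split.
  exists (fun K => total_density a b (mu + alpha) xi0 - D_trunc K xi0); split.
    near=> K; apply: mean_long_cvg; apply: (H K _).2.
    by near: K; exact: nbhs_infty_gt.
  have -> : Delta = total_density a b (mu + alpha) xi0 - fine (D xi0).
    by rewrite DeltaE /total_density; move: (Num.max _ _ / _) => z; ring.
  by apply: cvgB; [exact: cvg_cst|exact: D_trunc_cvg].
have ex : ell1_plus xi0 by case: (H 1%N isT) => -[].
have -> : (fun m : R => fine (H_HYL a b (m + alpha) xi0 - H_HYL_lsc a b (m + alpha) xi0)%E)
   = (fun m => Num.max (m + alpha - a * fine (D xi0)) 0 ^+ 2 / (2 * (a - b))).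
  apply/funext => m; rewrite /H_HYL_lsc /H_HYL asboolT//= opprB addrC subrK.
  by [].
rewrite DeltaE.
have -> : (fun m => Num.max (m + alpha - a * fine (D xi0)) 0 ^+ 2 / (2 * (a - b))) =
    (2 * (a - b))^-1 \*: (fun m => Num.max (m + (alpha - a * fine (D xi0))) 0 ^+ 2).
  by apply/funext => m; rewrite /GRing.scale/= addrA mulrC.
have -> : Num.max (mu + alpha - a * fine (D xi0)) 0 / (a - b) =
    (2 * (a - b))^-1 *: (2 * Num.max (mu + (alpha - a * fine (D xi0))) 0).
  by rewrite addrA /GRing.scale/=; field; rewrite gt_eqF.
apply: is_deriveZ; exact: is_derive_sqr_max0.
Unshelve. all: by end_near. Qed.

End density_of_long_loops.

(** * Lebesgue measure on tuples and periodic weights *)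

Section sigma_finite_copy.
Context {R : realType} (dT : measure_display) (T : measurableType dT).
Variables (m : {measure set T -> \bar R}) (hm : sigma_finite setT m).

Definition sigma_finite_copy (hm : sigma_finite setT m) : set T -> \bar R := m.

HB.instance Definition _ := Measure.copy (sigma_finite_copy hm) m.
HB.instance Definition _ :=
  Measure_isSigmaFinite.Build _ _ _ (sigma_finite_copy hm) hm.

End sigma_finite_copy.

Section tuple_lebesgue_measure.
Context {R : realType}.

Definition rect d (lo hi : nat -> R) : set (pointR R d) :=
  [set x | forall i : 'I_d, lo i <= tnth x i <= hi i].
Arguments rect : clear implicits.

Lemma measurable_rect d lo hi : measurable (rect d lo hi).
Proof.
rewrite (_ : rect d lo hi = \bigcap_(i in [set: 'I_d])
  ((fun x : pointR R d => tnth x i) @^-1` `[lo i, hi i]%classic)); last first.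
  by apply/seteqP; split => x h i; have := h i; rewrite /= in_itv/=; [|apply].
apply: fin_bigcap_measurable; first exact: finite_finset.
by move=> i _; rewrite -[_ @^-1` _]setTI; apply: measurable_tnth.
Qed.

Lemma rect_cons d lo hi (x : R) (u : pointR R d) :
  rect d.+1 lo hi [tuple of x :: u] <->
  (lo 0%N <= x <= hi 0%N) /\ rect d (lo \o succn) (hi \o succn) u.
Proof.
split=> [h|[hx hu] i].
  split; first by have := h ord0; rewrite tnth0.
  by move=> i; have := h (lift ord0 i); rewrite tnthS.
case: (unliftP ord0 i) => [j ->|->]; last by rewrite tnth0.
by have := hu j; rewrite tnthS.
Qed.

Lemma lebesgue_tuple_set0 d : lebesgue_tuple (set0 : set (pointR R d)) = 0%E.
Proof.
elim: d => [|d IH]; first by rewrite /= measure0.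
rewrite /= (eq_integral (fun=> 0%E)); first exact: integral0.
by move=> x _; rewrite -[RHS]IH; congr lebesgue_tuple; apply/seteqP; split.
Qed.

Lemma lebesgue_tuple_ge0 d (A : set (pointR R d)) : (0 <= lebesgue_tuple A)%E.
Proof. by case: d A => [|d] A; [exact: measure_ge0|]; elim: d A => [|d IH] A;
  apply: integral_ge0 => x _; [exact: measure_ge0|exact: IH]. Qed.

Lemma lebesgue_tuple_rect d lo hi : (forall i, lo i <= hi i) ->
  lebesgue_tuple (rect d lo hi) = (\prod_(i < d) (hi i - lo i))%:E.
Proof.
elim: d lo hi => [|d IH] lo hi lohi.
  rewrite /= big_ord0 (_ : rect 0 lo hi = setT) ?diracT//.
  by apply/seteqP; split => // x _ [].
transitivity (\int[@lebesgue_measure R]_(x in `[lo 0%N, hi 0%N]%classic)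
    (\prod_(i < d) (hi i.+1 - lo i.+1))%:E)%E.
  rewrite [RHS]integral_mkcond; apply: eq_integral => x _.
  rewrite patchE; case: ifPn => [|].
    rewrite inE/= in_itv/= => hx.
    rewrite -(IH (lo \o succn) (hi \o succn)); last by move=> i; exact: lohi.
    congr lebesgue_tuple; apply/seteqP; split => u /=; first by move/rect_cons => [].
    by move=> hu; apply/rect_cons.
  rewrite notin_setE/= in_itv/= => hx.
  rewrite -[RHS](lebesgue_tuple_set0 d); congr lebesgue_tuple.
  by apply/seteqP; split => u //= /rect_cons[].
rewrite integral_cst; last exact: measurable_itv.
have := lebesgue_measure_itv `[lo 0%N, hi 0%N]; rewrite /= lte_fin => lebE.
rewrite big_ord_recl/=.
transitivity ((\prod_(i < d) (hi i.+1 - lo i.+1))%:E *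
  (if (lo 0 < hi 0)%R then (hi 0%N)%:E - (lo 0%N)%:E else 0))%E.
  by rewrite -lebE.
case: ifPn => [|]; first by move=> _; rewrite -EFinD -EFinM mulrC.
rewrite -leNgt => h; have -> : hi 0%N = lo 0%N by apply/eqP; rewrite eq_le h lohi.
by rewrite mule0 subrr mul0r.
Qed.

Lemma measurable_tuple_cons d :
  measurable_fun setT (fun p : measurableTypeR R * pointR R d => [tuple of p.1 :: p.2]).
Proof. exact: measurable_cons. Qed.

Let sigma_finite_agrees d (m : {measure set (pointR R d) -> \bar R}) :
  (forall A, measurable A -> m A = lebesgue_tuple A) -> sigma_finite setT m.
Proof.
move=> mE; exists (fun n => rect d (fun=> - n%:R) (fun=> n%:R)).
  apply/seteqP; split => // x _.
  exists (Num.truncn (\sum_(i < d) `|tnth x i|)).+1 => // i.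
  rewrite -ler_norml; apply: (@le_trans _ _ (\sum_(i < d) `|tnth x i|)).
    by rewrite (bigD1 i)//= lerDl sumr_ge0.
  have s0 : 0 <= \sum_(i < d) `|tnth x i| by rewrite sumr_ge0.
  by have /andP[_ /ltW] := truncn_itv s0.
move=> n; split; first exact: measurable_rect.
rewrite mE; last exact: measurable_rect.
by rewrite lebesgue_tuple_rect ?ltry// => i; rewrite -subr_ge0 opprK addr_ge0.
Qed.

Let lebesgue_tuple_measure d : exists m : {measure set (pointR R d) -> \bar R},
  forall A, measurable A -> m A = lebesgue_tuple A.
Proof.
elim: d => [|d [m mE]]; first by exists (dirac ([tuple] : pointR R 0)).
pose m' : {sigma_finite_measure set (pointR R d) -> \bar R} :=
  sigma_finite_copy (sigma_finite_agrees mE).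
pose f := fun p : measurableTypeR R * pointR R d => [tuple of p.1 :: p.2].
have mf : measurable_fun setT f := @measurable_tuple_cons d.
pose p : {measure set (measurableTypeR R * pointR R d) -> \bar R} :=
  (@lebesgue_measure R \x m')%E.
unshelve eexists (pushforward p f : {measure set _ -> \bar R}); first exact: mf.
move=> A mA.
change (\int[@lebesgue_measure R]_x m (xsection (f @^-1` A) x) =
  \int[@lebesgue_measure R]_x lebesgue_tuple [set u : pointR R d | A [tuple of x :: u]])%E.
apply: eq_integral => x _; rewrite -mE.
  by congr (m _); apply/seteqP; split => u; rewrite /xsection/= inE.
have mfA : measurable (f @^-1` A) by rewrite -[_ @^-1` _]setTI; exact: mf.
have := measurable_xsection x mfA; congr measurable.
by apply/seteqP; split => u; rewrite /xsection/= inE.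
Qed.

Let lebesgue_tuple_sigma_additive d :
  semi_sigma_additive (@lebesgue_tuple R d).
Proof.
have [m mE] := lebesgue_tuple_measure d.
move=> F mF tF mUF; rewrite -mE//.
rewrite (_ : (fun n => _) = (fun n => \sum_(0 <= i < n) m (F i))%E); last first.
  by apply/funext => n; apply: eq_bigr => i _; rewrite mE.
exact: measure_semi_sigma_additive.
Qed.

HB.instance Definition _ d := isMeasure.Build _ _ _ (@lebesgue_tuple R d)
  (lebesgue_tuple_set0 d) (@lebesgue_tuple_ge0 d) (@lebesgue_tuple_sigma_additive d).

Lemma box_rect d N : box N = rect d (fun=> - N%:R) (fun=> N%:R).
Proof.
by apply/seteqP; split => x h i; have := h i; rewrite ler_norml.
Qed.

Lemma measurable_box d N : measurable (box N : set (pointR R d)).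
Proof. by rewrite box_rect; exact: measurable_rect. Qed.

Lemma lebesgue_tuple_box d N :
  lebesgue_tuple (box N : set (pointR R d)) = (vol R d N)%:E.
Proof.
rewrite box_rect lebesgue_tuple_rect; last first.
  by move=> i; rewrite -subr_ge0 opprK addr_ge0.
by rewrite prodr_const card_ord opprK /vol; congr (_ ^+ _)%:E; ring.
Qed.

End tuple_lebesgue_measure.
Arguments rect {R} d lo hi _.

Section esum_bounds.
Context {R : realType}.
Local Open Scope ereal_scope.

Lemma esumZ_le (T : choiceType) (I : set T) (f : T -> \bar R) (c : R) :
  (0 <= c)%R -> (forall i, 0 <= f i) ->
  \esum_(i in I) (c%:E * f i) <= c%:E * \esum_(i in I) f i.
Proof.
move=> c0 f0; apply: ge_ereal_sup => _ [A [finA AI] <-].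
rewrite -ge0_mule_fsumr// lee_wpmul2l ?lee_fin//.
by apply: ereal_sup_ubound; exists A.
Qed.

Lemma esum_tuple_prod_le (T : choiceType) (v : T -> R) (s : R) d :
  (forall z, (0 <= v z)%R) -> \esum_(z in [set: T]) (v z)%:E <= s%:E ->
  \esum_(z in [set: d.-tuple T]) (\prod_(i < d) v (tnth z i))%:E <= (s ^+ d)%:E.
Proof.
move=> v0 vs; elim: d => [|d IH].
  rewrite (_ : [set: 0.-tuple T] = [set [tuple]]); last first.
    by apply/seteqP; split => // x _ /=; exact: tuple0.
  by rewrite esum_set1 ?big_ord0 ?lee_fin ?expr0.
pose e (p : T * d.-tuple T) : d.+1.-tuple T := [tuple of p.1 :: p.2].
have e_bij : set_bij [set: T * d.-tuple T] [set: d.+1.-tuple T] e.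
  split => //.
    move=> [x u] [y v'] _ _ /(congr1 val)/= [-> /val_inj ->] //.
  by move=> z _; exists (thead z, [tuple of behead z]) => //=; rewrite /e/= -tuple_eta.
rewrite (reindex_esum _ _ _ _ e_bij).
rewrite (_ : [set: T * d.-tuple T] = [set: T] `*`` (fun=> [set: d.-tuple T])); last first.
  by apply/seteqP; split.
have E : (fun i => (\prod_(i0 < d.+1) v (tnth (e i) i0))%:E) =
    (fun k => (v k.1)%:E * (\prod_(i < d) v (tnth k.2 i))%:E).
  apply/funext => -[x u]; rewrite big_ord_recl tnth0 EFinM; congr (_ * _%:E).
  by apply: eq_bigr => i _; rewrite tnthS.
rewrite E -(@esum_esum _ _ _ _ _ (fun x u => (v x)%:E * (\prod_(i < d) v (tnth u i))%:E)); last first.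
  by move=> x u _ _; rewrite mule_ge0// lee_fin// prodr_ge0.
apply: (@le_trans _ _ (\esum_(x in [set: T]) ((s ^+ d)%:E * (v x)%:E))).
  apply: le_esum => x _; apply: le_trans (esumZ_le _ _ _) _ => //.
    by move=> u; rewrite lee_fin prodr_ge0.
  by rewrite muleC lee_wpmul2r ?lee_fin.
have s0 : (0 <= s)%R.
  by rewrite -lee_fin; apply: le_trans vs; apply: esum_ge0 => z _; rewrite lee_fin.
apply: le_trans (esumZ_le _ _ _) _; rewrite ?exprn_ge0//.
by rewrite exprSr EFinM lee_wpmul2l// lee_fin exprn_ge0.
Qed.

Lemma esum_int_geometric (w : R) : (0 <= w < 1)%R ->
  \esum_(z in [set: int]) (w ^+ `|z|%N)%:E = ((1 + w) / (1 - w))%:E.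
Proof.
move=> /andP[w0 w1].
have geo (c : R) : (0 <= c)%R ->
    \esum_(n in [set: nat]) (c * w ^+ n)%:E = (c * (1 - w)^-1)%:E.
  move=> c0; rewrite -nneseries_esumT; last by move=> n; rewrite lee_fin mulr_ge0// exprn_ge0.
  apply: nneseries_EFin_cvg; first by move=> n; rewrite mulr_ge0// exprn_ge0.
  by apply: cvg_geometric_series; rewrite ger0_norm.
rewrite (esumID (range Posz)); last by move=> z _; rewrite lee_fin exprn_ge0.
rewrite !setTI.
have -> : ~` range Posz = range Negz.
  apply/seteqP; split => [[n|n]|z]/=.
  - by move=> h; exfalso; apply: h; exists n.
  - by move=> _; exists n.
  - by move=> [n _ <-] [m _].
rewrite !esum_image; last 2 first.
- by move=> x y _ _ [].
- by move=> x y _ _ [].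
have -> : \esum_(i in [set: nat]) (w ^+ `|Posz i|)%:E = (1 * (1 - w)^-1)%:E.
  by rewrite -geo//; apply: eq_esum => n _; rewrite mul1r.
have -> : \esum_(i in [set: nat]) (w ^+ `|Negz i|)%:E = (w * (1 - w)^-1)%:E.
  by rewrite -geo//; apply: eq_esum => n _; rewrite -exprS.
by rewrite -EFinD -mulrDl.
Qed.

End esum_bounds.

Section periodic_weights.
Context {R : realType}.
Variables (d : nat) (beta alpha : R).
Hypotheses (d_gt0 : (0 < d)%N) (beta_gt0 : 0 < beta).

Lemma heatE t (x y : pointR R d) :
  heat t x y = (4 * pi * t) `^ (- (d%:R / 2)) * expR (- (sqdist x y / (4 * t))).
Proof. by rewrite /heat mulNr. Qed.

Lemma q_heat k : q d beta alpha k.+1 =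
  expR (beta * alpha * k.+1%:R) / k.+1%:R * (4 * pi * (k.+1%:R * beta)) `^ (- (d%:R / 2)).
Proof.
have bp : 0 <= 4 * pi * beta by rewrite !mulr_ge0// ?pi_ge0 ?ltW.
have -> : 4 * pi * (k.+1%:R * beta) = 4 * pi * beta * k.+1%:R by ring.
rewrite /q powRD ?pnatr_eq0 ?implybT// powRr1// powRN (powRM _ bp)//.
by rewrite !invfM; ring.
Qed.

Let V := vol R d.

Lemma q_cut_cst N (g : R -> pointR R d -> \bar R) k (C : R) :
  (0 < N)%N -> (forall x, g (k.+1%:R * beta)%R x = C%:E) -> (k < N)%N ->
  q_cut N beta alpha g k.+1 = expR (beta * alpha * k.+1%:R) / k.+1%:R * C.
Proof.
move=> N0 gC kN; rewrite /q_cut kN; have V0 := vol_gt0 (R := R) d N0.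
rewrite (eq_integral (fun=> C%:E)); last by move=> x _; exact: gC.
rewrite integral_cst; last exact: measurable_box.
rewrite -[X in (_ * X)%E]/(lebesgue_tuple _) lebesgue_tuple_box -EFinM/=.
by field; rewrite !gt_eqF.
Qed.

Definition per_bound N : R :=
  ((1 + expR (- (N%:R / beta))) / (1 - expR (- (N%:R / beta)))) ^+ d.

Lemma heat_per_diag N k : (k < N)%N -> exists C : R,
  [/\ forall x : pointR R d, heat_per N (k.+1%:R * beta) x x = C%:E,
      (4 * pi * (k.+1%:R * beta)) `^ (- (d%:R / 2)) <= C
    & C <= (4 * pi * (k.+1%:R * beta)) `^ (- (d%:R / 2)) * per_bound N].
Proof.
move=> kN; set t := k.+1%:R * beta; set h0 := _ `^ _.
have t0 : 0 < t by rewrite mulr_gt0.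
have N0 : (0 < N)%N by apply: leq_ltn_trans kN.
pose u (z : d.-tuple int) : R := \sum_(i < d) (2 * N%:R * (tnth z i)%:~R) ^+ 2.
have hE (x : pointR R d) z : heat t x
    [tuple tnth x i + 2 * N%:R * (tnth z i)%:~R | i < d] = h0 * expR (- (u z / (4 * t))).
  have uE : sqdist x [tuple tnth x i + 2 * N%:R * (tnth z i)%:~R | i < d] = u z.
    by apply: eq_bigr => i _; rewrite tnth_mktuple opprD addrA subrr add0r sqrrN.
  by rewrite heatE uE.
pose w := expR (- (N%:R / beta)).
have w0 : 0 <= w by exact: expR_ge0.
have w1 : w < 1 by rewrite expR_lt1 oppr_lt0 divr_gt0// ltr0n.
have h00 : 0 <= h0 by exact: powR_ge0.
have uw z : expR (- (u z / (4 * t))) <= \prod_(i < d) w ^+ `|tnth z i|%N.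
  rewrite /u mulr_suml -sumrN expR_sum; apply: ler_prod => i _.
  rewrite expR_ge0/= /w -expRM_natl ler_expR mulrN lerN2.
  set m := tnth z i.
  have -> : (2 * N%:R * m%:~R) ^+ 2 / (4 * t) = N%:R ^+ 2 * (m%:~R ^+ 2) / t.
    by field; rewrite gt_eqF.
  have m2 : (`|m|%N)%:R <= m%:~R ^+ 2 :> R.
    have -> : m%:~R ^+ 2 = (`|m|%N)%:R ^+ 2 :> R.
      by rewrite natr_absz intr_norm real_normK ?num_real.
    by rewrite -natrX ler_nat; case: `|m|%N => // n; rewrite leq_pmulr.
  rewrite ler_pdivlMr//.
  have tb : t <= N%:R * beta by rewrite ler_wpM2r ?(ltW beta_gt0)// ler_nat.
  have N00 : 0 <= N%:R :> R by [].
  have m0 : 0 <= (`|m|%N)%:R :> R by [].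
  apply: (@le_trans _ _ ((`|m|%N)%:R * (N%:R / beta) * (N%:R * beta))).
    by rewrite ler_wpM2l// mulr_ge0// divr_ge0// ltW.
  have -> : (`|m|%N)%:R * (N%:R / beta) * (N%:R * beta) = N%:R ^+ 2 * (`|m|%N)%:R.
    by field; rewrite gt_eqF.
  by rewrite ler_wpM2l// exprn_ge0.
pose S := (\esum_(z in [set: d.-tuple int]) (h0 * expR (- (u z / (4 * t))))%:E)%E.
have Sle : (S <= (h0 * per_bound N)%:E)%E.
  apply: (@le_trans _ _ (\esum_(z in [set: d.-tuple int])
      (h0%:E * (\prod_(i < d) w ^+ `|tnth z i|%N)%:E))%E).
    by apply: le_esum => z _; rewrite -EFinM lee_fin ler_wpM2l.
  apply: le_trans (esumZ_le _ _ _) _ => //.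
    by move=> z; rewrite lee_fin prodr_ge0// => i _; rewrite exprn_ge0.
  rewrite EFinM lee_wpmul2l ?lee_fin//.
  apply: (@esum_tuple_prod_le _ _ (fun z : int => w ^+ `|z|%N)).
    by move=> z; rewrite exprn_ge0.
  by rewrite esum_int_geometric// w0.
have Sge : (h0%:E <= S)%E.
  apply: esum_ge; exists [set [tuple 0 | i < d]].
    by split => //; exact: finite_set1.
  rewrite fsbig_set1 lee_fin (_ : u _ = 0) ?mul0r ?oppr0 ?expR0 ?mulr1//.
  by rewrite /u big1// => i _; rewrite tnth_mktuple mulr0 expr0n.
have Sfin : S \is a fin_num.
  rewrite ge0_fin_numE; first by apply: le_lt_trans Sle _; rewrite ltry.
  by apply: le_trans Sge; rewrite lee_fin.
exists (fine S); split.
- move=> x; rewrite fineK//; apply: eq_esum => z _; by rewrite hE.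
- by rewrite -lee_fin fineK.
- by rewrite -lee_fin fineK.
Qed.

Lemma cvg_per_bound : per_bound @ \oo --> (1 : R).
Proof.
have wc : (fun N : nat => expR (- (N%:R / beta))) @ \oo --> (0 : R).
  apply: (@cvg_comp _ _ _ (fun N : nat => N%:R / beta) (fun x : R => expR (- x)) _ +oo).
    apply/cvgryPge => A; near=> N; rewrite ler_pdivlMr//.
    by near: N; exact: nbhs_infty_ger.
  exact: cvgr_expR.
have h : (fun N : nat => (1 + expR (- (N%:R / beta))) / (1 - expR (- (N%:R / beta)))) @ \oo --> (1 : R).
  rewrite [X in _ --> X](_ : 1 = (1 + 0) / (1 - 0) :> R); last by rewrite addr0 subr0 divff.
  apply: (@cvgM _ _ _ _ (fun N : nat => 1 + expR (- (N%:R / beta)))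
     (fun N : nat => (1 - expR (- (N%:R / beta)))^-1)).
    by apply: cvgD => //; exact: cvg_cst.
  apply: cvgV; first by rewrite subr0 oner_neq0.
  by apply: cvgB => //; exact: cvg_cst.
rewrite /per_bound; elim: (d) => [|n IH]; first by under eq_fun do rewrite expr0; exact: cvg_cst.
under eq_fun do rewrite exprS.
have hM := cvgM (F := \oo) h IH.
by rewrite mulr1 in hM; exact: hM.
Unshelve. all: by end_near. Qed.

Let per_diag N := fun t (x : pointR R d) => heat_per N t x x.

Lemma q_per_bounds N k : (k < N)%N ->
  q d beta alpha k.+1 <= q_cut N beta alpha (per_diag N) k.+1
    <= per_bound N * q d beta alpha k.+1.
Proof.
move=> kN; have N0 : (0 < N)%N by apply: leq_ltn_trans kN.
have [C [CE C1 C2]] := heat_per_diag kN.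
rewrite (q_cut_cst N0 CE kN) q_heat [per_bound N * _]mulrCA [per_bound N * _]mulrC.
have e0 : 0 <= expR (beta * alpha * k.+1%:R) / k.+1%:R by rewrite divr_ge0// expR_ge0.
by rewrite !ler_wpM2l.
Qed.

End periodic_weights.

(** * Brownian motion killed outside a box *)

Section rectangle_integrals.
Context {R : realType}.

Lemma integral_rect_le d lo hi (f : pointR R d -> R) (c : R) :
  (forall i, lo i <= hi i) -> (forall y, rect d lo hi y -> f y <= c) ->
  (\int[@lebesgue_tuple R d]_(y in rect d lo hi) (f y)%:E <=
    (c * \prod_(i < d) (hi i - lo i))%:E)%E.
Proof.
move=> lohi fc; rewrite EFinM -(lebesgue_tuple_rect d lohi).
rewrite -(integral_cst (lebesgue_tuple (d := d)) (measurable_rect lo hi) c%:E).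
by apply: le_integralW => y /fc; rewrite lee_fin.
Qed.

Lemma integral_rect_ge d lo hi (f : pointR R d -> R) (c : R) :
  (forall i, lo i <= hi i) -> (forall y, rect d lo hi y -> c <= f y) ->
  ((c * \prod_(i < d) (hi i - lo i))%:E <=
   \int[@lebesgue_tuple R d]_(y in rect d lo hi) (f y)%:E)%E.
Proof.
move=> lohi fc; rewrite EFinM -(lebesgue_tuple_rect d lohi).
rewrite -(integral_cst (lebesgue_tuple (d := d)) (measurable_rect lo hi) c%:E).
by apply: le_integralW => y /fc; rewrite lee_fin.
Qed.

End rectangle_integrals.

Section heat_bounds.
Context {R : realType}.
Variable d : nat.
Implicit Types x y : pointR R d.

Lemma sqdist_ge0 x y : 0 <= sqdist x y.
Proof. by apply: sumr_ge0 => i _; rewrite sqr_ge0. Qed.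

Lemma sqdist_ge x y i : (tnth x i - tnth y i) ^+ 2 <= sqdist x y.
Proof. by rewrite /sqdist (bigD1 i)//= lerDl sumr_ge0// => j _; rewrite sqr_ge0. Qed.

Lemma heat_ge0 t x y : 0 <= heat t x y.
Proof. by rewrite /heat mulr_ge0 ?powR_ge0 ?expR_ge0. Qed.

Lemma heat_le_diag t x y : 0 < t -> heat t x y <= (4 * pi * t) `^ (- (d%:R / 2)).
Proof.
move=> t0; rewrite heatE ler_piMr ?powR_ge0//.
by rewrite expR_le1 oppr_le0 divr_ge0 ?sqdist_ge0// mulr_ge0// ltW.
Qed.

Lemma heat_ge_diag t x y (s : R) : 0 < t -> sqdist x y <= s ->
  (4 * pi * t) `^ (- (d%:R / 2)) * (1 - s / (4 * t)) <= heat t x y.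
Proof.
move=> t0 ys; rewrite heatE ler_wpM2l ?powR_ge0//.
apply: le_trans (expR_ge1Dx _).
by rewrite lerD2l lerN2 ler_pM2r ?invr_gt0 ?mulr_gt0.
Qed.

Definition far_heat (M : R) : R := (4 * pi * (M ^+ 2 / 4) / (d%:R / 2)) `^ (- (d%:R / 2)).

(* Maximising [r^(-p) exp(-A/r)] over [r] gives a bound uniform in time. *)
Lemma heat_le_far t x y (M : R) : (0 < d)%N -> 0 < t -> 0 < M -> M ^+ 2 <= sqdist x y ->
  heat t x y <= far_heat M.
Proof.
move=> d0 t0 M0 My; rewrite heatE /far_heat.
set p := d%:R / 2; have p0 : 0 < p by rewrite divr_gt0// ltr0n.
have pi0 := pi_gt0 R.
set A := M ^+ 2 / 4; have A0 : 0 < A by rewrite divr_gt0// exprn_gt0.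
have At : A / t <= sqdist x y / (4 * t).
  by rewrite /A -mulrA -invfM ler_pM2r// invr_gt0 mulr_gt0.
apply: (@le_trans _ _ ((4 * pi * t) `^ (- p) * expR (- (A / t)))).
  by rewrite ler_wpM2l ?powR_ge0// ler_expR lerN2.
have h1 : 0 < 4 * pi * t by rewrite !mulr_gt0.
have h2 : 0 < 4 * pi * A / p by rewrite divr_gt0// !mulr_gt0.
rewrite /powR !gt_eqF// -expRD ler_expR.
have hu : 0 < A / t / p by do 2![apply: divr_gt0 => //].
have E : 4 * pi * A / p = 4 * pi * t * (A / t / p).
  by field; rewrite !gt_eqF.
rewrite E (lnM (x := 4 * pi * t)) ?posrE// (mulrDr (- p)) lerD2l mulNr lerN2.
have := le_ln1Dx (x := A / t / p - 1).
rewrite ltrBrDr addNr hu => /(_ isT); rewrite addrCA subrr addr0 => h.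
apply: le_trans (_ : p * (A / t / p - 1) <= _); first by rewrite ler_pM2l.
have -> : p * (A / t / p - 1) = A / t - p by field; rewrite !gt_eqF.
by rewrite gerDl oppr_le0 ltW.
Qed.

Lemma cvg_far_heat : (0 < d)%N -> (fun M : nat => far_heat M%:R) @ \oo --> (0 : R).
Proof.
move=> d0; pose p : R := d%:R / 2; have p0 : 0 < p by rewrite divr_gt0// ltr0n.
have pi0 := pi_gt0 R; have c0 : 0 <= pi / p by rewrite divr_ge0// ltW.
pose c := (pi / p) `^ (- p).
have E (M : R) : 0 <= M -> far_heat M = c * (M ^+ d)^-1.
  move=> M0; rewrite /far_heat -/p.
  have -> : 4 * pi * (M ^+ 2 / 4) / p = pi / p * M ^+ 2 by field; rewrite gt_eqF.
  rewrite powRM ?exprn_ge0// -/c; congr (c * _).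
  rewrite -powR_mulrn// -powRrM -[RHS]powR_invn//; congr (_ `^ _).
  by rewrite /p; field.
have h : (fun M : nat => c * M%:R^-1) @ \oo --> (0 : R).
  rewrite -[X in _ --> X](mulr0 c); apply: cvgM; first exact: cvg_cst.
  apply/gtr0_cvgV0; last exact: cvgr_idn.
  by near=> M; rewrite ltr0n; near: M; exists 1%N.
apply: (squeeze_cvgr _ (cvg_cst 0) h); near=> M.
have M1 : 1 <= M%:R :> R by rewrite ler1n; near: M; exists 1%N.
have M0 : 0 < M%:R :> R by exact: lt_le_trans M1.
rewrite (E _ (ltW M0)) mulr_ge0 ?powR_ge0 ?invr_ge0 ?exprn_ge0//=.
rewrite ler_wpM2l ?powR_ge0// lef_pV2 ?posrE ?exprn_gt0//.
by case: (d) d0 => // n _; rewrite exprS ler_peMr ?exprn_ege1// ltW.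
Unshelve. all: by end_near. Qed.

End heat_bounds.

Section corner_cube.
Context {R : realType}.
Variables (d N : nat).
Hypothesis N_gt0 : (0 < N)%N.

Lemma corner_cube (x : pointR R d) (rho : R) : box N x -> 0 < rho <= 1 ->
  exists lo : nat -> R,
    rect d lo (fun i => lo i + rho) `<=` box N /\
    forall y, rect d lo (fun i => lo i + rho) y ->
      forall i, `|tnth y i - tnth x i| <= rho.
Proof.
move=> xN /andP[r0 r1].
exists (fun i => if 0 < nth 0 x i then nth 0 x i - rho else nth 0 x i).
have N1 : 1 <= N%:R :> R by rewrite ler1n.
split => y hy i; have := hy i; rewrite -tnth_nth; have := xN i;
  move: (tnth x i) (tnth y i) => u v; rewrite !ler_norml; case: ltP => u0; lra.
Qed.

Lemma killed_density_corner (g : R -> pointR R d -> pointR R d -> R) t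
    (x : pointR R d) (e rho0 : R) :
  {within [set v : 'rV[R]_d | box N ([tuple v ord0 i | i < d] : pointR R d)],
    continuous (fun v : 'rV[R]_d => g t x [tuple v ord0 i | i < d])} ->
  box N x -> 0 < e -> 0 < rho0 ->
  exists (lo : nat -> R) (rho : R),
  [/\ 0 < rho <= rho0, rect d lo (fun i => lo i + rho) `<=` box N,
      forall y, rect d lo (fun i => lo i + rho) y ->
        forall i, `|tnth y i - tnth x i| <= rho
    & forall y, rect d lo (fun i => lo i + rho) y -> `|g t x y - g t x x| <= e].
Proof.
move=> gc xN e0 rho00.
pose v0 : 'rV[R]_d := \row_i tnth x i.
pose tv (v : 'rV[R]_d) : pointR R d := [tuple v ord0 i | i < d].
have tv0 : tv v0 = x.
  by apply: eq_from_tnth => i; rewrite tnth_mktuple mxE.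
have v0S : [set v | box N (tv v)] v0 by rewrite /= tv0.
move/subspace_continuousP: gc => /(_ v0 v0S)/cvgrPdist_le/(_ e e0).
rewrite near_withinE => /nbhs_ballP[r /= r0 hr].
pose rho := Num.min (r / 2) (Num.min rho0 1).
have rr : 0 < rho by rewrite !lt_min !divr_gt0 ?rho00 ?ltr01.
have r1 : 0 < rho <= 1 by rewrite rr !ge_min lexx !orbT.
have [lo [loN lox]] := corner_cube xN r1.
exists lo, rho; split => //; first by rewrite rr !ge_min lexx orbT.
move=> y hy; pose v : 'rV[R]_d := \row_i tnth y i.
have tvy : [tuple v ord0 i | i < d] = y.
  by apply: eq_from_tnth => i; rewrite tnth_mktuple mxE.
have : ball v0 r v -> box N (tv v) -> `|g t x (tv v0) - g t x (tv v)| <= e := hr v.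
rewrite tv0 [tv v]tvy distrC; apply; last exact: loN.
split => // i j; rewrite !mxE /ball/= distrC.
apply: (le_lt_trans (lox y hy j)).
by rewrite /rho gt_min; apply/orP; left; rewrite ltr_pdivrMr// ltr_pMr// ltr1n.
Qed.

End corner_cube.

Section tuple_arithmetic.
Context {R : realType}.
Variable d : nat.
Implicit Types x y z : pointR R d.

Lemma measurable_tadd (dT : measure_display) (T : measurableType dT)
    (f g : T -> pointR R d) :
  measurable_fun setT f -> measurable_fun setT g ->
  measurable_fun setT (fun w => tadd (f w) (g w)).
Proof.
move=> /measurable_fun_tnthP mf /measurable_fun_tnthP mg.
apply/measurable_fun_tnthP => i.
rewrite (_ : _ \o _ = (fun w => tnth (f w) i + tnth (g w) i)); last first.
  by apply/funext => w /=; rewrite tnth_mktuple.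
by apply: measurable_funD; [exact: mf|exact: mg].
Qed.

Lemma measurable_tsub (dT : measure_display) (T : measurableType dT)
    (f g : T -> pointR R d) :
  measurable_fun setT f -> measurable_fun setT g ->
  measurable_fun setT (fun w => tsub (f w) (g w)).
Proof.
move=> /measurable_fun_tnthP mf /measurable_fun_tnthP mg.
apply/measurable_fun_tnthP => i.
rewrite (_ : _ \o _ = (fun w => tnth (f w) i - tnth (g w) i)); last first.
  by apply/funext => w /=; rewrite tnth_mktuple.
by apply: measurable_funB; [exact: mf|exact: mg].
Qed.

Lemma tsub0 x : tsub x (tzero R d) = x.
Proof. by apply: eq_from_tnth => i; rewrite !tnth_mktuple subr0. Qed.

Lemma tadd_tsub x y : tadd x (tsub y x) = y.
Proof. by apply: eq_from_tnth => i; rewrite !tnth_mktuple addrC subrK. Qed.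

Lemma taddA x y z : tadd x (tadd y z) = tadd (tadd x y) z.
Proof. by apply: eq_from_tnth => i; rewrite !tnth_mktuple addrA. Qed.

Lemma rect_tadd lo hi x : [set y | rect d lo hi (tadd x y)] =
  rect d (fun i => lo i - nth 0 x i) (fun i => hi i - nth 0 x i).
Proof.
apply/seteqP; split => y h i; have := h i; rewrite /= tnth_mktuple -tnth_nth;
  by rewrite lerBlDl lerBrDl.
Qed.

End tuple_arithmetic.

Section independent_jump.
Context {R : realType} (dO : measure_display) (Omega : measurableType dO).
Variables (P : probability Omega R) (d : nat).
Implicit Types Z W : Omega -> pointR R d.

(* With [Z] the position at the first exit from a box along a grid and [W] the
   subsequent increment, this plays the role of the strong Markov property. *)
Lemma independent_jump_le E Z W (S C : set (pointR R d)) (c : R) :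
  measurable E -> measurable_fun setT Z -> measurable_fun setT W ->
  measurable S -> measurable C ->
  (forall Q A, measurable Q -> measurable A ->
    P (E `&` Z @^-1` Q `&` W @^-1` A) = P (E `&` Z @^-1` Q) * P (W @^-1` A))%E ->
  E `<=` Z @^-1` S ->
  (forall z, S z -> P [set w | C (tadd z (W w))] <= c%:E)%E -> 0 <= c ->
  (P (E `&` [set w | C (tadd (Z w) (W w))]) <= c%:E * P E)%E.
Proof.
move=> mE mZ mW mS mC indep ES Pc c0.
pose PE : {measure set Omega -> \bar R} := mrestr P mE.
have fin_sf (m : {measure set (pointR R d) -> \bar R}) :
    (m setT < +oo)%E -> sigma_finite setT m.
  by move=> h; exists (fun=> setT) => //; rewrite bigcup_const//; exists 0%N.
have [m1 m1E] : exists m : {measure set (pointR R d) -> \bar R},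
    forall A, m A = P (E `&` Z @^-1` A).
  unshelve eexists (pushforward PE Z : {measure set _ -> \bar R}); first exact: mZ.
  by move=> A; rewrite setIC.
have [m2 m2E] : exists m : {measure set (pointR R d) -> \bar R},
    forall A, m A = P (W @^-1` A).
  by unshelve eexists (pushforward P W : {measure set _ -> \bar R}); first exact: mW.
have mZW : measurable_fun setT (fun w => (Z w, W w)) by exact/measurable_fun_pair.
have [m' m'E] : exists m : {measure set (pointR R d * pointR R d) -> \bar R},
    forall A, m A = P (E `&` (fun w => (Z w, W w)) @^-1` A).
  unshelve eexists (pushforward PE (fun w => (Z w, W w)) : {measure set _ -> \bar R}).
    exact: mZW.
  by move=> A; rewrite setIC.
have f1 : (m1 setT < +oo)%E.
  by rewrite m1E (le_lt_trans (probability_le1 _ _)) ?ltry// setIT.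
have f2 : (m2 setT < +oo)%E.
  by rewrite m2E (le_lt_trans (probability_le1 _ _)) ?ltry// preimage_setT.
pose X := [set p : pointR R d * pointR R d | S p.1 /\ C (tadd p.1 p.2)].
have mX : measurable X.
  apply: (@measurableI _ _ [set p | S p.1] [set p | C (tadd p.1 p.2)]).
    by rewrite -[[set p | _]]setTI; exact: (@measurable_fst _ _ _ _ measurableT).
  rewrite -[[set p | _]]setTI.
  have : measurable_fun setT
      (fun p : pointR R d * pointR R d => tadd p.1 p.2).
    by apply: measurable_tadd; [exact: measurable_fst|exact: measurable_snd].
  by move=> /(_ measurableT C mC).
have := @product_measure_unique _ _ _ _ _
  (sigma_finite_copy (fin_sf m1 f1)) (sigma_finite_copy (fin_sf m2 f2)) m' _ X mX.
rewrite [m' X]m'E => mXE.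
have -> : E `&` [set w | C (tadd (Z w) (W w))] =
    E `&` (fun w => (Z w, W w)) @^-1` X.
  by apply/seteqP; split => w [Ew h]; split => //; [split => //; exact: ES|case: h].
rewrite -{}mXE; last first.
  move=> A B mA mB.
  change (m' (A `*` B) = m1 A * m2 B)%E.
  by rewrite m'E m1E m2E -indep// -setIA.
have -> : P E = m1 setT by rewrite m1E preimage_setT setIT.
rewrite -(integral_cst m1 measurableT).
change (\int[m1]_z m2 (xsection X z) <= \int[m1]_(x in setT) (fun=> c%:E) x)%E.
apply: le_integralW => z _; rewrite m2E.
have [Sz|nSz] := pselect (S z).
  rewrite (_ : _ @^-1` _ = [set w | C (tadd z (W w))]); first exact: Pc.
  apply/seteqP; split => w; rewrite /xsection/= inE /X/=; first by case.
  by [].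
rewrite (_ : _ @^-1` _ = set0) ?measure0 ?lee_fin//.
by apply/seteqP; split => w //; rewrite /xsection/= inE /X/= => -[].
Qed.

End independent_jump.

Section brownian_increments.
Context {R : realType} (dO : measure_display) (Omega : measurableType dO).
Variables (P : probability Omega R) (d : nat) (B : R -> Omega -> pointR R d).
Hypothesis brownB : brownian P B.
Variable tau : nat -> R.
Hypotheses (tau0 : tau 0%N = 0).

Definition increment i w := tsub (B (tau i.+1) w) (B (tau i) w).

Definition increment_cylinders j : set (set Omega) :=
  [set E | exists A : nat -> set (pointR R d), (forall i, measurable (A i)) /\
     E = \bigcap_(i in `I_j) (increment i @^-1` A i)].

Let past j := <<s increment_cylinders j >>.

Section fixed_horizon.
Variable j : nat.
Hypothesis tau_incr : forall i, (i < j.+1)%N -> tau i < tau i.+1.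

Lemma tau_ge0 i : (i <= j.+1)%N -> 0 <= tau i.
Proof.
elim: i => [|i IH] ij; first by rewrite tau0.
exact: le_trans (IH (ltnW ij)) (ltW (tau_incr _)).
Qed.

Lemma measurable_increment i : (i <= j)%N -> measurable_fun setT (increment i).
Proof.
have [mB _ _ _] := brownB.
by move=> ij; apply: measurable_tsub; apply: mB; apply: tau_ge0 => //; exact: leqW.
Qed.

Lemma increment_law A : measurable A ->
  P (increment j @^-1` A) = (fine (\int[@lebesgue_tuple R d]_(y in A)
    (heat (tau j.+1 - tau j) (tzero R d) y)%:E))%:E.
Proof.
have [_ _ _ inc] := brownB; move=> mA.
pose t i := if i is 0%N then tau j else tau j.+1.
have := inc 1%N t (fun=> A); rewrite big_ord1/= => <- //.
- congr (P _); apply/seteqP; split => w; first by move=> h [|i].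
  by move=> /(_ 0%N); exact.
- by apply: tau_ge0; exact: leqW.
- by case=> // _; exact: tau_incr.
Qed.

Lemma past_increment_indep E A : past j E -> measurable A ->
  P (E `&` increment j @^-1` A) = (P E * P (increment j @^-1` A))%E.
Proof.
have [_ _ _ inc] := brownB; move=> pE mA.
have mW : measurable (increment j @^-1` A).
  by rewrite -[_ @^-1` _]setTI; apply: measurable_increment.
have p0 : 0 <= fine (P (increment j @^-1` A)) by rewrite fine_ge0// measure_ge0.
pose m1 : {measure set Omega -> \bar R} := mrestr P mW.
pose m2 : {measure set Omega -> \bar R} := mscale (NngNum p0) P.
have Wfin : P (increment j @^-1` A) \is a fin_num by exact: fin_num_measure.
have m2E F : m2 F = (P F * P (increment j @^-1` A))%E.
  by rewrite /m2/= /mscale/= fineK// muleC.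
rewrite -m2E; change (m1 E = m2 E).
apply: (@g_sigma_algebra_measure_unique _ _ _ (increment_cylinders j) _ (fun=> setT)) => //.
- move=> _ [C [mC ->]]; apply: fin_bigcap_measurable; first exact: finite_II.
  move=> i /= ij; rewrite -[_ @^-1` _]setTI; apply: measurable_increment => //.
  exact: ltnW.
- by move=> _; exists (fun=> setT); split => //; apply/seteqP; split.
- by rewrite bigcup_const//; exists 0%N.
- move=> _ _ [C1 [mC1 ->]] [C2 [mC2 ->]]; exists (fun i => C1 i `&` C2 i); split.
    by move=> i; exact: measurableI.
  by rewrite -bigcapI.
- move=> _ [C [mC ->]]; rewrite m2E /m1 /= /mrestr increment_law//.
  have := inc j tau C; rewrite tau0 lexx => ->//; last first.
    by move=> i ij; apply: tau_incr; exact: leqW.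
  have := inc j.+1 tau (fun i => if (i < j)%N then C i else A).
  rewrite tau0 lexx big_ord_recr/= ltnn.
  under eq_bigr do rewrite ltn_ord.
  rewrite EFinM => <-//.
  + congr (P _); apply/seteqP; split => w /=.
      move=> [h1 h2] i /=; rewrite ltnS leq_eqVlt => /orP[/eqP ->|ij].
        by rewrite ltnn.
      by rewrite ij; exact: h1.
    move=> h; split.
      by move=> i /= ij; have := h i; rewrite /= ij; apply; exact: leqW.
    by have := h j; rewrite /= ltnn; exact.
  + by move=> i; case: ifP.
- by move=> _; rewrite /m1/= (le_lt_trans (probability_le1 _ _)) ?ltry// setTI.
Qed.

Lemma past_increment i A : (i < j)%N -> measurable A -> past j (increment i @^-1` A).
Proof.
move=> ij mA; apply: sub_sigma_algebra.
exists (fun l => if l == i then A else setT); split; first by move=> l; case: ifP.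
apply/seteqP; split => w; first by move=> h l _ /=; case: eqP => // ->.
by move=> /(_ i); rewrite /= eqxx; exact.
Qed.

Lemma past_position i Q : (i <= j)%N -> measurable Q -> past j (B (tau i) @^-1` Q).
Proof.
have [_ B0 _ _] := brownB.
pose T := g_sigma_algebraType (increment_cylinders j).
suff h : (i <= j)%N -> measurable_fun setT (B (tau i) : T -> pointR R d).
  by move=> /h mB mQ; have := mB measurableT Q mQ; rewrite setTI.
elim: i => [_|i IH ij].
  rewrite (_ : B (tau 0) = cst (tzero R d)); first exact: measurable_cst.
  by apply/funext => w; rewrite tau0.
rewrite (_ : B (tau i.+1) = (fun w => tadd (B (tau i) w) (increment i w))); last first.
  by apply/funext => w; rewrite /increment tadd_tsub.
apply: (@measurable_tadd R d _ T (B (tau i)) (increment i)); first exact: IH (ltnW ij).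
by move=> _ A mA; rewrite setTI; exact: past_increment.
Qed.

End fixed_horizon.
End brownian_increments.

Section first_exit.
Context {R : realType} (dO : measure_display) (Omega : measurableType dO).
Variables (P : probability Omega R) (d : nat) (B : R -> Omega -> pointR R d).
Hypothesis brownB : brownian P B.
Variables (N : nat) (x : pointR R d) (C : set (pointR R d)) (c : R).
Hypotheses (mC : measurable C) (CN : C `<=` box N) (c_ge0 : 0 <= c).
Hypothesis far : forall z r, ~ box N z -> 0 < r ->
  fine (\int[@lebesgue_tuple R d]_(y in [set y | C (tadd z y)])
    (heat r (tzero R d) y)%:E)%E <= c.

Lemma measurable_shift_path s Q : 0 <= s -> measurable Q ->
  measurable [set w | Q (tadd x (B s w))].
Proof.
have [mB _ _ _] := brownB => s0 mQ.
have : measurable_fun setT (fun w => tadd x (B s w)).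
  by apply: measurable_tadd; [exact: measurable_cst|exact: mB].
by move=> /(_ measurableT Q mQ); rewrite setTI.
Qed.

Section grid.
Variables (h : R) (m : nat).
Hypothesis h_gt0 : 0 < h.

Let pos i w := tadd x (B (h * i%:R) w).

Definition grid_survival n : set Omega := [set w | forall i, (i < n)%N -> box N (pos i w)].

Let exit_at j := grid_survival j `\` [set w | box N (pos j w)].

Let hi_ge0 i : 0 <= h * i%:R. Proof. by rewrite mulr_ge0// ltW. Qed.

Lemma measurable_grid_survival n : measurable (grid_survival n).
Proof.
rewrite (_ : grid_survival n = \bigcap_(i in `I_n) [set w | box N (pos i w)]); last first.
  by apply/seteqP; split.
apply: fin_bigcap_measurable; first exact: finite_II.
by move=> i _; apply: measurable_shift_path => //; exact: measurable_box.
Qed.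

Let measurable_exit j : measurable (exit_at j).
Proof.
apply: measurableD; first exact: measurable_grid_survival.
by apply: measurable_shift_path => //; exact: measurable_box.
Qed.

Let exit_le j : (j < m)%N ->
  (P (exit_at j `&` [set w | C (pos m w)]) <= c%:E * P (exit_at j))%E.
Proof.
move=> jm; pose tau i := if (i <= j)%N then h * i%:R else h * m%:R.
have tau0 : tau 0%N = 0 by rewrite /tau leq0n mulr0.
have tau_incr i : (i < j.+1)%N -> tau i < tau i.+1.
  rewrite /tau ltnS => ij; rewrite ij; case: ifP => _.
    by rewrite ltr_pM2l// ltr_nat.
  by rewrite ltr_pM2l// ltr_nat; exact: leq_ltn_trans jm.
have tauj : tau j = h * j%:R by rewrite /tau leqnn.
have tauj1 : tau j.+1 = h * m%:R by rewrite /tau ltnn.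
have pastbox i : (i <= j)%N ->
    <<s increment_cylinders B tau j >> [set w | box N (pos i w)].
  move=> ij; have -> : [set w | box N (pos i w)] =
      B (tau i) @^-1` [set y | box N (tadd x y)] by rewrite /tau ij.
  apply: (past_position brownB tau0) => //.
  by rewrite box_rect rect_tadd; exact: measurable_rect.
have pastexit : <<s increment_cylinders B tau j >> (exit_at j).
  pose T := g_sigma_algebraType (increment_cylinders B tau j).
  suff : measurable (exit_at j : set T) by [].
  apply: measurableD; last exact: pastbox.
  rewrite (_ : grid_survival j = \bigcap_(i in `I_j) [set w | box N (pos i w)]); last first.
    by apply/seteqP; split.
  apply: fin_bigcap_measurable; first exact: finite_II.
  by move=> i ij; apply: pastbox; exact: ltnW.
have posE w : pos m w = tadd (pos j w) (increment B tau j w).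
  by rewrite /pos /increment tauj tauj1 -taddA tadd_tsub.
rewrite (_ : [set w | C (pos m w)] =
  [set w | C (tadd (pos j w) (increment B tau j w))]); last first.
  by apply/seteqP; split => w /=; rewrite posE.
have [mB _ _ _] := brownB.
apply: (@independent_jump_le _ _ _ _ _ _ (pos j) _ (~` box N)) => //.
- by apply: measurable_tadd; [exact: measurable_cst|exact: mB].
- exact: (measurable_increment brownB tau0 tau_incr).
- by apply: measurableC; exact: measurable_box.
- move=> Q A mQ mA; apply: (past_increment_indep brownB tau0 tau_incr) => //.
  pose T := g_sigma_algebraType (increment_cylinders B tau j).
  suff : measurable ((exit_at j `&` pos j @^-1` Q) : set T) by [].
  apply: measurableI => //.
  have -> : pos j @^-1` Q = B (tau j) @^-1` [set y | Q (tadd x y)] by rewrite tauj.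
  apply: (past_position brownB tau0) => //.
  have : measurable_fun setT (fun y : pointR R d => tadd x y).
    by apply: measurable_tadd; [exact: measurable_cst|exact: measurable_id].
  by move=> /(_ measurableT Q mQ); rewrite setTI.
- by move=> w [].
- move=> z zN; have mz : measurable [set y | C (tadd z y)].
    have : measurable_fun setT (fun y : pointR R d => tadd z y).
      by apply: measurable_tadd; [exact: measurable_cst|exact: measurable_id].
    by move=> /(_ measurableT C mC); rewrite setTI.
  have := increment_law brownB tau0 tau_incr mz.
  rewrite /preimage/= => ->; rewrite lee_fin; apply: far => //.
  by rewrite subr_gt0; exact: tau_incr.
Qed.

Lemma grid_survival_ge :
  (P [set w | C (pos m w)] <=
   P ([set w | C (pos m w)] `&` grid_survival m.+1) + c%:E)%E.
Proof.
have mCm : measurable [set w | C (pos m w)] by exact: measurable_shift_path.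
have mEC j : measurable (exit_at j `&` [set w | C (pos m w)]) by exact: measurableI.
have mK : measurable ([set w | C (pos m w)] `&` grid_survival m.+1).
  by apply: measurableI => //; exact: measurable_grid_survival.
have mU : measurable (\big[setU/set0]_(j < m) (exit_at j `&` [set w | C (pos m w)])).
  by apply: bigsetU_measurable => j _.
apply: (@le_trans _ _ (P (([set w | C (pos m w)] `&` grid_survival m.+1) `|`
    \big[setU/set0]_(j < m) (exit_at j `&` [set w | C (pos m w)])))).
  apply: le_measure; rewrite ?inE//; first exact: measurableU.
  move=> w Cw; have [hw|nw] := pselect (grid_survival m.+1 w); first by left.
  right.
  have ex : exists i, (i <= m)%N && ~~ `[< box N (pos i w) >].
    apply: contra_notP nw => /forallNP nw i; rewrite ltnS => im.
    by apply/asboolP; apply: contra_notT (nw i) => nb; rewrite im.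
  have [i /andP[im /asboolP ni] imin] := ex_minnP ex.
  have ltim : (i < m)%N.
    rewrite ltn_neqAle im andbT; apply/eqP => iE; apply: ni.
    by rewrite iE; exact: CN.
  rewrite -(bigcup_mkord m (fun j => exit_at j `&` [set w | C (pos m w)])); exists i => //; split => //; split => // l li.
  apply: contrapT => nl; have := imin l; rewrite (ltnW (ltn_trans li ltim)).
  by rewrite asboolF// => /(_ isT); rewrite leqNgt li.
apply: le_trans (measureU2 _ mK mU) _; rewrite leeD2l//.
apply: (@le_trans _ _ (\sum_(j < m) P (exit_at j `&` [set w | C (pos m w)])))%E.
  exact: (@Boole_inequality _ _ _ P (fun j => exit_at j `&` [set w | C (pos m w)]) m).
apply: (@le_trans _ _ (\sum_(j < m) (c%:E * P (exit_at j))))%E.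
  by apply: lee_sum => j _; exact: exit_le.
rewrite -ge0_sume_distrr; last by move=> j _; exact: measure_ge0.
rewrite -(measure_bigsetU P); last 2 first.
- by [].
- move=> i j _ _ [w [[si ei] [sj ej]]].
  by case: (ltngtP i j) => // ij; exfalso; [apply: ei; exact: sj|apply: ej; exact: si].
rewrite -[leRHS]mule1 lee_wpmul2l ?lee_fin//.
by apply: probability_le1; exact: bigsetU_measurable.
Qed.

End grid.
End first_exit.

Section survival.
Context {R : realType} (dO : measure_display) (Omega : measurableType dO).
Variables (P : probability Omega R) (d : nat) (B : R -> Omega -> pointR R d).
Hypothesis brownB : brownian P B.
Variables (N : nat) (x : pointR R d) (C : set (pointR R d)) (c : R).
Hypotheses (mC : measurable C) (CN : C `<=` box N) (c_ge0 : 0 <= c).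
Hypothesis far : forall z r, ~ box N z -> 0 < r ->
  fine (\int[@lebesgue_tuple R d]_(y in [set y | C (tadd z y)])
    (heat r (tzero R d) y)%:E)%E <= c.

Let survival t := [set w | C (tadd x (B t w)) /\
  forall s, 0 <= s <= t -> box N (tadd x (B s w))].

Let dyadic t n : set Omega := [set w | C (tadd x (B t w))] `&`
  grid_survival B N x (t / (2 ^ n)%:R) (2 ^ n).+1.

Let step_gt0 (t : R) n : 0 < t -> 0 < t / (2 ^ n)%:R.
Proof. by move=> t0; rewrite divr_gt0// ltr0n expn_gt0. Qed.

Let step_top (t : R) n : t / (2 ^ n)%:R * (2 ^ n)%:R = t.
Proof. by rewrite divfK// pnatr_eq0 -lt0n expn_gt0. Qed.

Let survivalE t : 0 < t -> survival t = \bigcap_n dyadic t n.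
Proof.
have [_ _ cB _] := brownB.
move=> t0; apply/seteqP; split => w.
  move=> [Cw sw] n _; split => // i im; apply: sw.
  rewrite mulr_ge0// ?(ltW (step_gt0 n t0))//= -[leRHS](step_top t n).
  by rewrite ler_pM2l ?step_gt0// ler_nat -ltnS.
move=> hw; split; first by have [] := hw 0%N I.
move=> s /andP[s0 st] i; rewrite tnth_mktuple leNgt; apply/negP => Ns.
have := cB w i; move/subspace_continuousP => /(_ s).
rewrite /= in_itv/= andbT => /(_ s0)/cvgrPdist_lt.
rewrite -subr_gt0 in Ns => /(_ _ Ns).
rewrite near_withinE => /nbhs_ballP[r /= r0 hr].
pose n := (Num.truncn (t / r)).+1; pose h : R := t / (2 ^ n)%:R.
have h0 : 0 < h by exact: step_gt0.
have hr' : h < r.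
  rewrite /h ltr_pdivrMr ?ltr0n ?expn_gt0// mulrC -ltr_pdivrMr//.
  apply: (@lt_trans _ _ n%:R); last by rewrite ltr_nat ltn_expl.
  by have /andP[] := truncn_itv (divr_ge0 (ltW t0) (ltW r0)).
pose k := Num.truncn (s / h).
have /andP[k1 k2] := truncn_itv (divr_ge0 s0 (ltW h0)).
rewrite -/k in k1 k2.
have hk1 : h * k%:R <= s by rewrite mulrC -ler_pdivlMr.
have hk2 : s < h * k%:R + h.
  by rewrite -[X in _ + X]mulr1 -mulrDr natr1 mulrC -ltr_pdivrMr.
have kn : (k < (2 ^ n).+1)%N.
  rewrite ltnS -(ler_nat R); apply: le_trans k1 _.
  by rewrite ler_pdivrMr// mulrC step_top.
have hk0 : 0 <= h * k%:R by rewrite mulr_ge0// ltW.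
have := hr (h * k%:R); rewrite /ball/= in_itv/= andbT => hrk.
have {hrk} : `|tnth (B s w) i - tnth (B (h * k%:R) w) i| <
    `|tnth x i + tnth (B s w) i| - N%:R.
  apply: hrk => //; rewrite ger0_norm ?subr_ge0//.
  by apply: lt_trans hr'; rewrite ltrBlDl.
have [_ /(_ k kn i)] := hw n I; rewrite tnth_mktuple -/h.
move: (tnth (B s w) i) (tnth (B (h * k%:R) w) i) (tnth x i) => u v y h1.
rewrite ltrBrDr ltNge => /negP; apply.
rewrite (_ : y + u = (u - v) + (y + v)); last by ring.
by apply: le_trans (ler_normD _ _) _; rewrite lerD2l.
Qed.

Lemma measurable_survival t : 0 < t -> measurable (survival t).
Proof.
move=> t0; rewrite survivalE//; apply: bigcapT_measurable => n.
apply: measurableI; first by apply: (measurable_shift_path brownB) => //; exact: ltW.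
by apply: (measurable_grid_survival brownB); exact: step_gt0.
Qed.

Lemma survival_ge t : 0 < t ->
  (P [set w | C (tadd x (B t w))] <= P (survival t) + c%:E)%E.
Proof.
move=> t0.
have mD n : measurable (dyadic t n).
  apply: measurableI; first by apply: (measurable_shift_path brownB) => //; exact: ltW.
  by apply: (measurable_grid_survival brownB); exact: step_gt0.
have cvgD : (P \o dyadic t) @ \oo --> P (survival t).
  rewrite survivalE//; apply: nonincreasing_cvg_mu => //.
  - by rewrite (le_lt_trans (probability_le1 _ _)) ?ltry.
  - by rewrite -survivalE//; exact: measurable_survival.
  - apply/nonincreasing_seqP => n; apply/subsetPset => w [Cw hw]; split => // i im.
    have := hw (2 * i)%N; rewrite expnS ltnS leq_mul2l/= => /(_ im).
    suff -> : t / (2 * 2 ^ n)%:R * (2 * i)%:R = t / (2 ^ n)%:R * i%:R by [].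
    rewrite !natrM; field; rewrite ?pnatr_eq0 -?lt0n ?expn_gt0//.
have step n : (P [set w | C (tadd x (B t w))] - c%:E <= P (dyadic t n))%E.
  rewrite leeBlDr//.
  have := grid_survival_ge brownB x mC CN c_ge0 far (2 ^ n) (step_gt0 n t0).
  by rewrite /= step_top.
have := lime_ge (cvgP _ cvgD) (nearW _ step).
rewrite (cvg_lim _ cvgD)//.
by rewrite leeBlDr//; apply.
Qed.

End survival.

Section killed_diagonal.
Context {R : realType}.
Variables (d N : nat) (g : R -> pointR R d -> pointR R d -> R).
Hypotheses (d_gt0 : (0 < d)%N) (N_gt0 : (0 < N)%N) (kg : killed_density N g).

Lemma brownian_law (dO : measure_display) (Omega : measurableType dO)
    (P : probability Omega R) (B : R -> Omega -> pointR R d) t A :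
  brownian P B -> 0 < t -> measurable A ->
  P [set w | A (B t w)] =
    (fine (\int[@lebesgue_tuple R d]_(y in A) (heat t (tzero R d) y)%:E))%:E.
Proof.
move=> [_ B0 _ inc] t0 mA.
have := inc 1%N (fun i => if i is 0%N then 0 else t) (fun=> A).
rewrite big_ord1/= subr0 => <-//; last by case.
congr (P _); apply/seteqP; split => w.
  by move=> h [|i]//= _; rewrite B0 tsub0.
by move=> /(_ 0%N); rewrite /= B0 tsub0; exact.
Qed.

Let shift_rect_le (x : pointR R d) (lo : nat -> R) (rho : R) : 0 < rho ->
  forall i, lo i - nth 0 x i <= lo i + rho - nth 0 x i.
Proof. by move=> r0 i; rewrite lerD2r lerDl ltW. Qed.

Let shift_rect_vol (x : pointR R d) (lo : nat -> R) (rho : R) :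
  \prod_(i < d) (lo i + rho - nth 0 x i - (lo i - nth 0 x i)) = rho ^+ d.
Proof.
transitivity (\prod_(i < d) rho); last by rewrite prodr_const card_ord.
by apply: eq_bigr => i _; ring.
Qed.

Let heat_shift_le t (x : pointR R d) lo rho c : 0 < rho -> 0 <= c ->
  (forall y, rect d lo (fun i => lo i + rho) (tadd x y) -> heat t (tzero R d) y <= c) ->
  fine (\int[@lebesgue_tuple R d]_(y in [set y |
    rect d lo (fun i => lo i + rho) (tadd x y)]) (heat t (tzero R d) y)%:E) <=
  c * rho ^+ d.
Proof.
move=> r0 c0 hc; rewrite rect_tadd -(shift_rect_vol x lo rho).
have := integral_rect_le (shift_rect_le x lo r0) (f := heat t (tzero R d)) (c := c).
rewrite -rect_tadd => /(_ hc) h; rewrite -lee_fin fineK//.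
rewrite ge0_fin_numE; first by apply: le_lt_trans h _; rewrite ltry.
by apply: integral_ge0 => y _; rewrite lee_fin heat_ge0.
Qed.

Let heat_shift_ge t (x : pointR R d) lo rho c c' : 0 < rho -> 0 <= c' ->
  (forall y, rect d lo (fun i => lo i + rho) (tadd x y) ->
     c <= heat t (tzero R d) y <= c') ->
  c * rho ^+ d <= fine (\int[@lebesgue_tuple R d]_(y in [set y |
    rect d lo (fun i => lo i + rho) (tadd x y)]) (heat t (tzero R d) y)%:E).
Proof.
move=> r0 c0 hc; rewrite rect_tadd -(shift_rect_vol x lo rho).
have := integral_rect_ge (shift_rect_le x lo r0) (f := heat t (tzero R d)) (c := c).
have := integral_rect_le (shift_rect_le x lo r0) (f := heat t (tzero R d)) (c := c').
rewrite -rect_tadd => h' h.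
have {}h : (_ <= _)%E := h (fun y hy => proj1 (andP (hc y hy))).
have {}h' : (_ <= _)%E := h' (fun y hy => proj2 (andP (hc y hy))).
rewrite -lee_fin fineK//.
rewrite ge0_fin_numE; first by apply: le_lt_trans h' _; rewrite ltry.
by apply: integral_ge0 => y _; rewrite lee_fin heat_ge0.
Qed.

Let vol_rect (lo : nat -> R) (rho : R) : \prod_(i < d) (lo i + rho - lo i) = rho ^+ d.
Proof.
transitivity (\prod_(i < d) rho); last by rewrite prodr_const card_ord.
by apply: eq_bigr => i _; ring.
Qed.

Let int_g_bounds t x (lo : nat -> R) rho e : 0 < rho ->
  (forall y, rect d lo (fun i => lo i + rho) y -> `|g t x y - g t x x| <= e) ->
  (((g t x x - e) * rho ^+ d)%:E <=
     \int[@lebesgue_tuple R d]_(y in rect d lo (fun i => lo i + rho)%R) (g t x y)%:E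
   <= ((g t x x + e) * rho ^+ d)%:E)%E.
Proof.
move=> r0 ge; have lohi i : lo i <= lo i + rho by rewrite lerDl ltW.
rewrite -(vol_rect lo rho); apply/andP; split.
  apply: (integral_rect_ge (f := g t x)) => // y /ge.
  by rewrite ler_norml lerBrDl => /andP[]; rewrite addrC.
apply: (integral_rect_le (f := g t x)) => // y /ge.
by rewrite ler_norml lerBlDl => /andP[].
Qed.

Lemma killed_diag_ge0 t x : 0 < t -> box N x -> 0 <= g t x x.
Proof.
move=> t0 xN; have [dO [ Omega [P [B [_ /(_ t x t0 xN)[gc gP]]]]]] := kg.
apply/ler_addgt0Pr => e e0.
have [lo [rho [/andP[r0 _] loN _ ge]]] := killed_density_corner N_gt0 gc xN e0 ltr01.
have /andP[_ h] := int_g_bounds r0 ge.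
have : (0 <= ((g t x x + e) * rho ^+ d)%:E)%E.
  by apply: le_trans h; rewrite -gP//; exact: measurable_rect.
by rewrite lee_fin pmulr_lge0// exprn_gt0.
Qed.

Lemma killed_diag_le t x : 0 < t -> box N x ->
  g t x x <= (4 * pi * t) `^ (- (d%:R / 2)).
Proof.
move=> t0 xN; have [dO [ Omega [P [B [brownB /(_ t x t0 xN)[gc gP]]]]]] := kg.
have [mB B0 cB _] := brownB.
apply/ler_addgt0Pr => e e0.
have [lo [rho [/andP[r0 _] loN _ ge]]] := killed_density_corner N_gt0 gc xN e0 ltr01.
have /andP[h _] := int_g_bounds r0 ge.
have mC : measurable (rect d lo (fun i => lo i + rho)) by exact: measurable_rect.
have : (((g t x x - e) * rho ^+ d)%:E <=
    ((4 * pi * t) `^ (- (d%:R / 2)) * rho ^+ d)%:E)%E.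
  apply: le_trans h _; rewrite -gP//.
  apply: (@le_trans _ _ (P [set w | rect d lo (fun i => lo i + rho) (tadd x (B t w))])).
    apply: le_measure; rewrite ?inE; last by move=> w [].
    - by apply: (measurable_survival brownB).
    - by apply: (measurable_shift_path brownB) => //; exact: ltW.
  rewrite (brownian_law (A := [set y | rect d lo (fun i => lo i + rho) (tadd x y)]) brownB t0).
    rewrite lee_fin; apply: heat_shift_le => // [|y _]; first exact: powR_ge0.
    exact: heat_le_diag.
  by rewrite rect_tadd; exact: measurable_rect.
by rewrite lee_fin ler_pM2r ?exprn_gt0// lerBlDr.
Qed.

Lemma killed_diag_ge t x M : 0 < t -> (0 < M)%N -> (M.+1 <= N)%N -> box (N - M.+1) x ->
  (4 * pi * t) `^ (- (d%:R / 2)) - far_heat d M%:R <= g t x x.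
Proof.
move=> t0 M0 MN xM.
have natN : (N - M.+1)%:R = N%:R - M%:R - 1 :> R.
  by rewrite natrB// -natr1 opprD addrA.
have xN : box N x.
  by move=> i; apply: le_trans (xM i) _; rewrite ler_nat leq_subr.
have [dO [ Omega [P [B [brownB /(_ t x t0 xN)[gc gP]]]]]] := kg.
have [mB B0 cB _] := brownB.
set h0 := _ `^ _; have h00 : 0 <= h0 by exact: powR_ge0.
apply/ler_addgt0Pr => e e0; have e2 : 0 < e / 2 by rewrite divr_gt0.
pose K := h0 * d%:R / (4 * t); have K0 : 0 <= K.
  by rewrite /K !mulr_ge0// invr_ge0 mulr_ge0// ltW.
pose r0 := Num.min 1 (e / 2 / (K + 1)).
have K1 : 0 < K + 1 by rewrite ltr_wpDl.
have r00 : 0 < r0 by rewrite lt_min ltr01 divr_gt0.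
have [lo [rho [/andP[rp rr0] loN lox ge]]] := killed_density_corner N_gt0 gc xN e2 r00.
have r1 : rho <= 1 by apply: le_trans rr0 _; rewrite ge_min lexx.
have Kr : h0 * (d%:R * rho ^+ 2 / (4 * t)) <= e / 2.
  have -> : h0 * (d%:R * rho ^+ 2 / (4 * t)) = K * rho ^+ 2.
    by rewrite /K; field; rewrite gt_eqF.
  have rK : rho * (K + 1) <= e / 2.
    by rewrite -ler_pdivlMr//; apply: le_trans rr0 _; rewrite ge_min lexx orbT.
  have : K * rho ^+ 2 <= K * rho by rewrite ler_wpM2l// expr2 ler_piMl// ltW.
  by lra.
have /andP[_ h] := int_g_bounds rp ge.
set C := rect d lo _ in loN lox ge h.
have mC : measurable C by exact: measurable_rect.
have farC z r : ~ box N z -> 0 < r ->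
    fine (\int[@lebesgue_tuple R d]_(y in [set y | C (tadd z y)])
      (heat r (tzero R d) y)%:E)%E <= far_heat d M%:R * rho ^+ d.
  move=> zN rr; apply: heat_shift_le => //; first exact: powR_ge0.
  move=> y Cy; apply: heat_le_far; rewrite ?ltr0n//.
  have [i zi] : exists i, N%:R < `|tnth z i|.
    apply: contrapT => /forallNP nz; apply: zN => i.
    by rewrite leNgt; apply/negP; exact: nz.
  apply: le_trans (sqdist_ge (tzero R d) y i).
  have := lox _ Cy i; have := xM i; rewrite natN !tnth_mktuple.
  move: zi r1; move: (tnth z i) (tnth y i) (tnth x i) => u v w zi r1 hw hv.
  rewrite sub0r sqrrN -[leRHS]real_normK ?num_real// lerXn2r ?nnegrE//.
  have h1 : `|u| <= `|v| + (`|u + v - w| + `|w|).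
    rewrite (_ : u = - v + ((u + v - w) + w)); last by ring.
    apply: le_trans (ler_normD _ _) _; rewrite normrN lerD//.
      by rewrite (_ : - v + (u + v - w + w) + v - w = u + v - w) ?ler_normD//; ring.
  move: h1 zi hw hv r1; move: `|u| `|v| `|w| `|u + v - w| (N%:R : R) (M%:R : R) => *; lra.
have f0 : 0 <= far_heat d M%:R * rho ^+ d.
  by rewrite mulr_ge0 ?exprn_ge0 ?powR_ge0// ltW.
have := survival_ge brownB x mC loN f0 farC t0.
rewrite (gP C mC loN).
rewrite (brownian_law (A := [set y | C (tadd x y)]) brownB t0); last first.
  by rewrite /C rect_tadd; exact: measurable_rect.
have lowC : h0 * (1 - d%:R * rho ^+ 2 / (4 * t)) * rho ^+ d <=
    fine (\int[@lebesgue_tuple R d]_(y in [set y | C (tadd x y)])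
      (heat t (tzero R d) y)%:E)%E.
  apply: (heat_shift_ge (c' := h0)) => // y Cy; apply/andP; split; last exact: heat_le_diag.
  apply: heat_ge_diag => //; rewrite /sqdist.
  rewrite (_ : d%:R * rho ^+ 2 = \sum_(i < d) rho ^+ 2); last first.
    by rewrite sumr_const card_ord mulr_natl.
  apply: ler_sum => i _; have := lox _ Cy i; rewrite !tnth_mktuple addrC addKr sub0r sqrrN => hy.
  by rewrite -[leLHS]real_normK ?num_real// lerXn2r ?nnegrE// ltW.
move=> hP.
have : (((h0 * (1 - d%:R * rho ^+ 2 / (4 * t)) * rho ^+ d)%:E <=
    ((g t x x + e / 2) * rho ^+ d)%:E + (far_heat d M%:R * rho ^+ d)%:E)%E).
  by apply: le_trans (le_trans hP (leeD2r _ h)); rewrite lee_fin.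
rewrite -EFinD lee_fin -mulrDl ler_pM2r ?exprn_gt0//.
move: Kr; rewrite mulrBr mulr1; move: (h0 * _) (far_heat _ _) (g t x x) => *; lra.
Qed.

End killed_diagonal.

Section dirichlet_weights.
Context {R : realType}.
Variables (d : nat) (beta alpha : R) (gDir : nat -> R -> pointR R d -> pointR R d -> R).
Hypotheses (d_gt0 : (0 < d)%N) (beta_gt0 : 0 < beta).
Hypothesis kg : forall N, (0 < N)%N -> killed_density N (gDir N).

Let w k : R := expR (beta * alpha * k.+1%:R) / k.+1%:R.
Let h0 k : R := (4 * pi * (k.+1%:R * beta)) `^ (- (d%:R / 2)).
Let qDir N k := q_cut N beta alpha (fun t (x : pointR R d) => (gDir N t x x)%:E) k.+1.
Let intDir N k := (\int[@lebesgue_tuple R d]_(x in box N)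
  (gDir N (k.+1%:R * beta)%R x x)%:E)%E.

Let w_ge0 k : 0 <= w k. Proof. by rewrite divr_ge0 ?expR_ge0. Qed.

Let time_gt0 k : 0 < k.+1%:R * beta. Proof. by rewrite mulr_gt0. Qed.

Let intDir_ge0 N k : (0 < N)%N -> (0 <= intDir N k)%E.
Proof.
by move=> N0; apply: integral_ge0 => x xN; rewrite lee_fin (killed_diag_ge0 N0 (kg N0)).
Qed.

Let intDir_le N k : (0 < N)%N -> (intDir N k <= (h0 k * vol R d N)%:E)%E.
Proof.
move=> N0; rewrite EFinM -lebesgue_tuple_box.
rewrite -(integral_cst (lebesgue_tuple (d := d)) (measurable_box N) (h0 k)%:E).
by apply: le_integralW => x xN; rewrite lee_fin (killed_diag_le N0 (kg N0)).
Qed.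

Let intDir_fin N k : (0 < N)%N -> intDir N k \is a fin_num.
Proof.
move=> N0; rewrite ge0_fin_numE ?intDir_ge0//.
by apply: le_lt_trans (intDir_le k N0) _; rewrite ltry.
Qed.

Let qDirE N k : (k < N)%N -> qDir N k = w k * (fine (intDir N k) / vol R d N).
Proof.
move=> kN; rewrite /qDir /q_cut kN -/(intDir N k) /w invfM; ring.
Qed.

Lemma q_dir_bounds N k : (k < N)%N -> 0 <= qDir N k <= q d beta alpha k.+1.
Proof.
move=> kN; have N0 : (0 < N)%N by exact: leq_ltn_trans kN.
have V0 := vol_gt0 (R := R) d N0; rewrite qDirE// q_heat// -/(w k) -/(h0 k).
rewrite mulr_ge0 ?divr_ge0 ?fine_ge0 ?intDir_ge0 ?(ltW V0)//=.
rewrite ler_wpM2l// ler_pdivrMr// -lee_fin fineK ?intDir_fin//; exact: intDir_le.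
Qed.

Let qDir_ge N M k : (k < N)%N -> (0 < M)%N -> (M < N)%N -> far_heat d M%:R <= h0 k ->
  w k * ((h0 k - far_heat d M%:R) * (vol R d (N - M.+1) / vol R d N)) <= qDir N k.
Proof.
move=> kN M0 MN farh; have N0 : (0 < N)%N by exact: leq_ltn_trans kN.
have V0 := vol_gt0 (R := R) d N0; rewrite qDirE// ler_wpM2l// mulrA.
rewrite ler_pM2r ?invr_gt0// -lee_fin fineK ?intDir_fin//.
rewrite EFinM -lebesgue_tuple_box -(integral_cst (lebesgue_tuple (d := d)) (measurable_box (N - M.+1))).
rewrite [leLHS]integral_mkcond /intDir [leRHS]integral_mkcond; apply: le_integralW => x _.
rewrite !patchE; case: ifPn => xM.
  have xN : x \in (box N : set (pointR R d)).
    move: xM; rewrite !inE => xM i; apply: le_trans (xM i) _.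
    by rewrite ler_nat leq_subr.
  by rewrite xN lee_fin (killed_diag_ge d_gt0 N0 (kg N0))//; move: xM; rewrite inE.
case: ifPn => //; rewrite inE => xN.
by rewrite lee_fin (killed_diag_ge0 N0 (kg N0)).
Qed.

Let vol_ratio_cvg M : vol R d (N - M) / vol R d N @[N --> \oo] --> (1 : R).
Proof.
have h : (fun N : nat => 1 - M%:R * N%:R^-1 : R) @ \oo --> (1 : R).
  rewrite -[X in _ --> X]subr0 -[X in _ - X](mulr0 M%:R).
  apply: cvgB; first exact: cvg_cst.
  apply: cvgM; first exact: cvg_cst.
  apply/gtr0_cvgV0; last exact: cvgr_idn.
  by near=> N; rewrite ltr0n; near: N; exists 1%N.
have hd : (fun N : nat => (1 - M%:R * N%:R^-1) ^+ d : R) @ \oo --> (1 : R).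
  rewrite -[X in _ --> X](expr1n _ d).
  exact: (continuous_cvg (F := \oo) _ (@exprn_continuous R d 1) h).
apply: cvg_trans hd; apply: near_eq_cvg; near=> N.
have MN : (M < N)%N by near: N; exists M.+1.
have N0 : N%:R != 0 :> R by rewrite pnatr_eq0 -lt0n (leq_ltn_trans _ MN).
rewrite /vol -expr_div_n natrB ?(ltnW MN)//; congr (_ ^+ _).
by field.
Unshelve. all: by end_near. Qed.

Lemma q_dir_cvg k : qDir N k @[N --> \oo] --> q d beta alpha k.+1.
Proof.
rewrite q_heat// -/(w k) -/(h0 k); apply/cvgrPdist_le => e e0.
have h00 : 0 < h0 k by rewrite powR_gt0// !mulr_gt0// pi_gt0.
pose e' := Num.min (h0 k) (e / 2 / (w k + 1)).
have w1 : 0 < w k + 1 by rewrite ltr_wpDl.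
have e'0 : 0 < e' by rewrite lt_min h00 !divr_gt0.
have [M [M0 Me]] : exists M, (0 < M)%N /\ far_heat d M%:R <= e'.
  have /cvgrPdist_le /(_ _ e'0) [M0 _ hM] := cvg_far_heat (R := R) d_gt0.
  exists M0.+1; split => //; have := hM M0.+1 (leqnSn _).
  by rewrite /= sub0r normrN ger0_norm ?powR_ge0.
have Mh : far_heat d M%:R <= h0 k by apply: le_trans Me _; rewrite ge_min lexx.
have Mw : w k * far_heat d M%:R <= e / 2.
  have : far_heat d M%:R * (w k + 1) <= e / 2.
    by rewrite -ler_pdivlMr//; apply: le_trans Me _; rewrite ge_min lexx orbT.
  by have : 0 <= far_heat d M%:R :> R := powR_ge0 _ _; lra.
have low : w k * ((h0 k - far_heat d M%:R) * (vol R d (N - M.+1) / vol R d N))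
    @[N --> \oo] --> w k * ((h0 k - far_heat d M%:R) * 1).
  by do 2![apply: cvgM; first exact: cvg_cst]; exact: vol_ratio_cvg.
have e20 : 0 < e / 2 by rewrite divr_gt0.
move/cvgrPdist_le: low => /(_ _ e20) low.
near=> N.
have kN : (k < N)%N by near: N; exists k.+1.
have MN : (M < N)%N by near: N; exists M.+1.
have /andP[_ up] := q_dir_bounds kN; rewrite q_heat// -/(w k) -/(h0 k) in up.
rewrite ger0_norm ?subr_ge0//.
have := qDir_ge kN M0 MN Mh.
have : `|w k * ((h0 k - far_heat d M%:R) * 1) -
  w k * ((h0 k - far_heat d M%:R) * (vol R d (N - M.+1) / vol R d N))| <= e / 2.
  by near: N.
move=> /(le_trans (ler_norm _)); rewrite mulr1 mulrBr.
set u := w k * ((h0 k - _) * _); move: Mw.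
move: (w k * far_heat d M%:R) (w k * h0 k) u (qDir N k) => *; lra.
Unshelve. all: by end_near. Qed.

End dirichlet_weights.

Section boundary_conditions.
Context {R : realType}.
Variables (d : nat) (beta alpha : R) (bc : bcond).
Variable gDir : nat -> R -> pointR R d -> pointR R d -> R.
Hypotheses (d_gt0 : (0 < d)%N) (beta_gt0 : 0 < beta).
Hypothesis kg : bc = Dir -> forall N, (0 < N)%N -> killed_density N (gDir N).

Let r N k := q_bc bc N (gDir N) beta alpha k.+1.

Let q_cut_ge N (g : R -> pointR R d -> \bar R) k : (N <= k)%N ->
  q_cut N beta alpha g k.+1 = 0.
Proof. by move=> Nk; rewrite /q_cut ltnNge Nk. Qed.

Lemma q_bc_ge0 N k : (0 < N)%N -> 0 <= r N k.
Proof.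
move=> N0; have q0 := ltW (q_gt0 d beta_gt0 alpha k).
have [Nk|kN] := leqP N k; rewrite /r /q_bc; move: kg; case: bc => // kg'.
- by rewrite q_cut_ge.
- by rewrite q_cut_ge.
- by have /andP[+ _] := q_per_bounds d alpha beta_gt0 kN; exact: le_trans.
- by have /andP[] := q_dir_bounds alpha beta_gt0 (kg' erefl) kN.
Qed.

Let rho N : R := if bc is Per then per_bound d beta N else 1.

Lemma q_bc_le : rho @ \oo --> (1 : R) /\
  \forall N \near \oo, forall k, r N k <= rho N * q d beta alpha k.+1.
Proof.
split; first by rewrite /rho; case: bc; try exact: cvg_cst; exact: cvg_per_bound.
near=> N => k; have N0 : (0 < N)%N by near: N; exists 1%N.
have q0 := ltW (q_gt0 d beta_gt0 alpha k).
rewrite /r /q_bc /rho; have [Nk|kN] := leqP N k; move: kg; case: bc => kg';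
  rewrite ?mul1r//.
- rewrite q_cut_ge// mulr_ge0//; apply: exprn_ge0.
  apply: divr_ge0; first by rewrite addr_ge0 ?expR_ge0.
  by rewrite subr_ge0 expR_le1 oppr_le0 divr_ge0// ltW.
- by rewrite q_cut_ge.
- by have /andP[] := q_per_bounds d alpha beta_gt0 kN.
- by have /andP[] := q_dir_bounds alpha beta_gt0 (kg' erefl) kN.
Unshelve. all: by end_near. Qed.

Lemma q_bc_cvg k : r N k @[N --> \oo] --> q d beta alpha k.+1.
Proof.
move: kg; rewrite /r /q_bc; case: bc => kg'; first exact: cvg_cst.
- have h : per_bound d beta N * q d beta alpha k.+1 @[N --> \oo] --> q d beta alpha k.+1.
    rewrite -[X in _ --> X]mul1r; apply: cvgM; last exact: cvg_cst.
    exact: cvg_per_bound.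
  apply: (squeeze_cvgr _ (cvg_cst _) h); near=> N.
  have kN : (k < N)%N by near: N; exists k.+1.
  exact: (q_per_bounds d alpha beta_gt0 kN).
- exact: q_dir_cvg (kg' erefl) k.
Unshelve. all: by end_near. Qed.

End boundary_conditions.

Unset Implicit Arguments.
Set Strict Implicit.

Theorem theorem2p21 (R : realType) (d : nat) (a b beta mu alpha : R)
    (bc : bcond)
    (gDir : nat -> R -> pointR R d -> pointR R d -> R)
    (dO : nat -> measure_display)
    (Omega : forall N : nat, measurableType (dO N))
    (P : forall N : nat, probability (Omega N) R)
    (X : forall N : nat, nat -> {RV (P N) >-> nat}) :
  (0 < d)%N -> 0 <= b -> b < a -> 0 < beta -> alpha <= 0 ->
  (bc = Dir -> forall N : nat, (0 < N)%N -> killed_density N (gDir N)) ->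
  (forall N : nat, (0 < N)%N ->
     independent_poisson (X N)
       (fun k => vol R d N * q_bc bc N (gDir N) beta alpha k.+1)) ->
  let E := fun K N : nat => mean_long d N K a b beta mu (nu_ref d N (X N)) in
  let F := tilted_pressure d a b beta mu alpha in
  ((\forall K \near \oo, derivable (F K) 0 1) ->
     exists Delta : R,
       iterated_lim E Delta /\ - derive1 (F K) 0 @[K --> \oo] --> Delta)
  /\
  (forall xi0 : nat -> R,
     (forall K : nat, (0 < K)%N ->
        exists (eps : R) (xi : R -> nat -> R),
          [/\ 0 < eps, C1_ell1 eps xi, xi 0 = xi0
            & forall s : R, - eps < s < eps ->
                is_minimiser (tilted_rate d a b beta mu alpha K s) (xi s)]) ->
     let Delta :=
       a / (a - b) * Num.max ((mu + alpha) / a - fine (D xi0)) 0 in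
     iterated_lim E Delta /\
     is_derive mu 1
       (fun m : R =>
          fine (H_HYL a b (m + alpha) xi0 - H_HYL_lsc a b (m + alpha) xi0)%E)
       Delta).
Proof.
move=> d0 b0 ba beta0 alpha0 kg XP E F.
have r_ge0 := q_bc_ge0 alpha beta0 kg.
have [rho_cvg r_le] := q_bc_le alpha beta0 kg.
have r_cvg := fun k => q_bc_cvg (alpha := alpha) d0 beta0 kg (k := k).
split; first exact: (iterated_lim_derive d0 b0 ba beta0 XP r_ge0 rho_cvg r_le r_cvg alpha0).
exact: (minimiser_curves d0 b0 ba beta0 XP r_ge0 rho_cvg r_le r_cvg alpha0).
Qed.
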